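(* Let $n \ge 5$, let $u,v\in V(Q_n)$ be vertices of opposite parity, and let $M$ be a matching of $Q_n$ spanning at most $5$ directions. Then $M$ can be extended to a Hamilton path of $Q_n$ between $u$ and $v$ (a Hamilton path with endpoints $u,v$ containing all edges of $M$) if and only if none of the conditions C1, C2, C3 holds.
   Context: $Q_n$ has vertex set $\{0,1\}^n$, two vertices adjacent iff they differ in exactly one coordinate; the parity of a vertex is the parity of its number of ones. The direction of edge $xy$ is the coordinate where $x,y$ differ; a matching spans at most $d$ directions if its edges lie in at most $d$ distinct directions. For a vertex $x$ and $i\in[n]$, $x^i$ denotes the vertex obtained by flipping coordinate $i$. A half-layer in direction $i$ is a set of the form $\{x x^i : x_i = 0,\ x \text{ has parity } p\}$ for a fixed parity $p$. For a vertex $u$, a $u$-avoiding almost half-layer in direction $i$ is $H\setminus\{uu^i\}$ where $H$ is the half-layer in direction $i$ containing $uu^i$. A vertex is covered by a set of edges if it is an endpoint of one of them. The C-conditions: C1: $M$ contains (as a subset) a half-layer $H$ and both $u$ and $v$ are covered by $H$. C2: there are directions $i\ne j$ such that $v=u^i$, $M$ contains the $u$-avoiding almost half-layer in direction $i$, and $uu^j\in M$ and $vv^j\in M$. C3: $uv\in M$. *)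

(* Defs.v *)
From mathcomp Require Import all_boot.

Set Implicit Arguments.
Unset Strict Implicit.
Unset Printing Implicit Defensive.

Notation cube n := {ffun 'I_n -> bool}.

Section Hypercube.

Variable n : nat.

Local Notation cube := (cube n).

Definition qadj : rel cube := [rel x y : cube | #|[set i | x i != y i]| == 1].

Definition parity (x : cube) : bool := odd #|[set i | x i]|.

Definition flip (x : cube) (i : 'I_n) : cube :=
  [ffun k => if k == i then ~~ x k else x k].

(* The undirected edge between x and y is the two-element set [set x; y]. *)
Definition qedges : {set {set cube}} :=
  [set e | [exists x, exists y, qadj x y && (e == [set x; y])]].

Definition matching (M : {set {set cube}}) : Prop :=
  (M \subset qedges) /\ trivIset M.

Definition directions (M : {set {set cube}}) : {set 'I_n} :=
  [set i | [exists x : cube, exists y : cube,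
             ([set x; y] \in M) && (x i != y i)]].

Definition half_layer (i : 'I_n) (p : bool) : {set {set cube}} :=
  [set [set x; flip x i] | x : cube & ~~ x i && (parity x == p)].

Definition covered (x : cube) (E : {set {set cube}}) : Prop :=
  exists2 e, e \in E & x \in e.

(* A is H \ {u u^i}, with H the half-layer in direction i containing u u^i. *)
Definition almost_half_layer (u : cube) (i : 'I_n) (A : {set {set cube}}) :
    Prop :=
  exists2 p, [set u; flip u i] \in half_layer i p
           & A = half_layer i p :\ [set u; flip u i].

Definition C1 (u v : cube) (M : {set {set cube}}) : Prop :=
  exists i p, [/\ half_layer i p \subset M,
                  covered u (half_layer i p) & covered v (half_layer i p)].

Definition C2 (u v : cube) (M : {set {set cube}}) : Prop :=
  exists i j : 'I_n,
    [/\ i != j, v = flip u i,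
        exists2 A, almost_half_layer u i A & A \subset M,
        [set u; flip u j] \in M & [set v; flip v j] \in M].

Definition C3 (u v : cube) (M : {set {set cube}}) : Prop := [set u; v] \in M.

(* In the next two definitions a path is given by its first vertex x and the
   sequence s of the vertices after x. *)
Definition path_edges (x : cube) (s : seq cube) : seq {set cube} :=
  [seq [set z.1; z.2] | z <- zip (x :: s) s].

Definition hamilton_path (u v : cube) (s : seq cube) : Prop :=
  [/\ path qadj u s, uniq (u :: s), forall x : cube, x \in u :: s
    & last u s = v].

Definition extends_to_hamilton_path (u v : cube) (M : {set {set cube}}) : Prop :=
  exists2 s, hamilton_path u v s & {subset M <= path_edges u s}.

End Hypercube.

(* Main.v *)
From HB Require Import structures.
Require Import Defs.
From mathcomp Require Import all_boot.
From Stdlib Require Import BinNat.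
From Stdlib Require List.

(** Necessity is a count: if [M] contains (almost) a whole half-layer [H] that
    meets both ends, every vertex of [H] lying in one of the two layers spends
    one of its two path edges on [H], and the vertices outside [H] then need
    more path neighbours than are left.

    Sufficiency is proved by induction on [n], in the stronger form that there
    are three different paths.  For [n > 5] some direction [d] is not used by [M]
    and cuts the cube into two halves.  If [d] separates [u] from [v], a path of
    each half is glued at a common vertex; only few vertices are unsuitable.  If
    it does not, a path of the half containing [u] and [v] is opened at an edge
    outside [M] and a path of the other half is inserted; three different paths
    cannot consist only of edges at which this is impossible, since those edges
    form two matchings and part of a 4-cycle.  If the half containing [u] and [v]
    violates C1 or C2, the matching there is almost a full direction, and the
    path to be opened is taken for a slightly smaller matching and rerouted.

    For [n = 5] the cube is cut along a direction carrying the fewest edges of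
    [M], hence at most three.  For each of the resulting configurations there is
    a list of crossing patterns of which any two maximal matchings of the halves
    admit at least three in common, unless C1 or C2 holds or [M] misses a
    direction; this is established by computation. *)

Set Implicit Arguments.
Unset Strict Implicit.
Unset Printing Implicit Defensive.

(** * Consecutive vertices of a path *)

(** The number 5 enters twice. For n > 5 it guarantees a direction free of [M] along which to cut,
    and for n = 5 the at most 16 edges of a matching, spread over five directions, leave one
    direction with at most three. The obstacle to the induction is that C1 and C2 do not pass to
    halves: a half may violate them although the cube does not. What keeps this under control is
    that, for n >= 5, no matching contains almost full half-layers in two different directions,
    since eight vertices would have to be matched in both. So for a given end either very few other
    ends are bad, or the matching is almost determined: a matching containing a half-layer uses a
    single direction, and all edges violating C2 lie on one 4-cycle. Three paths are carried along
    because two paths without a suitable edge can differ only in the way they go round that 4-cycle;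
    there are two ways, so a third path has such an edge. A path of a half is opened at an edge, but
    the argument only uses the two ends of the gap, which may also be far apart; the rerouted cases
    rely on this. *)

Section Linked.

Variable T : eqType.
Implicit Types (x y z : T) (p q : seq T).

Definition cons2 p x y := exists a b, p = a ++ x :: y :: b.
Definition linked p x y := cons2 p x y \/ cons2 p y x.

Lemma linkedC p x y : linked p x y -> linked p y x.
Proof. by case; [right|left]. Qed.

Lemma linked_rev p x y : linked p x y -> linked (rev p) x y.
Proof.
by case=> -[a [b ->]]; [right|left]; exists (rev b), (rev a);
  rewrite rev_cat !rev_cons -!cats1 -!catA.
Qed.

Lemma linked_catl p q x y : linked p x y -> linked (p ++ q) x y.
Proof.
by case=> -[a [b ->]]; [left|right]; exists a, (b ++ q); rewrite -catA.
Qed.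

Lemma linked_catr p q x y : linked q x y -> linked (p ++ q) x y.
Proof.
by case=> -[a [b ->]]; [left|right]; exists (p ++ a), b; rewrite -catA.
Qed.

Lemma cons2_cat p q x y : cons2 (p ++ q) x y ->
  [\/ cons2 p x y, cons2 q x y | (exists p', p = rcons p' x) /\ (exists q', q = y :: q')].
Proof.
case=> a [b]; elim: p a => [|z p IH] [|w a] /=.
- by move=> ->; constructor 2; exists [::], b.
- by move=> ->; constructor 2; exists (w :: a), b.
- case=> ->; case: p {IH} => [|z' p] /=.
    by move=> ->; constructor 3; split; [exists [::]|exists b].
  by case=> -> _; constructor 1; exists [::], p.
- case=> -> /IH[[a' [b' ->]]|c|[[p' ->] c]].
  + by constructor 1; exists (w :: a'), b'.
  + by constructor 2.
  + by constructor 3; split=> //; exists (w :: p').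
Qed.

Lemma linked_cat p q x y : linked (p ++ q) x y ->
  [\/ linked p x y, linked q x y
    | exists p' q' a b, [/\ p = rcons p' a, q = b :: q' & (x, y) = (a, b) \/ (x, y) = (b, a)]].
Proof.
case=> /cons2_cat[h|h|[[p' ep] [q' eq]]].
- by constructor 1; left.
- by constructor 2; left.
- by constructor 3; exists p', q', x, y; split=> //; left.
- by constructor 1; right.
- by constructor 2; right.
- by constructor 3; exists p', q', y, x; split=> //; right.
Qed.

Lemma linked_mem p x y : linked p x y -> (x \in p) && (y \in p).
Proof. by case=> -[a [b ->]]; rewrite !mem_cat !inE !eqxx !orbT. Qed.

Lemma cons2_index p x y : uniq p -> cons2 p x y -> index y p = (index x p).+1.
Proof.
move=> up [a [b e]]; move: up; rewrite e cat_uniq /= negb_or => /and3P[_ /andP[xa /norP[ya _]]].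
rewrite inE negb_or => /andP[/andP[xy _] _].
by rewrite !index_cat (negPf xa) (negPf ya) /= eqxx (negPf xy) eqxx addn0 addn1.
Qed.

Lemma linked_index p x y : uniq p -> linked p x y ->
  index y p = (index x p).+1 \/ index x p = (index y p).+1.
Proof. by move=> up [] h; [left|right]; apply: cons2_index. Qed.

Lemma cons2_path (e : rel T) x p y z : path e x p -> cons2 (x :: p) y z -> e y z.
Proof.
move=> + [a [b e']]; case: a e' => [|w a] [-> ->] /=; first by case/andP.
by rewrite cat_path /= => /and3P[_ _ /andP[]].
Qed.

End Linked.

Lemma linked_map (T U : eqType) (g : T -> U) (p : seq T) x y :
  linked p x y -> linked (map g p) (g x) (g y).
Proof.
by case=> -[a [b ->]]; [left|right]; exists (map g a), (map g b); rewrite map_cat.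
Qed.

(** * The cube *)

Section Cube.

Variable n : nat.
Implicit Types (m : cube n -> 'I_n -> bool) (x y z u v : cube n) (i j k : 'I_n) (s p q : seq (cube n)).

Lemma flipE x i k : flip x i k = x k (+) (k == i).
Proof. by rewrite ffunE; case: eqP => _; case: (x k). Qed.

Lemma flipK i : involutive (@flip n ^~ i).
Proof. by move=> x; apply/ffunP => k; rewrite !flipE -addbA addbb addbF. Qed.

Lemma flipC x i j : flip (flip x i) j = flip (flip x j) i.
Proof. by apply/ffunP => k; rewrite !flipE addbAC. Qed.

Lemma flip_injr x i j : flip x i = flip x j -> i = j.
Proof.
move=> /ffunP/(_ i); rewrite !flipE eqxx => /addbI.
by case: eqP.
Qed.

Lemma flip_neq x i : flip x i != x.
Proof.
apply/eqP => /ffunP/(_ i); rewrite flipE eqxx addbT.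
by case: (x i).
Qed.

Lemma parityE x : parity x = \big[addb/false]_i x i.
Proof.
rewrite /parity -sum1_card big_mkcond (big_morph odd oddD (erefl _)).
by apply: eq_bigr => i _; rewrite inE; case: (x i).
Qed.

Lemma parity_flip x i : parity (flip x i) = ~~ parity x.
Proof.
rewrite !parityE (eq_bigr (fun k => x k (+) (k == i))); last by move=> k _; rewrite flipE.
rewrite big_split /= [X in _ (+) X](_ : _ = true) ?addbT //.
by rewrite (bigD1 i) //= eqxx big1 // => k /negPf->.
Qed.

Lemma qadjP x y : reflect (exists i, y = flip x i) (qadj x y).
Proof.
apply: (iffP idP) => [/cards1P[i /setP xyE]|[i ->]].
  exists i; apply/ffunP => k; rewrite flipE; move: (xyE k); rewrite !inE => <-.
  by case: (x k) (y k) => [] [].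
apply/cards1P; exists i; apply/setP => k; rewrite !inE flipE.
by case: (x k) (k == i) => [] [].
Qed.

Lemma qadj_flip x i : qadj x (flip x i).
Proof. by apply/qadjP; exists i. Qed.

Lemma qadj_sym : symmetric (@qadj n).
Proof.
by move=> x y; apply/qadjP/qadjP => -[i ->]; exists i; rewrite flipK.
Qed.

Definition typ i x := x i (+) parity x.

Lemma typ_flip i j x : typ i (flip x j) = typ i x (+) (i != j).
Proof.
rewrite /typ parity_flip flipE; case: eqP; by case: (x i) (parity x) => [] [].
Qed.

(* Matchings are handled through the predicate [m x i]: the edge between [x]
   and [flip x i] belongs to the matching. *)
Definition ismat m :=
  (forall x i, m (flip x i) i = m x i) /\
  (forall x i j, m x i -> m x j -> i = j).

(* Both ends of an edge of direction i have the same [typ i], and the two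
   half-layers of direction i are the two values of [typ i]. *)
Definition hlayer m i t :=
  [forall x, (typ i x == t) ==> m x i].

Definition c1 m u v := [exists i, (typ i v == typ i u) && hlayer m i (typ i u)].
Definition c2 m u v :=
  [exists i, exists j, [&& i != j, v == flip u i, m u j, m v j &
     [forall x, [&& typ i x == typ i u, x != u & x != v] ==> m x i]]].
Definition c3 m u v :=
  [exists i, (v == flip u i) && m u i].
Definition good m u v := ~~ [|| c1 m u v, c2 m u v | c3 m u v].

Lemma c1P m u v :
  reflect (exists2 i, typ i v = typ i u & forall x, typ i x = typ i u -> m x i) (c1 m u v).
Proof.
apply: (iffP existsP) => [[i /andP[/eqP tv /forallP h]]|[i tv h]]; exists i.
- exact: tv.
- by move=> x /eqP tx; move/implyP: (h x); apply.
- by rewrite tv eqxx; apply/forallP => x; apply/implyP => /eqP; apply: h.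
Qed.

Lemma c2P m u v :
  reflect (exists i j, [/\ i != j, v = flip u i, m u j, m v j &
     forall x, typ i x = typ i u -> x <> u -> x <> v -> m x i]) (c2 m u v).
Proof.
apply: (iffP existsP) => [[i /existsP[j /and5P[ij /eqP vu mu mv /forallP h]]]|].
  exists i, j; split=> // x tx xu xv; move/implyP: (h x); apply.
  by rewrite tx eqxx /=; apply/andP; split; apply/eqP.
move=> [i [j [ij vu mu mv h]]]; exists i; apply/existsP; exists j.
rewrite ij mu mv vu eqxx /=; apply/forallP => x; apply/implyP.
by case/and3P => /eqP tx /eqP xu /eqP xv; apply: h => //; rewrite vu.
Qed.

Lemma c3P m u v : reflect (exists2 i, v = flip u i & m u i) (c3 m u v).
Proof.
by apply: (iffP existsP) => [[i /andP[/eqP]]|[i -> h]]; exists i; rewrite ?eqxx.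
Qed.

Lemma goodP m u v : good m u v <-> [/\ ~ c1 m u v, ~ c2 m u v & ~ c3 m u v].
Proof.
by rewrite /good; split; case: (c1 _ _ _) (c2 _ _ _) (c3 _ _ _) => [] [] [] // [].
Qed.

Lemma c1_sym m u v : c1 m u v -> c1 m v u.
Proof. by case/c1P => i tv h; apply/c1P; exists i => // x; rewrite tv; apply: h. Qed.

Lemma c2_sym m u v : c2 m u v -> c2 m v u.
Proof.
case/c2P => i [j [ij vu mu mv h]]; apply/c2P; exists i, j; split=> //.
  by rewrite vu flipK.
by move=> x; rewrite vu typ_flip eqxx addbF => tx xu xv; apply: h => //; rewrite vu.
Qed.

Lemma good_sym m u v : ismat m -> good m u v -> good m v u.
Proof.
move=> [ms _] /goodP[g1 g2 g3]; apply/goodP; split.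
- by move/c1_sym.
- by move/c2_sym.
- by case/c3P => i uv h; apply: g3; apply/c3P; exists i; rewrite uv ?flipK // ms.
Qed.

Definition ham m u v s :=
  hamilton_path u v s /\ forall x i, m x i -> linked (u :: s) x (flip x i).

Definition ham3 m u v := exists s1 s2 s3,
  [/\ ham m u v s1, ham m u v s2 & ham m u v s3] /\ [/\ s1 <> s2, s1 <> s3 & s2 <> s3].

Lemma ham_size m u v s : ham m u v s -> size (u :: s) = 2 ^ n.
Proof.
case=> -[_ us all _] _.
transitivity #|[set: cube n]|; last by rewrite cardsT card_ffun card_bool card_ord.
by rewrite -(card_uniqP us); apply: eq_card => x; rewrite all inE.
Qed.

End Cube.

(** * Necessity: counting path neighbours in a layer *)

Section Necessity.

Variables (n : nat) (m : cube n -> 'I_n -> bool) (u v : cube n) (s : seq (cube n)).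
Hypotheses (n3 : 2 < n) (mm : ismat m) (hs : ham m u v s).

Let p := u :: s.
(** Path adjacency is expressed by positions, so that a vertex visibly has at most two neighbours
    and [u], at position 0, only one. *)
Let nb x y := (index x p == (index y p).+1) || (index y p == (index x p).+1).

Let up : uniq p. Proof. by case: hs => -[]. Qed.
Let inp x : x \in p. Proof. by case: hs => -[]. Qed.
Let sz : size s = (2 ^ n).-1. Proof. by rewrite -(ham_size hs). Qed.
Let iu : index u p = 0. Proof. by rewrite /= eqxx. Qed.
Let iv : index v p = size s.
Proof. by case: hs => -[_ _ _ <-] _; rewrite index_last. Qed.
Let szge : 7 <= size s.
Proof. by rewrite sz -ltnS prednK ?expn_gt0 // (@leq_exp2l 2 3). Qed.
Let injx x y : index x p = index y p -> x = y.
Proof. by move=> e; rewrite -(nth_index u (inp x)) e nth_index. Qed.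

Let nbC x y : nb x y = nb y x. Proof. by rewrite /nb orbC. Qed.
Let nbm x i : m x i -> nb x (flip x i).
Proof.
by case: hs => _ h /h /(linked_index up) [] e; rewrite /nb -/p e !eqxx ?orbT.
Qed.

Let nb_adj x y : nb x y -> qadj x y.
Proof.
wlog e : x y / index y p = (index x p).+1 => [H|_].
  by case/orP => /eqP e; [rewrite qadj_sym|]; apply: H; rewrite // /nb e eqxx ?orbT.
case: hs => -[/pathP h _ _ _] _.
have xs : index x p < size s by move: (index_mem y p); rewrite inp e ltnS.
have ey : nth u s (index x p) = y.
  by rewrite -[nth u s _]/(nth u p (index x p).+1) -e nth_index.
by have := h u _ xs; rewrite ey nth_index.
Qed.

Let nb2 y : y != u -> y != v -> exists w1 w2, [/\ w1 != w2, nb y w1 & nb y w2].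
Proof.
move=> yu yv; have i0 : 0 < index y p.
  by rewrite lt0n; apply: contra yu => /eqP e; apply/eqP/injx; rewrite e iu.
have i1 : index y p < size s.
  rewrite ltn_neqAle -iv; apply/andP; split.
    by apply: contra yv => /eqP /injx ->.
  by rewrite iv; move: (index_mem y p); rewrite inp ltnS.
have ix k : k < size p -> index (nth u p k) p = k by move=> kp; apply: index_uniq.
have sp : (index y p).+1 < size p by rewrite ltnS.
have sp' : (index y p).-1 < size p by apply: leq_ltn_trans (ltnW sp); rewrite leq_pred.
exists (nth u p (index y p).+1), (nth u p (index y p).-1); split.
- rewrite nth_uniq // eq_sym neq_ltn; apply/orP; left.
  by rewrite ltnS leq_pred.
- by rewrite /nb ix // eqxx orbT.
- by rewrite /nb ix // prednK // eqxx.
Qed.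

Let nb3 x a b c : nb x a -> nb x b -> nb x c -> [\/ a = b, a = c | b = c].
Proof.
move=> /orP[] /eqP ha /orP[] /eqP hb /orP[] /eqP hc;
  try (by constructor 1; apply: injx; apply: succn_inj; rewrite -ha -hb);
  try (by constructor 2; apply: injx; apply: succn_inj; rewrite -ha -hc);
  try (by constructor 3; apply: injx; apply: succn_inj; rewrite -hb -hc);
  try (by constructor 1; apply: injx; rewrite ha hb);
  try (by constructor 2; apply: injx; rewrite ha hc);
  by constructor 3; apply: injx; rewrite hb hc.
Qed.

Let nbu a b : nb u a -> nb u b -> a = b.
Proof.
by rewrite /nb iu => /orP[//|/eqP ea] /orP[//|/eqP eb]; apply: injx; rewrite ea eb.
Qed.

Lemma ham_not_c3 : ~~ c3 m u v.
Proof.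
apply/negP => /c3P[i vu /nbm]; rewrite -vu /nb iu iv => /orP[//|/eqP e].
by move: szge; rewrite e.
Qed.

Section Layer.

Variable i : 'I_n.
(** [Y] and [X] are the two parity classes of the layer of [u]. The path edges of direction [i]
    leave the layer, so the vertices of [Y] have to find their remaining path neighbours in [X],
    which is no larger than [Y]. *)
Let Y := [set y : cube n | (y i == u i) && (parity y != parity u)].
Let X := [set y : cube n | (y i == u i) && (parity y == parity u)].
Hypothesis hX : forall x, x \in X -> x != u -> nb x (flip x i).
Hypothesis vY : v \notin Y.

Let cardXY : #|X| = #|Y|.
Proof.
have [k ki] : exists k : 'I_n, k != i.
  have h0 : 0 < n by apply: ltn_trans n3.
  have h1 : 1 < n by apply: ltn_trans n3.
  case: (eqVneq (Ordinal h0) i) => [<-|]; last by exists (Ordinal h0).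
  by exists (Ordinal h1).
rewrite -(card_imset (mem X) (can_inj (@flipK n k))); apply: eq_card => y.
apply/imsetP/idP => [[x]|].
  rewrite !inE => /andP[/eqP xu /eqP px] ->.
  by rewrite flipE [i == k]eq_sym (negPf ki) addbF xu eqxx parity_flip px; case: (parity u).
rewrite !inE => /andP[/eqP yu py]; exists (flip y k); last by rewrite flipK.
rewrite !inE flipE [i == k]eq_sym (negPf ki) addbF yu eqxx parity_flip.
by move: py; case: (parity y) (parity u) => [] [].
Qed.

Let inlayer y w : y \in Y -> nb y w -> w != flip y i -> w \in X.
Proof.
rewrite !inE => /andP[/eqP yu py] /nb_adj/qadjP[k ->] wk.
have ki : k != i by apply: contra wk => /eqP->.
rewrite flipE [i == k]eq_sym (negPf ki) addbF yu eqxx parity_flip.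
by move: py; case: (parity y) (parity u) => [] [].
Qed.

Let flipX w y : w \in X -> y \in Y -> y != flip w i.
Proof.
rewrite !inE => /andP[/eqP wu _] /andP[/eqP yu _]; apply/eqP => /ffunP/(_ i).
by rewrite flipE eqxx addbT wu yu; case: (u i).
Qed.

(* The in-layer neighbours of [Y] on the path are pairwise different, because
   every vertex of [X] but [u] already has a neighbour outside the layer. *)
Let layer_inj (G Z : {set cube n}) : G \subset Y -> u \in Z ->
  (forall y w, y \in G -> nb y w -> w \in X -> w \notin Z) -> #|G| <= #|X :\: Z|.
Proof.
move=> /subsetP GY uZ hZ; pose h y := odflt y [pick w | nb y w && (w != flip y i)].
have hP y : y \in G -> nb y (h y) /\ h y != flip y i.
  move=> yG; have yY := GY _ yG; rewrite /h; case: pickP => [w /andP[]|h0] //=.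
  have yu : y != u by apply: contraTneq yY => ->; rewrite !inE !eqxx.
  have yv : y != v by apply: contraTneq yY => ->.
  have [w1 [w2 [w12 h1 h2]]] := nb2 yu yv.
  move: (h0 w1) (h0 w2); rewrite h1 h2 /= => /negbFE/eqP e1 /negbFE/eqP e2.
  by move: w12; rewrite e1 e2 eqxx.
have hX' y : y \in G -> h y \in X.
  by move=> yG; have [? ?] := hP _ yG; apply: inlayer (GY _ yG) _ _.
have hi : {in G &, injective h}; last first.
  rewrite -(card_in_imset hi); apply: subset_leq_card; apply/subsetP => w /imsetP[y yG ->].
  by rewrite inE hX' // andbT; apply: hZ (yG) _ _; [case: (hP _ yG)|apply: hX'].
move=> y y' yG yG' e.
have wu : h y != u.
  by apply: contraTneq uZ => <-; apply: hZ (yG) _ _; [case: (hP _ yG)|apply: hX'].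
have [n1 _] := hP _ yG; have [n2 _] := hP _ yG'; rewrite -e in n2.
rewrite nbC in n1; rewrite nbC in n2.
case: (nb3 n1 n2 (hX (hX' _ yG) wu)) => // e'.
  by move: (flipX (hX' _ yG) (GY _ yG)); rewrite {1}e' eqxx.
by move: (flipX (hX' _ yG) (GY _ yG')); rewrite {1}e' eqxx.
Qed.

Let uX : u \in X. Proof. by rewrite !inE !eqxx. Qed.

(** The only path neighbour of [u] lies outside the layer, so no vertex of [Y] is served by [u]: all
    of [Y] would inject into [X] without [u]. *)
Lemma layer_c1 : nb u (flip u i) -> False.
Proof.
move=> nu; have : #|Y| <= #|X :\: [set u]|.
  apply: layer_inj; rewrite ?inE // => y w yY nw wX; rewrite inE; apply/eqP => wu.
  move: nw; rewrite wu nbC => nw.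
  by move: (flipX uX yY); rewrite (nbu nu nw) eqxx.
by rewrite -cardXY (cardsD1 u X) uX ltnn.
Qed.

(** Now [u] serves [y0], the flip of [u] along [j]. If the second path neighbour [z] of [y0] is in
    the layer, both [u] and [z] are used up by [y0], and the other vertices of [Y] would inject into
    [X] without two elements. Otherwise [z] is the neighbour of [v] along [j], and the path is just
    [u], [y0], [z], [v], which is too short. *)
Lemma layer_c2 j : i != j -> v = flip u i -> nb u (flip u j) -> nb v (flip v j) -> False.
Proof.
move=> ij vu nu nv; set y0 := flip u j in nu.
have y0Y : y0 \in Y.
  by rewrite !inE flipE (negPf ij) addbF eqxx parity_flip; case: (parity u).
have y0u : y0 != u by apply: flip_neq.
have y0v : y0 != v by apply: contraTneq y0Y => ->.
have [z zu nz] : exists2 z, z != u & nb y0 z.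
  have [w1 [w2 [w12 h1 h2]]] := nb2 y0u y0v.
  by case: (eqVneq w1 u) w12 => [-> w2u|]; [exists w2; rewrite // eq_sym|exists w1].
have [ze|ze] := eqVneq z (flip y0 i); last first.
  have zX := inlayer y0Y nz ze.
  have : #|Y :\ y0| <= #|X :\: [set u; z]|.
    apply: layer_inj; rewrite ?subD1set ?inE ?eqxx // => y w.
    rewrite inE => /andP[]; rewrite inE => yy0 yY nw wX; rewrite !inE; apply/norP; split.
      apply: contraTneq nw => ->; rewrite nbC; apply: contra yy0 => nw.
      by rewrite (nbu nw nu).
    apply: contraTneq nw => ->; rewrite nbC; apply: contra yy0 => nw.
    rewrite nbC in nz; case: (nb3 nw nz (hX zX zu)) => [->//|e|e].
      by move: (flipX zX yY); rewrite {1}e eqxx.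
    by move: (flipX zX y0Y); rewrite {1}e eqxx.
  rewrite setDUr.
  move: cardXY; rewrite (cardsD1 u X) uX (cardsD1 y0 Y) y0Y => /addnI e.
  rewrite -e (cardsD1 z (X :\ u)) !inE zu; move: zX; rewrite !inE => -> /=.
  have -> : (X :\ u) :&: (X :\ z) = X :\ u :\ z.
    by apply/setP => w; rewrite !(in_setI, in_setD1); case: (w \in X);
       rewrite ?andbT ?andbF // andbC.
  by rewrite add1n ltnn.
have zv : z = flip v j by rewrite ze vu /y0 flipC.
move: nu nz nv; rewrite -zv /nb iu => /orP[//|/eqP e1].
rewrite e1 => /orP[/eqP[e]|/eqP e2].
  by move: zu; rewrite -[z == u]/(z == u) (injx (etrans (esym e) (esym iu))) eqxx.
rewrite e2 iv => /orP[] /eqP e; first by move: szge; rewrite e.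
have: v = y0 by apply: injx; rewrite iv e1; apply: succn_inj; rewrite -e.
by move=> e'; rewrite e' eqxx in y0v.
Qed.

End Layer.

Lemma ham_good : good m u v.
Proof.
apply/goodP; split; last by apply/negP/ham_not_c3.
  case/c1P => i tv h.
  apply: (@layer_c1 i); last by apply: nbm; apply: h.
    move=> x; rewrite !inE => /andP[/eqP xu /eqP px] _; apply: nbm; apply: h.
    by rewrite /typ xu px.
  rewrite !inE; apply/negP => /andP[/eqP vu pv]; move: tv; rewrite /typ vu.
  by move/addbI => e; rewrite e eqxx in pv.
case/c2P => i [j [ij vu mu mv h]].
have viu : v i != u i by rewrite vu flipE eqxx addbT; case: (u i).
apply: (@layer_c2 i _ _ j ij vu); [|by rewrite !inE (negPf viu)|exact: nbm|exact: nbm].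
move=> x; rewrite !inE => /andP[/eqP xu /eqP px] xnu; apply: nbm; apply: h.
- by rewrite /typ xu px.
- exact/eqP.
- by move=> e; move: viu; rewrite -e xu eqxx.
Qed.

End Necessity.

(** * Gluing paths of the two halves of a cube *)

Section Weave.

(** A half is an abstract type [T] with two embeddings, because the gluing serves twice: for halves
    of a cube of any dimension (through [ins]) and for the computational model of Q4 (through
    [Phi]). *)
Variables (n : nat) (T : eqType) (adj : rel T) (f : bool -> T -> cube n).
Hypotheses (fadj : forall b x y, adj x y -> qadj (f b x) (f b y))
  (fcross : forall b x, qadj (f b x) (f (~~ b) x))
  (finj : forall b b' x x', f b x = f b' x' -> b = b' /\ x = x')
  (fsurj : forall z, exists b x, z = f b x).
Implicit Types (ps : seq (seq T)) (p : seq T) (x y z : T) (b : bool).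

(* The pieces of [ps] lie alternately in the copies [b] and [~~ b] of [T]. *)
Fixpoint weave b ps : seq (cube n) :=
  if ps is p :: ps' then map (f b) p ++ weave (~~ b) ps' else [::].

Fixpoint sidecat b ps : seq T :=
  if ps is p :: ps' then (if b then p else [::]) ++ sidecat (~~ b) ps' else [::].

Fixpoint slinked b ps x y : Prop :=
  if ps is p :: ps' then (b /\ linked p x y) \/ slinked (~~ b) ps' x y else False.

(** A step between the copies keeps the element of [T], hence each piece starts with the element at
    which the previous one ended. *)
Fixpoint chain x ps y : Prop :=
  if ps is p :: ps' then
    exists t, [/\ p = x :: t, path adj x t
                & if ps' is [::] then last x t = y else chain (last x t) ps' y]
  else False.

Fixpoint crossing z ps : seq T :=
  if ps is p :: ps' then
    if ps' is [::] then [::] else last z p :: crossing z ps'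
  else [::].

Lemma mem_weave b b' x ps : (f b' x \in weave b ps) = (x \in sidecat (b' == b) ps).
Proof.
elim: ps b => [|p ps IH] b //=; rewrite !mem_cat IH; congr (_ || _); last first.
  by congr (_ \in sidecat _ _); case: (b) (b') => [] [].
case: eqP => [->|bb].
  by apply: mem_map => y z /finj[].
by apply/mapP => -[y _ /finj[]].
Qed.

Lemma weave_uniq b ps : uniq (sidecat true ps) -> uniq (sidecat false ps) -> uniq (weave b ps).
Proof.
elim: ps b => [|p ps IH] b //=; rewrite cat_uniq => /and3P[up dp u1] u2.
rewrite cat_uniq IH // andbT map_inj_uniq ?up /=; last by move=> x y /finj[].
apply: contra dp => /hasP[z zw /mapP[x xp zx]]; apply/hasP; exists x => //.
by move: zw; rewrite zx mem_weave; case: (b).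
Qed.

Lemma weave_path b ps x y : chain x ps y ->
  exists s, [/\ weave b ps = f b x :: s, path (@qadj n) (f b x) s
              & last (f b x) s = f (b (+) ~~ odd (size ps)) y].
Proof.
elim: ps b x => [|p ps IH] b x //= [t [-> xt]].
have pt : path (@qadj n) (f b x) (map (f b) t).
  by rewrite path_map; apply: sub_path xt => z z'; apply: fadj.
case: ps IH => [_ <-|q ps IH ch].
  by exists (map (f b) t); rewrite cats0 last_map addbF.
have [s [-> ps' ls]] := IH (~~ b) _ ch.
exists (map (f b) t ++ f (~~ b) (last x t) :: s); split => //.
  by rewrite cat_path pt last_map /= fcross.
by rewrite last_cat /= ls /= negbK; case: (b) (odd _) => [] [].
Qed.

Lemma weave_linked b b' ps x y :
  slinked (b' == b) ps x y -> linked (weave b ps) (f b' x) (f b' y).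
Proof.
elim: ps b => [|p ps IH] b //= [[/eqP-> h]|h].
  by apply: linked_catl; apply: linked_map.
apply: linked_catr; apply: IH; move: h; congr slinked.
by case: (b) (b') => [] [].
Qed.

Lemma weave_cross b b' ps x y z0 z : chain x ps y -> z \in crossing z0 ps ->
  linked (weave b ps) (f b' z) (f (~~ b') z).
Proof.
elim: ps b x => [|p ps IH] b x //= [t [-> xt]].
case: ps IH => [//|q ps] IH ch; rewrite inE => /predU1P[->|zc]; last first.
  by apply: linked_catr; apply: IH ch _.
have [s [-> _ _]] := weave_path (~~ b) ch.
have h : linked (map (f b) (x :: t) ++ f (~~ b) (last x t) :: s)
                (f b (last x t)) (f (~~ b) (last x t)).
  left; exists (map (f b) (belast x t)), s.
  by rewrite lastI map_rcons -cats1 -catA.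
case: (eqVneq b' b) => [->//|bb].
have -> : b' = ~~ b by case: (b) (b') bb => [] [].
by rewrite negbK; apply: linkedC.
Qed.

(** The pieces are the maximal runs inside one copy and can be read off the woven path. An empty
    piece would merge its two neighbours, hence the nonemptiness assumptions. This is how different
    paths are told apart after gluing. *)
Lemma weave_inj b ps ps' : weave b ps = weave b ps' ->
  all (fun p => p != [::]) ps -> all (fun p => p != [::]) ps' -> ps = ps'.
Proof.
have hd p p' w w' c : map (f c) p ++ w = map (f c) p' ++ w' ->
    (if w is z :: _ then exists x, z = f (~~ c) x else True) ->
    (if w' is z :: _ then exists x, z = f (~~ c) x else True) -> p = p' /\ w = w'.
  elim: p p' => [|x p IH] [|x' p'] //= e.
  - by rewrite e => -[x'' /finj[]]; case: (c).
  - by rewrite -e => _ [x'' /finj[]]; case: (c).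
  - by case: e => /finj[_ ->] /IH e h h'; have [-> ->] := e h h'.
have nw c qs : all (fun p => p != [::]) qs ->
    if weave c qs is z :: _ then exists x, z = f c x else True.
  by case: qs => [|[|x q] qs] //= _; exists x.
elim: ps ps' b => [|p ps IH] [|p' ps'] b //=.
- by case: p'.
- by case: p.
move=> e /andP[_ h] /andP[_ h'].
by have [-> /IH->] := hd _ _ _ _ _ e (nw _ _ h) (nw _ _ h').
Qed.

Lemma weave_ham (m : cube n -> 'I_n -> bool) b ps x y : chain x ps y ->
  uniq (sidecat true ps) -> uniq (sidecat false ps) ->
  (forall z, z \in sidecat true ps) -> (forall z, z \in sidecat false ps) ->
  (forall w i, m w i -> linked (weave b ps) w (flip w i)) ->
  exists2 s, weave b ps = f b x :: s & ham m (f b x) (f (b (+) ~~ odd (size ps)) y) s.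
Proof.
move=> ch u1 u2 a1 a2 hm; have [s [es pt ls]] := weave_path b ch.
exists s => //; split; last by rewrite -es.
split=> //; first by rewrite -es weave_uniq.
move=> z; have [b' [x' ->]] := fsurj z.
by rewrite -es mem_weave; case: eqP.
Qed.

End Weave.

(** * Coordinates of the two halves along a direction *)

Section Split.

Variables (n : nat) (d : 'I_n.+1).
Implicit Types (b : bool) (x y : cube n) (i j : 'I_n) (z w : cube n.+1).

Definition ins b x : cube n.+1 := [ffun k => if unlift d k is Some j then x j else b].
Definition proj z : cube n := [ffun j => z (lift d j)].

Lemma ins_d b x : ins b x d = b.
Proof. by rewrite ffunE unlift_none. Qed.

Lemma ins_lift b x j : ins b x (lift d j) = x j.
Proof. by rewrite ffunE liftK. Qed.

Lemma insK b : cancel (ins b) proj.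
Proof. by move=> x; apply/ffunP => j; rewrite ffunE ins_lift. Qed.

Lemma projK z : ins (z d) (proj z) = z.
Proof.
apply/ffunP => k; case: (unliftP d k) => [j|] ->; first by rewrite ins_lift ffunE.
by rewrite ins_d.
Qed.

Lemma ins_inj b b' x x' : ins b x = ins b' x' -> b = b' /\ x = x'.
Proof.
move=> e; split; first by rewrite -(ins_d b x) e ins_d.
by rewrite -(insK b x) e insK.
Qed.

Lemma flip_ins_d b x : flip (ins b x) d = ins (~~ b) x.
Proof.
apply/ffunP => k; rewrite flipE; case: (unliftP d k) => [j|] ->.
  by rewrite !ins_lift eq_sym (negPf (neq_lift _ _)) addbF.
by rewrite !ins_d eqxx addbT.
Qed.

Lemma flip_ins_lift b x j : flip (ins b x) (lift d j) = ins b (flip x j).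
Proof.
apply/ffunP => k; rewrite flipE; case: (unliftP d k) => [i|] ->.
  by rewrite !ins_lift flipE (inj_eq (@lift_inj _ d)).
by rewrite !ins_d (negPf (neq_lift _ _)) addbF.
Qed.

Lemma parity_ins b x : parity (ins b x) = b (+) parity x.
Proof.
rewrite !parityE (bigD1_ord d) //= ins_d; congr (_ (+) _).
by apply: eq_bigr => j _; rewrite ins_lift.
Qed.

(** A half-layer of the whole cube restricts to half-layers of opposite type in the two halves; so
    half-layers found in both halves join to one of the cube only if their types are opposite. *)
Lemma typ_lift b x j : typ (lift d j) (ins b x) = b (+) typ j x.
Proof. by rewrite /typ ins_lift parity_ins addbCA. Qed.

Lemma qadj_ins b x y : qadj x y -> qadj (ins b x) (ins b y).
Proof. by case/qadjP => j ->; rewrite -flip_ins_lift qadj_flip. Qed.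

Lemma qadj_ins_d b x : qadj (ins b x) (ins (~~ b) x).
Proof. by rewrite -flip_ins_d qadj_flip. Qed.

Lemma ins_surj z : exists b x, z = ins b x.
Proof. by exists (z d), (proj z); rewrite projK. Qed.

Variable m : cube n.+1 -> 'I_n.+1 -> bool.

Definition side b x j := m (ins b x) (lift d j).

Lemma side_ismat b : ismat m -> ismat (side b).
Proof.
move=> [ms mu]; split=> [x i|x i j h h']; first by rewrite /side -flip_ins_lift ms.
by apply: (@lift_inj _ d); apply: mu h h'.
Qed.

End Split.

(** * The induction step *)

Definition dset n (m : cube n -> 'I_n -> bool) := [set i | [exists x, m x i]].

Definition few_directions_extend n :=
  forall (m : cube n -> 'I_n -> bool) u v, ismat m -> #|dset m| <= 5 ->
    parity u != parity v -> good m u v -> ham3 m u v.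

Section Glue.

Variables (n : nat) (d : 'I_n.+1) (m : cube n.+1 -> 'I_n.+1 -> bool).
Hypotheses (mm : ismat m) (du : forall x, ~~ m x d).
Variables (u v : cube n.+1).

Lemma side_dset b : #|dset (side d m b)| <= #|dset m|.
Proof.
rewrite -(card_imset _ (@lift_inj _ d)); apply: subset_leq_card.
apply/subsetP => _ /imsetP[j + ->]; rewrite !inE => /existsP[x h].
by apply/existsP; exists (ins d b x).
Qed.

Lemma unused_linked b ps :
  (forall b' x j, side d m b' x j -> slinked (b' == b) ps x (flip x j)) ->
  forall w i, m w i -> linked (weave (ins d) b ps) w (flip w i).
Proof.
move=> h w i; case: (unliftP d i) => [j|] -> mwi; last by rewrite (negPf (du w)) in mwi.
have [b' [x e]] := ins_surj d w; move: mwi; rewrite e => mwi.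
by rewrite flip_ins_lift; apply: weave_linked; apply: h.
Qed.

Lemma glueS x s0 s1 : v d = ~~ u d ->
  ham (side d m (u d)) (proj d u) x s0 -> ham (side d m (v d)) x (proj d v) s1 ->
  exists2 s, weave (ins d) (u d) [:: proj d u :: s0; x :: s1] = u :: s & ham m u v s.
Proof.
move=> vd [[p0 u0 a0 l0] h0] [[p1 u1 a1 l1] h1].
set ps := [:: _; _].
have ch : chain (@qadj n) (proj d u) ps (proj d v).
  by exists s0; split=> //=; rewrite l0; exists s1.
have := weave_ham (@qadj_ins _ d) (@qadj_ins_d _ d) (@ins_inj _ d) (@ins_surj _ d) (m := m) (b := u d) ch.
have -> : u d (+) ~~ odd (size ps) = v d by rewrite addbT vd.
rewrite !projK; apply=> //.
- by rewrite /= cats0.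
- by rewrite /= cats0.
- by move=> z; rewrite /= cats0.
- by move=> z; rewrite /= cats0.
apply: unused_linked => b' y j; case: (eqVneq b' (u d)) => [->|bb] sy /=.
  by left; split=> //; apply: h0.
right; left; split=> //; apply: h1; rewrite vd.
by have <- : b' = ~~ u d by case: (b') (u d) bb => [] [].
Qed.

(** The half of [u] and [v] is covered by two pieces and the gap between them is bridged by a
    Hamilton path of the other half. The ends of the gap need not be adjacent. *)
Lemma glueN t1 y t2 s1 : v d = u d ->
  path (@qadj n) (proj d u) t1 -> path (@qadj n) y t2 -> last y t2 = proj d v ->
  uniq ((proj d u :: t1) ++ (y :: t2)) -> (forall x, x \in (proj d u :: t1) ++ (y :: t2)) ->
  (forall x j, side d m (u d) x j ->
     linked (proj d u :: t1) x (flip x j) \/ linked (y :: t2) x (flip x j)) ->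
  ham (side d m (~~ u d)) (last (proj d u) t1) y s1 ->
  exists2 s, weave (ins d) (u d)
      [:: proj d u :: t1; last (proj d u) t1 :: s1; y :: t2] = u :: s & ham m u v s.
Proof.
move=> vd p1 p2 l2 up ap h0 [[p3 u3 a3 l3] h3].
set ps := [:: _; _; _].
have ch : chain (@qadj n) (proj d u) ps (proj d v).
  by exists t1; split=> //=; exists s1; split=> //; rewrite l3; exists t2.
have := weave_ham (@qadj_ins _ d) (@qadj_ins_d _ d) (@ins_inj _ d) (@ins_surj _ d) (m := m) (b := u d) ch.
have -> : u d (+) ~~ odd (size ps) = v d by rewrite addbF vd.
rewrite !projK; apply=> //.
- by rewrite /= cats0.
- by rewrite /= cats0.
- by move=> z; rewrite /= cats0 -cat_cons.
- by move=> z; rewrite /= cats0.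
apply: unused_linked => b' x j; case: (eqVneq b' (u d)) => [->|bb] sx /=.
  by case: (h0 _ _ sx) => h; [left|right; right; left].
right; left; split=> //; apply: h3.
by have <- : b' = ~~ u d by case: (b') (u d) bb => [] [].
Qed.

(** One path per crossing vertex is enough: different crossing vertices give different pieces, hence
    different paths. *)
Lemma ham3S (xs : seq (cube n)) : v d = ~~ u d -> uniq xs -> 2 < size xs ->
  (forall x, x \in xs -> ham3 (side d m (u d)) (proj d u) x /\
                         ham3 (side d m (v d)) x (proj d v)) -> ham3 m u v.
Proof.
move=> vd; case: xs => [|x1 [|x2 [|x3 xs]]] // + _ h.
rewrite /= !inE !negb_or => /and3P[/and3P[/eqP x12 /eqP x13 _] /andP[/eqP x23 _] _].
have g x : x \in [:: x1, x2, x3 & xs] -> exists s s0 s1,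
    [/\ weave (ins d) (u d) [:: proj d u :: s0; x :: s1] = u :: s & ham m u v s].
  case/h => -[s0 [_ [_ [[h0 _ _] _]]]] [s1 [_ [_ [[h1 _ _] _]]]].
  by have [s e hs] := glueS vd h0 h1; exists s, s0, s1.
have m1 : x1 \in [:: x1, x2, x3 & xs] by rewrite !inE eqxx.
have [s1 [a1 [b1 [e1 H1]]]] := g x1 m1.
have m2 : x2 \in [:: x1, x2, x3 & xs] by rewrite !inE eqxx orbT.
have [s2 [a2 [b2 [e2 H2]]]] := g x2 m2.
have m3 : x3 \in [:: x1, x2, x3 & xs] by rewrite !inE eqxx !orbT.
have [s3 [a3 [b3 [e3 H3]]]] := g x3 m3.
exists s1, s2, s3; split=> //; split=> e.
- by move: e1; rewrite e -e2 => /(weave_inj (@ins_inj _ d))/(_ isT isT)[].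
- by move: e1; rewrite e -e3 => /(weave_inj (@ins_inj _ d))/(_ isT isT)[].
- by move: e2; rewrite e -e3 => /(weave_inj (@ins_inj _ d))/(_ isT isT)[].
Qed.

(** The opened path stays fixed; the three different paths are those inserted in the other half. *)
Lemma ham3N t1 y t2 : v d = u d ->
  path (@qadj n) (proj d u) t1 -> path (@qadj n) y t2 -> last y t2 = proj d v ->
  uniq ((proj d u :: t1) ++ (y :: t2)) -> (forall x, x \in (proj d u :: t1) ++ (y :: t2)) ->
  (forall x j, side d m (u d) x j ->
     linked (proj d u :: t1) x (flip x j) \/ linked (y :: t2) x (flip x j)) ->
  ham3 (side d m (~~ u d)) (last (proj d u) t1) y -> ham3 m u v.
Proof.
move=> vd p1 p2 l2 up ap h0 [r1 [r2 [r3 [[h1 h2 h3] [n12 n13 n23]]]]].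
have [s1 e1 H1] := glueN vd p1 p2 l2 up ap h0 h1.
have [s2 e2 H2] := glueN vd p1 p2 l2 up ap h0 h2.
have [s3 e3 H3] := glueN vd p1 p2 l2 up ap h0 h3.
exists s1, s2, s3; split=> //; split=> e.
- by move: e1; rewrite e -e2 => /(weave_inj (@ins_inj _ d))/(_ isT isT)[].
- by move: e1; rewrite e -e3 => /(weave_inj (@ins_inj _ d))/(_ isT isT)[].
- by move: e2; rewrite e -e3 => /(weave_inj (@ins_inj _ d))/(_ isT isT)[].
Qed.

End Glue.

(** * Vertices of prescribed type, and the scarcity of bad ends *)

Section Fibers.

Variable n : nat.
Hypothesis n5 : 4 < n.
Implicit Types (m : cube n -> 'I_n -> bool) (x y u v : cube n) (i j k : 'I_n) (b c p : bool).

Lemma ord_avoid (s : seq 'I_n) : size s < n -> exists k, k \notin s.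
Proof.
move=> sn; apply/existsP; apply: contraLR sn; rewrite -leqNgt => /existsPn h.
rewrite -[n in n <= _]card_ord cardE; apply: uniq_leq_size; first exact: enum_uniq.
by move=> k _; move: (h k); rewrite negbK.
Qed.

Let setb x i b := if x i == b then x else flip x i.

Let setbE x i b k : setb x i b k = if k == i then b else x k.
Proof.
rewrite /setb; case: eqP => [<-|h]; first by case: eqP => [->|].
by rewrite flipE; case: eqP => [->|]; rewrite ?addbF // addbT; case: (x i) b h => [] [].
Qed.

(** Besides [i] and [k] there are three more directions. Flipping two of them preserves the parity
    and both prescribed coordinates, so one vertex and its three double flips do. *)
Lemma fiber i k p b c : i != k -> exists s,
  [/\ uniq s, size s = 4 & forall x, x \in s -> [/\ parity x = p, x i = b & x k = c]].
Proof.
move=> ik.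
have [e1 h1] := @ord_avoid [:: i; k] (leq_trans (isT : 2 < 5) n5).
have [e2 h2] := @ord_avoid [:: e1; i; k] (leq_trans (isT : 3 < 5) n5).
have [e3 h3] := @ord_avoid [:: e2; e1; i; k] n5.
pose x1 := setb (setb [ffun => false] i b) k c.
pose x0 := if parity x1 == p then x1 else flip x1 e1.
have [p0 i0 k0] : [/\ parity x0 = p, x0 i = b & x0 k = c].
  move: h1; rewrite !inE negb_or => /andP[h1 h1'].
  have e1i : x1 i = b by rewrite !setbE (negPf ik) eqxx.
  have e1k : x1 k = c by rewrite setbE eqxx.
  rewrite /x0; case: eqP => [->|hp]; split=> //.
  - by rewrite parity_flip; case: (parity x1) (p) hp => [] [].
  - by rewrite flipE eq_sym (negPf h1) addbF.
  - by rewrite flipE eq_sym (negPf h1') addbF.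
have ok e e' : e \notin [:: i; k] -> e' \notin [:: i; k] ->
    [/\ parity (flip (flip x0 e) e') = p, flip (flip x0 e) e' i = b & flip (flip x0 e) e' k = c].
  rewrite !inE !negb_or => /andP[a a'] /andP[a1 a1'].
  by rewrite !parity_flip negbK !flipE ![i == _]eq_sym ![k == _]eq_sym (negPf a)
     (negPf a') (negPf a1) (negPf a1') !addbF.
have h2' : e2 \notin [:: i; k] by move: h2; rewrite inE negb_or => /andP[].
have h3' : e3 \notin [:: i; k] by move: h3; rewrite 2!inE !negb_or => /and3P[].
exists [:: x0; flip (flip x0 e1) e2; flip (flip x0 e1) e3; flip (flip x0 e2) e3]; split=> //; last first.
  by move=> x; rewrite !inE => /or4P[] /eqP -> //; apply: ok.
have e12 : e1 != e2 by move: h2; rewrite inE negb_or eq_sym => /andP[].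
have e23 : e2 != e3 by move: h3; rewrite inE negb_or eq_sym => /andP[].
have e13 : e1 != e3 by move: h3; rewrite 2!inE !negb_or ![e3 == _]eq_sym => /and3P[].
have nz e e' : e != e' -> x0 != flip (flip x0 e) e'.
  move=> ee; apply/eqP => /ffunP/(_ e); rewrite !flipE eqxx (negPf ee) addbF.
  by case: (x0 e).
have nz2 x e e' : e != e' -> flip x e != flip x e'.
  by move=> ee; apply: contra ee => /eqP /flip_injr ->.
rewrite /= !inE !negb_or !nz //= nz2 //= flipC nz2 //=.
by rewrite ![flip (flip x0 _) e3]flipC nz2.
Qed.

Lemma fiber8 i p b : exists s,
  [/\ uniq s, size s = 8 & forall x, x \in s -> parity x = p /\ x i = b].
Proof.
have [k ki] := @ord_avoid [:: i] (leq_trans (isT : 1 < 5) n5).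
have ik : i != k by move: ki; rewrite inE eq_sym.
have [s [us ss hs]] := fiber p b false ik.
have [t [ut st ht]] := fiber p b true ik.
exists (s ++ t); split; rewrite ?size_cat ?ss ?st //.
  rewrite cat_uniq us ut andbT /=; apply/hasPn => x /ht[_ _ xk]; apply/negP => /hs[_ _].
  by rewrite xk.
by move=> x; rewrite mem_cat => /orP[/hs|/ht] [].
Qed.

(** Within one parity class types are coordinates up to complement, so each parity contributes a
    fiber of four vertices; [E] cannot contain all eight. *)
Lemma fiber_typ i k b c (E : seq (cube n)) : i != k -> size E < 8 ->
  exists z, [/\ typ i z = b, typ k z = c & z \notin E].
Proof.
move=> ik sE.
have [s [us ss hs]] := fiber false b c ik.
have [t [ut st ht]] := fiber true (~~ b) (~~ c) ik.
have uts : uniq (s ++ t).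
  rewrite cat_uniq us ut andbT /=; apply/hasPn => x /ht[px _ _]; apply/negP => /hs[].
  by rewrite px.
have /allPn[z] : ~~ all (mem E) (s ++ t).
  apply: contraL sE => /allP h; rewrite -leqNgt.
  by have := uniq_leq_size uts h; rewrite size_cat ss st.
rewrite mem_cat => zs zE; exists z; split=> //; rewrite /typ.
  by case/orP: zs => [/hs|/ht] [-> -> _]; rewrite ?addbF // addbT negbK.
by case/orP: zs => [/hs|/ht] [-> _ ->]; rewrite ?addbF // addbT negbK.
Qed.

(** [E] collects the vertices missing from two almost half-layers. A vertex of both types outside
    [E] would be matched in two directions. *)
Lemma half_layers_conflict m i k t t' (E : seq (cube n)) : ismat m -> i != k -> size E < 8 ->
  (forall x, typ i x = t -> x \notin E -> m x i) ->
  (forall x, typ k x = t' -> x \notin E -> m x k) -> False.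
Proof.
move=> [_ mu] ik sE h h'; have [z [zi zk zE]] := fiber_typ t t' ik sE.
by move: ik; rewrite (mu _ _ _ (h _ zi zE) (h' _ zk zE)) eqxx.
Qed.

(** If [u] lies in a half-layer contained in [m], then C2 is excluded by [half_layers_conflict],
    while C1 and C3 both force the type of [u] in that direction. If not, C1 cannot occur, C3 spoils
    only the partner of [u], and C2 spoils only one neighbour, because two of them would bring
    almost half-layers in two directions. *)
Lemma bad_ends m u : ismat m ->
  (exists2 i, (forall x, typ i x = typ i u -> m x i)
     & forall x, ~~ good m u x -> typ i x = typ i u) \/
  (exists2 B : seq (cube n), size B <= 2 & forall x, ~~ good m u x -> x \in B).
Proof.
move=> mm; have [_ mu] := mm.
have [/existsP[i /forallP hi]|nh] := boolP [exists i, hlayer m i (typ i u)].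
  left; exists i => [x tx|x].
    by move/implyP: (hi x); apply; rewrite tx.
  have h x' : typ i x' = typ i u -> m x' i by move/eqP => tx; move/implyP: (hi x'); apply.
  rewrite negbK => /or3P[/c1P[k tk hk]|/c2P[k [j [kj xu muj mxj hk]]]|/c3P[k -> muk]].
  - by have -> : i = k by apply: (mu u); [apply: h|apply: hk].
  - have ji : j = i by apply: (mu u); last apply: h.
    case: (@half_layers_conflict m k i (typ k u) (typ i u) [:: u; x]) => //.
    + by rewrite -ji.
    + by move=> z tz; rewrite !inE => /norP[/eqP zu /eqP zx]; apply: hk.
    + by move=> z tz _; apply: h.
  - have -> : k = i by apply: (mu u); last apply: h.
    by rewrite typ_flip eqxx addbF.
right.
exists ((if [pick i | m u i] is Some i then [:: flip u i] else [::]) ++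
        (if [pick i | c2 m u (flip u i)] is Some i then [:: flip u i] else [::])).
  by case: pickP => [? _|_]; case: pickP.
move=> x; rewrite negbK mem_cat => /or3P[/existsP[i /andP[_ hi]]||/c3P[i -> mui]].
- by case/negP: nh; apply/existsP; exists i.
- move=> c2x; have /c2P[k [j [kj xu _ _ hk]]] := c2x.
  rewrite orbC; case: pickP => [k' c2k|/(_ k)]; last by rewrite -xu c2x.
  rewrite inE xu; apply/orP; left; apply/eqP; congr (flip u).
  apply/eqP; case: eqP => // /eqP kk; exfalso.
  have /c2P[k2 [j2 [_ ek _ _ hk2]]] := c2k.
  have e2 : k' = k2 by apply: flip_injr ek.
  case: (@half_layers_conflict m k k' (typ k u) (typ k' u) [:: u; x; flip u k']) => //.
  + by move=> z tz; rewrite !inE => /norP[/eqP ? /norP[/eqP ? _]]; apply: hk.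
  + rewrite e2 => z tz; rewrite !inE => /norP[/eqP ? /norP[_ /eqP ?]].
    by apply: hk2 => //; rewrite -e2 in ek *; rewrite e2.
- case: pickP => [k' muk|/(_ i)]; last by rewrite mui.
  by rewrite inE (mu _ _ _ muk mui) eqxx.
Qed.

Lemma size_filter_avoid (s B : seq (cube n)) : uniq s ->
  size s - size B <= size [seq x <- s | x \notin B].
Proof.
move=> us; rewrite leq_subLR size_filter -(count_predC (mem B) s) leq_add2r -size_filter.
by apply: uniq_leq_size; [apply: filter_uniq|move=> x; rewrite mem_filter => /andP[]].
Qed.

End Fibers.

Section StepS.

Variables (n : nat) (n5 : 4 < n) (IH : few_directions_extend n).
Variables (d : 'I_n.+1) (m : cube n.+1 -> 'I_n.+1 -> bool) (u v : cube n.+1).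
Hypotheses (mm : ismat m) (dm : #|dset m| <= 5) (puv : parity u != parity v).
Hypotheses (g : good m u v) (du : forall x, ~~ m x d).

Lemma side_extend b x y : parity x != parity y -> good (side d m b) x y -> ham3 (side d m b) x y.
Proof.
move=> pxy gxy; apply: IH => //; first exact: side_ismat.
by apply: leq_trans dm; apply: side_dset.
Qed.

Let u' := proj d u.
Let v' := proj d v.

(** A crossing vertex has parity opposite to [u'] and [v']; if in addition it agrees with such an
    end in coordinate [i], its type in direction [i] differs from that of the end, so the half-layer
    case of [bad_ends] does no harm. In the other case at most two candidates per end are lost. *)
Lemma stepS : v d = ~~ u d -> ham3 m u v.
Proof.
move=> vd; have uE : u = ins d (u d) u' by rewrite projK.
have vE : v = ins d (~~ u d) v' by rewrite -vd projK.
have pu : parity v' = parity u'.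
  by move: puv; rewrite uE vE !parity_ins; case: (u d) (parity u') (parity v') => [] [] [].
suff [s us [ss hs]] : exists2 s : seq (cube n), uniq s & 2 < size s /\ forall x, x \in s ->
    [/\ parity x = ~~ parity u', good (side d m (u d)) u' x & good (side d m (v d)) x v'].
  apply: (ham3S du vd us ss) => x /hs[px g0 g1]; split; apply: side_extend => //.
    by rewrite px; case: (parity u').
  by rewrite px pu; case: (parity u').
have m0 := side_ismat d (u d) mm; have m1 := side_ismat d (v d) mm.
have gs x : good (side d m (v d)) v' x -> good (side d m (v d)) x v'.
  exact: good_sym.
have n1 (x t : cube n) i : parity x = ~~ parity u' -> x i = t i -> parity t = parity u' -> typ i x <> typ i t.
  by move=> px xt pt; rewrite /typ px xt pt; case: (t i) (parity u') => [] [].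
have [[i hi bi]|[B sB hB]] := bad_ends n5 u' m0;
  have [[k hk bk]|[C sC hC]] := bad_ends n5 v' m1.
(* If both halves impose a condition on the same coordinate, the conditions agree: otherwise the two
   half-layers would join to a half-layer of the cube covering [u] and [v], which is C1. *)
- have uvk : i = k -> u' i = v' i.
    move=> ik; apply/eqP; apply: contraT => uvi; case/goodP: g => nc1 _ _; case: nc1.
    apply/c1P; exists (lift d i) => [|z].
      rewrite uE vE !typ_lift /typ pu.
      by move: uvi; case: (u' i) (v' i) (parity u') (u d) => [] [] [] [].
    have [b [y ->]] := ins_surj d z; rewrite uE !typ_lift.
    case: (eqVneq b (u d)) => [-> /addbI ty|bu]; first exact: hi.
    have -> : b = v d by rewrite vd; case: (b) (u d) bu => [] [].
    move=> ty; rewrite ik; apply: hk; rewrite -ik; move: ty uvi; rewrite vd /typ pu.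
    by case: (y i) (u' i) (v' i) (parity u') (parity y) (u d) => [] [] [] [] [] [].
  have [s us [ss hs]] : exists2 s : seq (cube n), uniq s & 2 < size s /\ forall x, x \in s ->
      [/\ parity x = ~~ parity u', x i = u' i & x k = v' k].
    have [ik|ik] := eqVneq i k.
      have [s [us ss hs]] := fiber8 n5 i (~~ parity u') (u' i).
      exists s; rewrite // ss; split=> // x /hs[px xi]; split=> //.
      by rewrite -ik -uvk.
    have [s [us ss hs]] := fiber n5 (~~ parity u') (u' i) (v' k) ik.
    by exists s; rewrite // ss.
  exists s => //; split=> // x /hs[px xi xk]; split=> //.
    by apply: contraT => /bi /(n1 _ _ _ px xi (erefl _)).
  by apply: gs; apply: contraT => /bk /(n1 _ _ _ px xk pu).
- have [s [us ss hs]] := fiber8 n5 i (~~ parity u') (u' i).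
  exists [seq x <- s | x \notin C]; first exact: filter_uniq.
  split.
    apply: leq_trans (size_filter_avoid C us); rewrite ss.
    by apply: leq_trans (leq_sub2l 8 sC).
  move=> x; rewrite mem_filter => /andP[xC /hs[px xi]]; split=> //.
    by apply: contraT => /bi /(n1 _ _ _ px xi (erefl _)).
  by apply: gs; apply: contraR xC => /hC.
- have [s [us ss hs]] := fiber8 n5 k (~~ parity u') (v' k).
  exists [seq x <- s | x \notin B]; first exact: filter_uniq.
  split.
    apply: leq_trans (size_filter_avoid B us); rewrite ss.
    by apply: leq_trans (leq_sub2l 8 sB).
  move=> x; rewrite mem_filter => /andP[xB /hs[px xk]]; split=> //.
    by apply: contraR xB => /hB.
  by apply: gs; apply: contraT => /bk /(n1 _ _ _ px xk pu).
(* The coordinate is arbitrary; it only provides eight candidates, of which at most four are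
   lost. *)
- have [s [us ss hs]] := fiber8 n5 (Ordinal n5) (~~ parity u') false.
  exists [seq x <- s | x \notin B ++ C]; first exact: filter_uniq.
  split.
    apply: leq_trans (size_filter_avoid (B ++ C) us); rewrite ss size_cat.
    by apply: leq_trans (leq_sub2l 8 (leq_add sB sC)).
  move=> x; rewrite mem_filter mem_cat negb_or => /andP[/andP[xB xC] /hs[px _]]; split=> //.
    by apply: contraR xB => /hB.
  by apply: gs; apply: contraR xC => /hC.
Qed.

End StepS.

(** * The exceptional 4-cycle *)

Section Corners.

Variables (n : nat) (n5 : 4 < n).
Implicit Types (m : cube n -> 'I_n -> bool) (x y z a : cube n) (i j k : 'I_n).

Definition corners a j k := [:: a; flip a j; flip a k; flip (flip a j) k].

Lemma cornersE x a j k : x \in corners a j k ->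
  corners x j k =i corners a j k.
Proof.
move=> + z; rewrite !inE => /or4P[] /eqP-> //;
  rewrite ?flipK ?[flip (flip (flip a j) k) j]flipC ?[flip (flip a k) j]flipC ?flipK;
  by do 4![case: (z == _)].
Qed.

(* All the edges that violate C2 lie on a single 4-cycle. *)
Lemma c2_corners m a j : ismat m -> c2 m a (flip a j) -> exists k,
  [/\ k != j, forall x, x \in corners a j k -> m x k
    & forall x i, c2 m x (flip x i) -> i = j /\ x \in corners a j k].
Proof.
move=> mm; have [ms mu] := mm; case/c2P => j' [k [jk /flip_injr ej]].
rewrite -{j'}ej in jk * => ma mb h; exists k; split; first by rewrite eq_sym.
  by move=> x; rewrite !inE => /or4P[] /eqP-> //; rewrite ms.
move=> x i /c2P[i' [l [il /flip_injr ei]]]; rewrite -{i'}ei in il * => mx mx' h'.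
(* Two edges violating C2 bring two almost half-layers, which together miss at most four
   vertices. *)
have ij : i = j.
  apply/eqP; case: (eqVneq i j) => // ij; exfalso.
  apply: (@half_layers_conflict _ n5 m i j (typ i x) (typ j a) [:: x; flip x i; a; flip a j]) => //.
    by move=> z tz; rewrite !inE => /norP[/eqP ? /norP[/eqP ? _]]; apply: h'.
  by move=> z tz; rewrite !inE => /norP[_ /norP[_ /norP[/eqP ? /eqP ?]]]; apply: h.
split=> //; rewrite {}ij in il mx' h'.
have [tx|tx] := eqVneq (typ j x) (typ j a).
  rewrite !inE; case: (eqVneq x a) => //= xa; case: (eqVneq x (flip a j)) => //= xb.
  have mxj : m x j by apply: h => //; apply/eqP.
  by move: il; rewrite (mu _ _ _ mx mxj) eqxx.
have ty : typ j (flip a k) = typ j x.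
  by rewrite typ_flip jk; case: (typ j x) (typ j a) tx => [] [].
(* In the half-layer of the other type, [flip a k] is already matched along [k], so an almost
   half-layer there must be the one avoiding it. *)
have nj : ~~ m (flip a k) j.
  apply/negP => mj; have mk : m (flip a k) k by rewrite ms.
  by move: jk; rewrite (mu _ _ _ mj mk) eqxx.
rewrite !inE; case: (eqVneq x (flip a k)) => [|/eqP xk]; first by rewrite !orbT.
case: (eqVneq (flip x j) (flip a k)) => [e|/eqP xk'].
  by rewrite -[x](flipK j) e flipC eqxx !orbT.
by case/negP: nj; apply: h' => // e; [apply: xk|apply: xk'].
Qed.

End Corners.

(** * Among three paths, one has an edge at which it can be opened *)

Section BranchingPaths.

Variables (n : nat) (n5 : 4 < n) (m0 m1 : cube n -> 'I_n -> bool) (u v : cube n).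
Hypotheses (mm0 : ismat m0) (mm1 : ismat m1).

Let cuttable x y := ~~ [exists j, (y == flip x j) && m0 x j] && good m1 x y.

(** The edges at which a path cannot be opened. C1 needs no term of its own: the ends of an edge
    have equal types only in the direction of the edge, so C1 puts the edge itself into [m1]. *)
Let G x y := exists j, y = flip x j /\ [|| m0 x j, m1 x j | c2 m1 x (flip x j)].

Let uncuttable x y : qadj x y -> ~~ cuttable x y -> G x y.
Proof.
case/qadjP => j ->; rewrite /cuttable negb_and !negbK => h; exists j; split=> //.
case/orP: h => [/existsP[i /andP[/eqP/flip_injr -> ->]]//|].
case/or3P => [/c1P[i + h]|->|/c3P[i /flip_injr -> ->]]; rewrite ?orbT //.
by rewrite typ_flip; case: eqP => [<- _|_]; [rewrite h ?orbT|case: (typ i x)].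
Qed.

Let G_sym x y : G x y -> G y x.
Proof.
case=> j [-> h]; exists j; rewrite (flipK j x); split; first by [].
rewrite (mm0.1) (mm1.1); case/or3P: h => [->|->|/c2_sym ->]; rewrite ?orbT //.
Qed.

(** Each of the two matchings supplies at most one edge at [y], so a third edge must come from
    C2. *)
Let G_deg y a b c : G y a -> G y b -> G y c -> a <> b -> a <> c -> b <> c ->
  exists j, c2 m1 y (flip y j).
Proof.
case=> j1 [-> h1] [j2 [-> h2]] [j3 [-> h3]] n12 n13 n23.
case: (boolP (c2 m1 y (flip y j1))) => [|f1]; first by exists j1.
case: (boolP (c2 m1 y (flip y j2))) => [|f2]; first by exists j2.
case: (boolP (c2 m1 y (flip y j3))) => [|f3]; first by exists j3.
exfalso; move: h1 h2 h3; rewrite (negPf f1) (negPf f2) (negPf f3) !orbF.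
by case/orP=> h1 /orP[] h2 /orP[] h3;
  try (by apply: n12; congr flip; (apply: mm0.2 h1 h2 || apply: mm1.2 h1 h2));
  try (by apply: n13; congr flip; (apply: mm0.2 h1 h3 || apply: mm1.2 h1 h3));
  apply: n23; congr flip; (apply: mm0.2 h2 h3 || apply: mm1.2 h2 h3).
Qed.

Let gpath s := ham m0 u v s /\ forall x y, cons2 (u :: s) x y -> G x y.

Let P s i := nth u (u :: s) i.
Let N := 2 ^ n.

Let gpathG s i : gpath s -> i.+1 < N -> G (P s i) (P s i.+1).
Proof.
case=> hs hG iN; apply: hG; exists (take i (u :: s)), (drop i.+2 (u :: s)).
by rewrite /P -!drop_nth ?cat_take_drop ?(ham_size hs) // ltnW.
Qed.

Let P_inj s i j : gpath s -> i < N -> j < N -> P s i = P s j -> i = j.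
Proof.
move=> [hs _] iN jN /eqP; rewrite nth_uniq ?(ham_size hs) //; first by move/eqP.
by case: hs => -[].
Qed.

Let P_last s : gpath s -> P s N.-1 = v.
Proof.
move=> [hs _]; rewrite /P /N -(ham_size hs) -/(P s _).
by case: hs => -[_ _ _ <-] _; rewrite (last_nth u).
Qed.

Let branch s s' k := [/\ k.+1 < N, forall i, i <= k -> P s i = P s' i & P s k.+1 <> P s' k.+1].

Let branch_sym s s' k : branch s s' k -> branch s' s k.
Proof. by case=> kN h ne; split=> // [i /h|/esym]. Qed.

Let branch_ex s s' : gpath s -> gpath s' -> s <> s' -> exists k, branch s s' k.
Proof.
move=> hs hs' ne.
have [/allP h|/allPn[i]] := boolP (all (fun i => P s i == P s' i) (iota 0 N)).
  case: ne; suff [] : u :: s = u :: s' by [].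
  apply: (@eq_from_nth _ u) => [|i]; rewrite (ham_size hs.1) ?(ham_size hs'.1) // => iN.
  by apply/eqP; apply: h; rewrite mem_iota.
rewrite mem_iota /= add0n => iN ni.
have ex : exists i, P s i != P s' i by exists i.
case: (ex_minnP ex) => -[|k] nk mk; first by rewrite eqxx in nk.
exists k; split; first by apply: leq_ltn_trans iN; apply: mk.
  move=> j jk; apply/eqP; apply: contraT => /mk.
  by rewrite ltnNge jk.
exact/eqP.
Qed.

(** The vertex to which [s] departs has three neighbours in [G]: the common predecessor and the two
    vertices next to it on [s']. There it occurs later than on [s] and not at the end, since both
    paths end in [v] at the same position. *)
Let branch_c2 s s' k : gpath s -> gpath s' -> branch s s' k ->
  exists j, c2 m1 (P s k.+1) (flip (P s k.+1) j).
Proof.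
move=> hs hs' [kN eqk nek]; set y := P s k.+1.
have N0 : 0 < N by rewrite expn_gt0.
have kN' := ltnW kN.
have ys' : y \in u :: s' by case: hs'.1 => -[].
pose l := index y (u :: s').
have lN : l < N by rewrite /N -(ham_size hs'.1) index_mem.
have yl : P s' l = y by rewrite /P nth_index.
have kl : k.+1 < l.
  rewrite ltn_neqAle; apply/andP; split.
    by apply/eqP => e; apply: nek; rewrite e yl -e.
  rewrite ltnNge; apply/negP => lk; move: (eqk _ lk); rewrite yl.
  by move/(P_inj hs (leq_ltn_trans lk kN') kN) => e; move: lk; rewrite e ltnn.
case: l lN yl kl => [//|l] lN yl kl.
have [lN'|] := ltnP l.+2 N; last first.
  move=> Nl; have lE : l.+1 = N.-1.
    by apply/eqP; rewrite eqn_leq -ltnS prednK // lN /= -ltnS prednK.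
  move: yl; rewrite lE (P_last hs') -(P_last hs) => /esym.
  move/(P_inj hs kN) => e; move: kl; rewrite lE -e ?ltnn // prednK //.
apply: (@G_deg _ (P s k) (P s' l) (P s' l.+2)).
- by apply: G_sym; apply: gpathG.
- by rewrite -yl; apply: G_sym; apply: gpathG.
- by rewrite -yl; apply: gpathG.
- rewrite eqk // => /(P_inj hs' kN' (ltnW lN)) e.
  by move: kl; rewrite e ltnn.
- rewrite eqk // => /(P_inj hs' kN' lN') e.
  by move: kl; rewrite e ltnS -ltnS ltnNge leqW // leqW.
- by move=> /(P_inj hs' (ltnW lN) lN') /eqP; rewrite -addn2 -{1}[l]addn0 eqn_add2l.
Qed.

Let on_corners a j k :=
  k != j /\ forall x i, c2 m1 x (flip x i) -> i = j /\ x \in corners a j k.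

(** Both continuations are corners of the exceptional cycle. Having the same parity they are
    opposite corners, and their only common neighbours are the two remaining corners. *)
Let branch_corners a j k s s' l : on_corners a j k -> gpath s -> gpath s' -> branch s s' l ->
  let x := P s l in let y := P s l.+1 in let y' := P s' l.+1 in
  x \in corners a j k /\
  (y = flip x j /\ y' = flip x k \/ y = flip x k /\ y' = flip x j).
Proof.
move=> [kj Wa] hs hs' br x y y'.
have [i1 /Wa[_ yW]] := branch_c2 hs hs' br.
have [i2 /Wa[_ yW']] := branch_c2 hs' hs (branch_sym br).
case: br => lN eql nel.
have [p [yE _]] := gpathG hs lN; have := gpathG hs' lN; rewrite -(eql l) // => -[q [yE' _]].
rewrite -/y -/x in yE yW nel; rewrite -/y' -/x in yE' yW' nel.
have yy : [|| y' == y, y' == flip y j, y' == flip y k | y' == flip (flip y j) k].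
  by move: yW'; rewrite -(cornersE yW) !inE.
have py : parity y = ~~ parity x by rewrite yE parity_flip.
have py' : parity y' = ~~ parity x by rewrite yE' parity_flip.
case/or4P: yy => /eqP e.
- by case: nel; rewrite e.
- by move: py'; rewrite e parity_flip py; case: (parity x).
- by move: py'; rewrite e parity_flip py; case: (parity x).
have pq : p != q by apply/eqP => e'; apply: nel; rewrite yE yE' e'.
have pjk : (p == j) || (p == k).
  move: e; rewrite yE yE' => /ffunP/(_ p); rewrite !flipE eqxx (negPf pq).
  by case: (x p) (p == j) (p == k) => [] [] [].
have xy : x = flip y p by rewrite yE flipK.
split.
  rewrite -(cornersE yW) xy !inE.
  by case/orP: pjk => /eqP->; rewrite eqxx !orbT.
case/orP: pjk => /eqP pE; [left|right]; rewrite yE pE; split=> //; rewrite e yE pE.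
  by rewrite flipK.
by rewrite flipC flipK.
Qed.

(** At a branching both cycle neighbours of the current corner are still unvisited. After an earlier
    branching two adjacent corners have been visited, and every corner has a cycle neighbour among
    these two. *)
Let branch_len a j k s s' s2 l l2 : on_corners a j k -> gpath s -> gpath s' -> gpath s2 ->
  branch s s' l -> branch s s2 l2 -> l2 <= l.
Proof.
move=> W hs hs' hs2 br br2; rewrite leqNgt; apply/negP => ll.
have [xW xy] := branch_corners W hs hs' br.
have [zW zy] := branch_corners W hs hs2 br2.
have [lN2 eql2 _] := br2.
have lN2' := ltnW lN2.
have nb i : i <= l2 -> P s i <> flip (P s l2) j /\ P s i <> flip (P s l2) k.
  move=> il; have iN := leq_ltn_trans il lN2'.
  have n1 : P s i <> P s l2.+1.
    by move/(P_inj hs iN lN2) => e; move: il; rewrite e ltnn.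
  have n2 : P s i <> P s2 l2.+1.
    by rewrite eql2 // => /(P_inj hs2 iN lN2) => e; move: il; rewrite e ltnn.
  by case: zy => -[<- <-].
have [nx nx'] := nb l (ltnW ll); have [ny ny'] := nb l.+1 ll.
move: zW; rewrite -(cornersE xW) !inE => /or4P[] /eqP zE; rewrite zE in nx nx' ny ny'.
- by case: xy => -[e _]; [apply: ny|apply: ny'].
- by rewrite flipK in nx.
- by rewrite flipK in nx'.
- case: xy => -[e _]; rewrite e in ny ny'; first by rewrite flipK in ny'.
  by rewrite flipC flipK in ny.
Qed.

(** All three pairs branch at the same position, where only two continuations are available. *)
Let at_most_two a j k s1 s2 s3 : on_corners a j k -> gpath s1 -> gpath s2 -> gpath s3 ->
  s1 <> s2 -> s1 <> s3 -> s2 <> s3 -> False.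
Proof.
move=> W h1 h2 h3 n12 n13 n23; have [kj _] := W.
have [l b12] := branch_ex h1 h2 n12; have [l' b13] := branch_ex h1 h3 n13.
have [l2 b23] := branch_ex h2 h3 n23.
have e1 : l' = l by apply/eqP; rewrite eqn_leq (branch_len W h1 h2 h3 b12 b13) (branch_len W h1 h3 h2 b13 b12).
have e2 : l2 = l.
  apply/eqP; rewrite eqn_leq (branch_len W h2 h1 h3 (branch_sym b12) b23).
  by rewrite (branch_len W h2 h3 h1 b23 (branch_sym b12)).
rewrite e1 in b13; rewrite e2 in b23.
have [_ x12] := branch_corners W h1 h2 b12; have [_ x13] := branch_corners W h1 h3 b13.
have [_ eq12 d12] := b12; have [_ _ d23] := b23.
apply: d23; case: x12 x13 => -[e ->] [[e' ->]|[e' ->]] //.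
  by move: kj; rewrite (flip_injr (etrans (esym e) e')) eqxx.
by move: kj; rewrite (flip_injr (etrans (esym e) e')) eqxx.
Qed.

Lemma ham3_cut : ham3 m0 u v -> exists s x y,
  [/\ ham m0 u v s, cons2 (u :: s) x y, ~ (exists2 j, y = flip x j & m0 x j) & good m1 x y].
Proof.
move=> [s1 [s2 [s3 [[h1 h2 h3] [n12 n13 n23]]]]].
pose C s := [exists x, exists y, [&& (index y (u :: s) == (index x (u :: s)).+1) , cuttable x y & index y (u :: s) < N]].
have cut s : ham m0 u v s -> C s -> exists s x y,
    [/\ ham m0 u v s, cons2 (u :: s) x y, ~ (exists2 j, y = flip x j & m0 x j) & good m1 x y].
  move=> hs /existsP[x /existsP[y /and3P[/eqP iE /andP[nm gxy] iN]]]; exists s, x, y; split=> //.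
    exists (take (index x (u :: s)) (u :: s)), (drop (index x (u :: s)).+2 (u :: s)).
    have hN := ham_size hs; rewrite -/N in hN; rewrite iE in iN.
    have xs : x \in u :: s by case: hs => -[].
    have ys : y \in u :: s by case: hs => -[].
    rewrite -[LHS](cat_take_drop (index x (u :: s))) (drop_nth u) ?hN 1?ltnW //.
    by rewrite (drop_nth u) ?hN // -iE !nth_index.
  by case=> j yE mj; case/negP: nm; apply/existsP; exists j; rewrite yE eqxx.
have nocut s : ham m0 u v s -> ~~ C s -> gpath s.
  move=> hs nC; split=> // x y xy; have [[pt us _ _] _] := hs.
  apply: uncuttable; first exact: cons2_path pt xy.
  apply/negP => cxy; case/negP: nC; apply/existsP; exists x; apply/existsP; exists y.
  rewrite (cons2_index us xy) eqxx cxy /= -(cons2_index us xy) /N -(ham_size hs) index_mem.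
  by case/andP: (linked_mem (or_introl xy)).
case: (boolP (C s1)) => [/(cut _ h1)//|/(nocut _ h1) g1].
case: (boolP (C s2)) => [/(cut _ h2)//|/(nocut _ h2) g2].
case: (boolP (C s3)) => [/(cut _ h3)//|/(nocut _ h3) g3].
exfalso.
have [k br] := branch_ex g1 g2 n12.
have [i F] := branch_c2 g1 g2 br.
have [k' [kj _ h]] := c2_corners n5 mm1 F.
exact: (at_most_two (conj kj h)) g1 g2 g3 n12 n13 n23.
Qed.

End BranchingPaths.

(** * Induction step when both ends lie in a half where they are good *)

Section StepN.

Variables (n : nat) (n5 : 4 < n) (IH : few_directions_extend n).
Variables (d : 'I_n.+1) (m : cube n.+1 -> 'I_n.+1 -> bool) (u v : cube n.+1).
Hypotheses (mm : ismat m) (dm : #|dset m| <= 5) (puv : parity u != parity v).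
Hypotheses (du : forall x, ~~ m x d) (vd : v d = u d).

Let u' := proj d u.
Let v' := proj d v.
Let m0 := side d m (u d).
Let m1 := side d m (~~ u d).

Lemma proj_parity : parity u' != parity v'.
Proof.
by move: puv; rewrite -[u](projK d) -[v](projK d) !parity_ins vd; case: (u d) (parity u') (parity v') => [] [] [].
Qed.

Lemma stepN_good : good m0 u' v' -> ham3 m u v.
Proof.
move=> g0; have h3 := side_extend IH mm dm proj_parity g0.
have [s [x [y [[[pt us as_ ls] hs] [A [B e]] nxy gxy]]]] :=
  ham3_cut n5 (side_ismat d (u d) mm) (side_ismat d (~~ u d) mm) h3.
have [t1 e1] : exists t1, u' :: t1 = rcons A x.
  by case: A e => [|w A] [-> _]; [exists [::]|exists (rcons A x)].
have lx : last u' t1 = x by rewrite -[last _ _]/(last u' (u' :: t1)) e1 last_rcons.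
have es : s = t1 ++ y :: B.
  suff [] : u' :: s = u' :: t1 ++ y :: B by [].
  by rewrite -cat_cons e1 cat_rcons.
have ps : u' :: s = (u' :: t1) ++ y :: B by rewrite es.
move: pt ls; rewrite es cat_path last_cat lx /= => /and3P[p1 xy p2] l2.
apply: (ham3N du vd p1 p2 l2); rewrite -/u' -?ps //.
  move=> z j mz; have := hs _ _ mz; rewrite ps => /linked_cat[h|h|[p' [q' [a [b [ep [eb _] h]]]]]].
  - by left.
  - by right.
  have ea : a = x by rewrite -lx -[last _ _]/(last u' (u' :: t1)) ep last_rcons.
  case: nxy; exists j; case: h => -[ez ez'].
  + by rewrite -ea -ez ez' eb.
  + by rewrite eb -ez -ea -ez' flipK.
  + by rewrite -ea -ez.
  + by rewrite -ea -ez' (side_ismat d (u d) mm).1.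
rewrite lx; apply: side_extend => //.
by case/qadjP: xy => j ->; rewrite parity_flip; case: (parity x).
Qed.

End StepN.

(** * Matchings inside a single direction *)

Section Rungs.

Variable n : nat.
Implicit Types (m : cube n -> 'I_n -> bool) (x y u v : cube n) (i j k : 'I_n).

(** A vertex outside the half-layer has all its neighbours in directions other than [i] on the
    half-layer, where they are already matched along [i]. *)
Lemma hlayer_single m i t x k : ismat m -> hlayer m i t -> m x k -> k = i.
Proof.
move=> [ms mu] /forallP h mx.
have [/eqP tx|tx] := boolP (typ i x == t).
  by apply: mu mx _; apply: (implyP (h x)); apply/eqP.
have [//|ki] := eqVneq k i.
apply: (mu (flip x k)); first by rewrite ms.
apply: (implyP (h _)); rewrite typ_flip [i == k]eq_sym ki addbT.
by move: tx; case: (typ i x) (t) => [] [].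
Qed.

Lemma good_uncovered m u v : (forall k, ~~ m u k) -> good m u v.
Proof.
move=> un; apply/goodP; split.
- by case/c1P => i _ /(_ u (erefl _)); apply/negP.
- by case/c2P => i [j [_ _ mu _ _]]; move/negP: (un j).
- by case/c3P => i _; apply/negP.
Qed.

(** Flips in three different directions produce a vertex at distance three, and C2 and C3 concern
    adjacent ends only. *)
Lemma good_far m u i k l : i != k -> i != l -> k != l -> (forall i t, ~~ hlayer m i t) ->
  good m u (flip (flip (flip u i) k) l).
Proof.
move=> ik il kl nh.
have nadj e : flip (flip (flip u i) k) l <> flip u e.
  have df c c' c'' : c != c' -> c != c'' -> flip (flip (flip u c) c') c'' = flip u e -> e = c.
    move=> cc cc' /ffunP/(_ c); rewrite !flipE eqxx (negPf cc) (negPf cc').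
    by case: (eqVneq c e) => // _; case: (u c).
  move=> h; have e1 := df i k l ik il h; rewrite flipC in h.
  have li : l != i by rewrite eq_sym.
  have lk : l != k by rewrite eq_sym.
  rewrite [flip (flip u i) l]flipC in h.
  by have e2 := df l i k li lk h; move: il; rewrite -e1 -e2 eqxx.
apply/goodP; split.
- by case/c1P => e _ h; case/negP: (nh e (typ e u)); apply/forallP => x; apply/implyP => /eqP/h.
- by case/c2P => e [j [_ /nadj]].
- by case/c3P => e /nadj.
Qed.

(** Such matchings replace the matching of a bad half: they contain nearly all of it, can be chosen
    so that the induction hypothesis applies, and span one direction. *)
Definition rungs i (P : pred (cube n)) x k := (k == i) && P x.

Lemma rungs_ismat i (P : pred (cube n)) : (forall x, P (flip x i) = P x) -> ismat (rungs i P).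
Proof.
move=> hP; split=> [x k|x k k'] /=; rewrite /rungs; first by case: eqP => // ->; rewrite hP.
by case/andP => /eqP-> _ /andP[/eqP->].
Qed.

Lemma rungs_dset i P : #|dset (rungs i P)| <= 5.
Proof.
apply: (@leq_trans #|[set i]|); last by rewrite cards1.
by apply/subset_leq_card/subsetP => k; rewrite !inE => /existsP[x /andP[]].
Qed.

End Rungs.

Section ProjFlip.

Variables (n : nat) (d : 'I_n.+1).

Lemma proj_flip_lift z j : proj d (flip z (lift d j)) = flip (proj d z) j.
Proof. by rewrite -[z in LHS](projK d) flip_ins_lift insK. Qed.

End ProjFlip.

(** In this form being a path is inherited by pieces that are cut out, reversed or rejoined. *)
Lemma sorted_linked n (s : seq (cube n)) :
  (forall x y, linked s x y -> qadj x y) <-> sorted (@qadj n) s.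
Proof.
split.
  elim: s => [//|x [//|y s] IH] h /=; apply/andP; split.
    by apply: h; left; exists [::], s.
  by apply: IH => z w zw; apply: h; apply: (@linked_catr _ [:: x]).
case: s => [_ x y|x s /= ps y z [] c]; first by case=> -[[|? ?] [? []]].
  exact: cons2_path ps c.
by rewrite qadj_sym; apply: cons2_path ps c.
Qed.

Section StepBad.

Variables (n : nat) (n5 : 4 < n) (IH : few_directions_extend n).
Variables (d : 'I_n.+1) (m : cube n.+1 -> 'I_n.+1 -> bool) (u v : cube n.+1).
Hypotheses (mm : ismat m) (dm : #|dset m| <= 5) (puv : parity u != parity v).
Hypotheses (g : good m u v) (du : forall x, ~~ m x d) (vd : v d = u d).

Let u' := proj d u.
Let v' := proj d v.
Let m0 := side d m (u d).
Let m1 := side d m (~~ u d).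
Let mm0 : ismat m0 := side_ismat d (u d) mm.
Let mm1 : ismat m1 := side_ismat d (~~ u d) mm.

Let puv' : parity u' != parity v' := proj_parity puv vd.

Let dset_lift (e : 'I_n.+1) x : m x e -> exists2 i, e = lift d i & m0 (proj d x) i || m1 (proj d x) i.
Proof.
case: (unliftP d e) => [i|] -> mx; last by rewrite (negPf (du x)) in mx.
exists i => //; rewrite /m0 /m1 /side.
by move: mx; rewrite -{1}[x](projK d); case: (x d) (u d) => [] [] /= ->; rewrite ?orbT.
Qed.

(** The second piece ends in [v']; writing its first vertex as [head v' t2] also allows the piece to
    consist of [v'] alone. *)
Lemma ham3N_pieces t1 t2 :
  sorted (@qadj n) (u' :: t1) -> sorted (@qadj n) (rcons t2 v') ->
  uniq ((u' :: t1) ++ rcons t2 v') -> (forall x, x \in (u' :: t1) ++ rcons t2 v') ->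
  (forall x j, m0 x j -> linked (u' :: t1) x (flip x j) \/ linked (rcons t2 v') x (flip x j)) ->
  parity (last u' t1) != parity (head v' t2) -> good m1 (last u' t1) (head v' t2) -> ham3 m u v.
Proof.
have [t [et lt]] : exists t, rcons t2 v' = head v' t2 :: t /\ last (head v' t2) t = v'.
  by case: t2 => [|b t] /=; [exists [::]|exists (rcons t v'); rewrite last_rcons].
rewrite et => s1 s2 us as_ hl pp gg.
by apply: (ham3N du vd s1 s2 lt us as_ hl); apply: (side_extend IH).
Qed.

Let nc3 : ~ c3 m0 u' v'.
Proof.
case/c3P => i vE mu; case/goodP: g => _ _; apply; apply/c3P; exists (lift d i).
  by rewrite -[u](projK d) flip_ins_lift -/u' -vE -vd projK.
by move: mu; rewrite /m0 /side projK.
Qed.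

Section Layer.

Variables (i : 'I_n) (tv : typ i v' = typ i u').
Hypotheses (hi : forall x, typ i x = typ i u' -> m0 x i)
  (nosep : forall e, (forall x, ~~ m x e) -> v e = u e).

Let v1 := flip v' i.

Let m0i x k : m0 x k -> k = i.
Proof. by apply: (hlayer_single mm0 (t := typ i u')); apply/forallP => y; apply/implyP => /eqP/hi. Qed.

Let v1u : v1 <> u'.
Proof.
by move=> e; apply: nc3; apply/c3P; exists i; [rewrite -e flipK|apply: hi].
Qed.

Let v1v : v1 <> v'.
Proof. by apply/eqP/flip_neq. Qed.

Let no_hlayer1 k t : ~~ hlayer m1 k t.
Proof.
apply/negP => hk.
have [e] : exists e, [&& e != i, e != k & u' e != v' e].
  apply/existsP; apply: contraT => /existsPn h; exfalso.
  have agree e : e != i -> e != k -> u' e = v' e.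
    by move=> ei ek; move: (h e); rewrite ei ek /= negbK => /eqP.
  have ui : v' i = ~~ u' i.
    by move: tv puv'; rewrite /typ; case: (u' i) (v' i) (parity u') (parity v') => [] [] [] [].
  have [ek|nk] := eqVneq (v' k) (flip u' i k).
    apply: v1u; rewrite /v1 -[RHS](flipK i); congr flip; apply/ffunP => e.
    have [->|ei] := eqVneq e i; first by rewrite flipE eqxx ui addbT.
    have [->//|ek'] := eqVneq e k.
    by rewrite flipE (negPf ei) addbF agree.
  have vE : v' = flip (flip u' i) k.
    apply/ffunP => e; rewrite flipE; have [->|ek] := eqVneq e k.
      by move: nk; case: (v' k) (flip u' i k) => [] [].
    have [->|ei] := eqVneq e i; first by rewrite flipE eqxx ui addbT addbF.
    by rewrite flipE (negPf ei) !addbF agree.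
  by move: puv'; rewrite vE !parity_flip negbK eqxx.
case/and3P => ei ek /eqP; apply; move: (nosep (e := lift d e)); rewrite !ffunE => -> // x.
apply/negP => mx; have [e' /lift_inj <-] := dset_lift mx.
by case/orP => [/m0i|/(hlayer_single mm1 hk)] eE; move: ei ek; rewrite eE eqxx.
Qed.

Let notv x := (x != v') && (x != v1).

Let notv_flip x : notv (flip x i) = notv x.
Proof.
have fe y : (flip x i == y) = (x == flip y i) by rewrite -(inj_eq (inv_inj (flipK i))) flipK.
by rewrite /notv !fe flipK andbC.
Qed.

(** All rungs except the one at [v'] are taken, which leaves [v'] uncovered. The resulting path
    visits [u'], [A], [v1], [Z], [v'] in this order. It is replaced by [u'], [A] and by [Z] reversed
    followed by [v1], [v'], which restores the omitted rung. The gap then joins a neighbour of [v1]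
    to a neighbour of [v'] at distance three. *)
Lemma step_layer : ham3 m u v.
Proof.
have mmR : ismat (rungs i notv) by apply: rungs_ismat notv_flip.
have gR : good (rungs i notv) u' v'.
  apply/goodP; split.
  - case/c1P => k tk h.
    have /andP[/eqP kE _] := h _ (erefl _).
    have := h v' tk; rewrite /rungs /notv eqxx /= andbF //.
  - by case/c2P => k [j [_ _ _ /andP[_]]]; rewrite /notv eqxx.
  - case/c3P => k vE /andP[/eqP kE]; rewrite /notv => /andP[_ /eqP]; apply.
    by rewrite /v1 vE kE flipK.
have [s [_ [_ [[[[ps us as_ ls] hs] _ _] _]]]] := IH mmR (rungs_dset i notv) puv' gR.
have v1s : v1 \in u' :: s by [].
have [A [R eA]] : exists A R, u' :: s = u' :: A ++ v1 :: R.
  move: v1s; rewrite inE => /predU1P[/v1u//|/splitPr[A R]].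
  by exists A, R.
have [Z eR] : exists Z, R = rcons Z v'.
  case: s eA ls {ps us as_ hs v1s} => [|y s]; first by case: A.
  case=> -> lv; move: lv; rewrite last_cat /=.
  by case/lastP: R => [/= /v1v//|Z w]; rewrite last_rcons => ->; exists Z.
rewrite {}eR in eA.
have hrung x : notv x -> linked (u' :: s) x (flip x i).
  by move=> nx; apply: hs; rewrite /rungs eqxx.
(* If [v1] came directly before [v'], the path would contain every edge of direction [i], against
   the necessity of the failure of C1. *)
have [Z' [z eZ]] : exists Z' z, Z = rcons Z' z.
  case/lastP: Z eA => [eA|Z' z _]; last by exists Z', z.
  have hf : ham (rungs i predT) u' v' s.
    split=> // x k /andP[/eqP-> _]; have [/hrung//|] := boolP (notv x).
    rewrite negb_and !negbK eA => /orP[] /eqP->; rewrite -/v1 ?flipK;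
      [apply: linkedC|]; left; by exists (u' :: A), [::].
  have /(ham_good (leq_trans (isT : 2 < 5) n5)) := hf.
  move/goodP => -[nc _ _]; case: nc; apply/c1P; exists i => // x _.
  by rewrite /rungs eqxx.
have sp : u' :: s = (u' :: A) ++ [:: v1] ++ Z ++ [:: v'].
  by rewrite eA -cats1.
have ub : [/\ v1 \notin u' :: A, v' \notin u' :: A, v1 \notin Z & v' \notin Z].
  move: us; rewrite sp cat_uniq => /and3P[_ /hasPn n1].
  rewrite /= mem_cat negb_or cat_uniq => /andP[/andP[-> _] /and3P[_ + _]].
  rewrite /= orbF => ->; split=> //; apply: n1; by rewrite !mem_cat !inE eqxx ?orbT.
have [vA v'A vZ v'Z] := ub.
have adj : forall x y, linked (u' :: s) x y -> qadj x y by apply/sorted_linked.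
pose p := last u' A.
have lp : u' :: A = rcons (belast u' A) p by rewrite -lastI.
have /adj/qadjP[k pE] : linked (u' :: s) v1 p.
  right; exists (belast u' A), (Z ++ [:: v']).
  by rewrite sp lp cat_rcons.
have /adj/qadjP[l zE] : linked (u' :: s) v' z.
  right; exists ((u' :: A) ++ [:: v1] ++ Z'), [::].
  by rewrite sp eZ -!catA cat_rcons.
have pA : p \in u' :: A by rewrite lp mem_rcons inE eqxx.
have zZ : z \in Z by rewrite eZ mem_rcons inE eqxx.
have ik : i != k.
  by apply/eqP => e; move: v'A; rewrite -(flipK i v') -/v1 e -pE pA.
have il : i != l.
  by apply/eqP => e; move: vZ; rewrite /v1 e -zE zZ.
(* Otherwise [p] and [z] are the ends of a rung, which the path must contain although [v1] lies
   between them. *)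
have kl : k != l.
  apply/eqP => e.
  have pz : flip z i = p by rewrite pE zE e flipC.
  have nz : notv z by apply/andP; split; apply/eqP => e'; [move: v'Z|move: vZ]; rewrite -e' zZ.
  have := hrung _ nz; rewrite pz sp => /linked_cat[/linked_mem/andP[zA _]|/linked_mem/andP[_ pR]|].
  - by move: us; rewrite sp cat_uniq => /and3P[_ /hasPn/(_ z)]; rewrite !mem_cat zZ !orbT zA => /(_ isT).
  - by move: us; rewrite sp cat_uniq => /and3P[_ /hasPn/(_ p pR)]; rewrite pA.
  case=> p' [q' [a [b [_ [<- _] [] [ez ep]]]]]; first by move: v'A vA; rewrite -ep pA.
  by move: vZ; rewrite -ez zZ.
apply: (@ham3N_pieces A (rev Z ++ [:: v1])).
- by apply/sorted_linked => x y h; apply: adj; rewrite sp; apply: linked_catl.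
- rewrite -cats1 -catA; apply/sorted_linked => x y /linked_cat[h|h|].
  + by apply: adj; rewrite sp; do 2!apply: linked_catr; apply: linked_catl; rewrite -(revK Z); apply: linked_rev.
  + have sv : sorted (@qadj n) [:: v1; v'] by rewrite /= andbT qadj_sym /v1 qadj_flip.
    exact: (sorted_linked _).2 sv _ _ h.
  + case=> p' [q' [a [b [eZ' [<- _] h]]]].
    have eZr : Z = a :: rev p' by rewrite -[Z]revK eZ' rev_rcons.
    have : qadj a v1.
      by apply: adj; right; exists (u' :: A), (rev p' ++ [:: v']); rewrite sp eZr.
    by case: h => -[-> ->] //; rewrite qadj_sym.
- rewrite -(perm_uniq (s1 := u' :: s)) // sp perm_cat2l -cats1 -!catA.
  by apply/permP => q; rewrite !count_cat count_rev /= !addn0 addnCA.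
- move=> x; rewrite -(perm_mem (s1 := u' :: s)) // sp perm_cat2l -cats1 -!catA.
  by apply/permP => q; rewrite !count_cat count_rev /= !addn0 addnCA.
- move=> x e /m0i ->; rewrite -cats1 -catA.
  have [nx|] := boolP (notv x); last first.
    rewrite negb_and !negbK => /orP[] /eqP->; rewrite -/v1 ?flipK; right; apply: linked_catr.
      by right; exists [::], [::].
    by left; exists [::], [::].
  have nx' : notv (flip x i) by rewrite notv_flip.
  have := hrung _ nx; rewrite sp; move/andP: nx nx' => [/eqP xv /eqP xv1] /andP[/eqP yv /eqP yv1].
  case/linked_cat => [h|/linked_cat[h|/linked_cat[h|h|h]|h]|h].
  + by left.
  + by case/linked_mem/andP: h; rewrite inE => /eqP.
  + by right; apply: linked_catl; apply: linked_rev.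
  + by case/linked_mem/andP: h; rewrite inE => /eqP.
  + by case: h => p' [q' [a [b [_ [e1 _] [] [e2 e3]]]]]; [case: yv; rewrite e1|case: xv; rewrite e1].
  + by case: h => p' [q' [a [b [e1 _ [] [e2 e3]]]]];
      case: (p') e1 => [|? []] // [e1]; [case: xv1; rewrite e1|case: yv1; rewrite e1].
  + by case: h => p' [q' [a [b [_ [e1 _] [] [e2 e3]]]]]; [case: yv1; rewrite e1|case: xv1; rewrite e1].
- rewrite eZ rev_rcons /= -/p pE zE !parity_flip; by case: (parity _).
- rewrite eZ rev_rcons /= -/p.
  have -> : p = flip (flip (flip z l) i) k by rewrite pE zE flipK.
  apply: good_sym => //; apply: good_far => //; by rewrite eq_sym.
Qed.

End Layer.

Section Almost.

Variables (i j : 'I_n).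
Hypotheses (ij : i != j) (vE : v' = flip u' i) (mu : m0 u' j) (mv : m0 v' j)
  (hi : forall x, typ i x = typ i u' -> x <> u' -> x <> v' -> m0 x i).
Hypothesis noside : forall e, (forall x, ~~ m x e) ->
  ~~ good (side e m (u e)) (proj e u) (proj e v).

Let w0 := flip u' j.
Let w1 := flip v' j.

Let m0ij x k : m0 x k -> k = i \/ k = j /\ (x \in [:: u'; v'; w0; w1]).
Proof.
have [ms un] := mm0; move=> mx; have [->|ki] := eqVneq k i; first by left.
right; have tv : typ i v' = typ i u' by rewrite vE typ_flip eqxx addbF.
have go y : typ i y = typ i u' -> m0 y k -> k = j /\ y \in [:: u'; v'].
  move=> ty my; rewrite !inE; have [yu|yu] := eqVneq y u'.
    by split=> //; apply: (un u') => //; rewrite -yu.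
  have [yv|yv] := eqVneq y v'.
    by split=> //; apply: (un v') => //; rewrite -yv.
  by move: ki; rewrite (un y k i my) ?eqxx //; apply: hi => //; apply/eqP.
have [tx|tx] := eqVneq (typ i x) (typ i u').
  have [-> h] := go _ tx mx; split=> //.
  by move: h; rewrite !inE => /orP[] ->; rewrite ?orbT.
have ty : typ i (flip x k) = typ i u'.
  by rewrite typ_flip [i == k]eq_sym ki; move: tx; case: (typ i x) (typ i u') => [] [].
have my : m0 (flip x k) k by rewrite ms.
have [kj h] := go _ ty my; split=> //; rewrite kj in h.
by move: h; rewrite !inE => /orP[] /eqP e; rewrite -[x](flipK j) e eqxx ?orbT.
Qed.

Let w10 : w1 = flip w0 i.
Proof. by rewrite /w1 vE flipC. Qed.

Let mw0 : m0 w0 j. Proof. by rewrite mm0.1. Qed.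
Let mw1 : m0 w1 j. Proof. by rewrite mm0.1. Qed.

Let neq_j x y : m0 x j -> m0 y i -> x <> y.
Proof. by move=> mx my e; move: ij; rewrite (mm0.2 x i j) ?eqxx // e. Qed.

(* [X] covers everything but [u', v']: it is cut at [w0 w1] and both parts are
   extended by the matching edges [u' w0] and [v' w1]. *)
Lemma twist X : uniq X -> (forall x, (x \in X) = (x != u') && (x != v')) ->
  sorted (@qadj n) X -> linked X w0 w1 ->
  (forall x, x \notin [:: u'; v'; w0; w1] -> linked X x (flip x i)) ->
  parity (head u' X) != parity (last u' X) -> good m1 (head u' X) (last u' X) -> ham3 m u v.
Proof.
move=> uX aX sX lX rX pX gX.
wlog [X1 [X2 eX]] : X uX aX sX lX rX pX gX / cons2 X w0 w1.
  move=> W; case: lX => c; first by apply: (W X) => //; left.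
  have hl : head u' (rev X) = last u' X.
    by case/lastP: (X) => // X' z; rewrite rev_rcons last_rcons.
  have lh : last u' (rev X) = head u' X.
    by case: (X) => // z X'; rewrite rev_cons last_rcons.
  apply: (W (rev X)); rewrite ?rev_uniq ?hl ?lh //.
  - by move=> x; rewrite mem_rev.
  - by apply/sorted_linked => x y /linked_rev; rewrite revK; apply: (sorted_linked X).2.
  - by apply: linked_rev; right.
  - by move=> x /rX h; apply: linked_rev.
  - by rewrite eq_sym.
  - exact: good_sym.
  - by case: c => a [b ->]; exists (rev b), (rev a); rewrite rev_cat !rev_cons -!cats1 -!catA.
have hX : last u' (w0 :: rev X1) = head u' X.
  by rewrite eX; case: (X1) => //= z X'; rewrite rev_cons last_rcons.
have tX : head v' (rev (w1 :: X2)) = last u' X.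
  by rewrite eX last_cat /= lastI rev_rcons.
have adj : forall x y, linked X x y -> qadj x y by apply/sorted_linked.
have e1 : u' :: w0 :: rev X1 = [:: u'] ++ rev (rcons X1 w0) by rewrite rev_rcons.
have e2 : X = rcons X1 w0 ++ w1 :: X2 by rewrite eX cat_rcons.
have wX : (w0 \in X) && (w1 \in X) by apply: linked_mem lX.
have perm : perm_eq ((u' :: w0 :: rev X1) ++ rcons (rev (w1 :: X2)) v') (u' :: v' :: X).
  rewrite eX; apply/permP => q; rewrite /= !count_cat count_rev -cats1 count_cat count_rev /=.
  rewrite addn0 -!addnA; congr (_ + _).
  by rewrite !addnA [LHS]addnC -!addnA; congr (_ + _); rewrite addnCA.
apply: (@ham3N_pieces (w0 :: rev X1) (rev (w1 :: X2))); rewrite ?hX ?tX //.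
- rewrite e1; apply/sorted_linked => x y /linked_cat[h|h|h].
  + by case: h => -[[|? [|? ?]] [? []]].
  + by apply: adj; rewrite e2; apply: linked_catl; rewrite -[rcons _ _]revK; apply: linked_rev.
  + case: h => p' [q' [a [b [ea]]]]; rewrite rev_rcons => -[eb _].
    have {}ea : a = u' by case: (p') ea => [|? []] // [].
    by rewrite ea -eb => -[] [-> ->]; rewrite /w0 ?qadj_flip // qadj_sym qadj_flip.
- rewrite -cats1; apply/sorted_linked => x y /linked_cat[h|h|h].
  + by apply: adj; rewrite e2; apply: linked_catr; rewrite -[w1 :: X2]revK; apply: linked_rev.
  + by case: h => -[[|? [|? ?]] [? []]].
  + case: h => p' [q' [a [b [ea [<- _]]]]].
    have {}ea : a = w1 by move: ea; rewrite rev_cons => /rcons_inj[].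
    by rewrite ea => -[] [-> ->]; rewrite /w1 ?qadj_flip // qadj_sym qadj_flip.
- rewrite (perm_uniq perm) /= uX inE !aX !eqxx /= andbF orbF andbT vE eq_sym.
  by rewrite flip_neq.
- move=> x; rewrite (perm_mem perm) !inE aX.
  by case: eqP => //= _; case: eqP.
move=> x k mx; case: (m0ij mx) => [ki|[kj xW]].
  have nW : x \notin [:: u'; v'; w0; w1].
    rewrite ki in mx; rewrite !inE !negb_or; apply/and4P; split; apply/eqP => e;
      [have h := neq_j mu mx|have h := neq_j mv mx|have h := neq_j mw0 mx|have h := neq_j mw1 mx];
      exact: h (esym e).
  have [xw0 xw1] : x <> w0 /\ x <> w1.
    by move: nW; rewrite !inE !negb_or => /and4P[_ _ /eqP ? /eqP ?].
  rewrite ki; have := rX _ nW; rewrite e2 => /linked_cat[h|h|h].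
  + by left; rewrite e1; apply: linked_catr; apply: linked_rev.
  + by right; rewrite -cats1; apply: linked_catl; apply: linked_rev.
  + case: h => p' [q' [a [b [/rcons_inj[_ <-] [<- _]]]]].
    by case=> -[].
rewrite kj; move: xW; rewrite !inE => /or4P[] /eqP->; rewrite /w0 /w1 ?flipK -/w0 -/w1.
- by left; left; exists [::], (rev X1).
- by right; right; exists (rev X2), [::]; rewrite rev_cons -cats1 -cats1 -catA.
- by left; right; exists [::], (rev X1).
- by right; left; exists (rev X2), [::]; rewrite rev_cons -cats1 -cats1 -catA.
Qed.

(** All rungs are taken, from [x'] to that one of [u'], [v'] whose parity differs; the types of the
    ends differ, so this is good. The path has to finish with the rung [u' v'], and without these
    two vertices it is a path [X] starting at [x']. The gap is good because [m1] leaves [x']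
    uncovered. *)
Let step_uncovered x' : (forall k, ~~ m1 x' k) -> typ i x' <> typ i u' -> ham3 m u v.
Proof.
move=> un tx.
have tv : typ i v' = typ i u' by rewrite vE typ_flip eqxx addbF.
have [e [f [pe fE euv]]] : exists e f, [/\ parity x' != parity e, f = flip e i
    & (e, f) = (u', v') \/ (e, f) = (v', u')].
  have [pu|pu] := eqVneq (parity x') (parity u').
    by exists v', u'; split; [rewrite pu|rewrite vE flipK|right].
  by exists u', v'; split=> //; left.
have te : typ i e = typ i u' by case: euv => -[-> _].
have mmR : ismat (rungs i predT) by apply: rungs_ismat.
have gR : good (rungs i predT) x' e.
  apply/goodP; split.
  - case/c1P => k tk /(_ _ (erefl _))/andP[/eqP kE _]; apply: tx.
    by rewrite -te -kE tk.
  - case/c2P => k [l [kl ek /andP[/eqP lE _] _ h]]; rewrite lE in kl.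
    have [z [tz _ zE]] := @fiber_typ _ n5 k i (typ k x') false [:: x'; e] kl isT.
    move: zE; rewrite !inE negb_or => /andP[/eqP zx /eqP ze].
    by have /andP[/eqP e' _] := h z tz zx ze; move: kl; rewrite e' eqxx.
  - case/c3P => k ek /andP[/eqP kE _]; apply: tx.
    by rewrite -te ek kE typ_flip eqxx addbF.
have [s [_ [_ [[[[ps us as_ ls] hs] _ _] _]]]] := IH mmR (rungs_dset i predT) pe gR.
have hrung x : linked (x' :: s) x (flip x i) by apply: hs; rewrite /rungs eqxx.
have xe : x' <> e by move=> xe; move: pe; rewrite xe eqxx.
have xf : x' <> f by move=> xf; apply: tx; rewrite xf fE typ_flip eqxx addbF.
have [X eX] : exists X, x' :: s = X ++ [:: f; e].
  have [s' es] : exists s', x' :: s = rcons s' e.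
    by exists (belast x' s); rewrite -ls -lastI.
  have := hrung e; rewrite -fE es -cats1 => /linked_cat[/linked_mem/andP[eX _]|h|h].
  - by move: us; rewrite es rcons_uniq eX.
  - by case: h => -[[|? [|? ?]] [? []]].
  case: h => p' [q' [a [b [ep [eb _] [] [ea ef]]]]].
    by move: (flip_neq e i); rewrite -fE ef eb eqxx.
  by exists p'; rewrite ep -ef -cats1 -catA.
have X0 : head u' X = x'.
  by case: X eX => [[/xf]|z X [->]].
have fX : f \notin X /\ e \notin X.
  move: us; rewrite eX cat_uniq => /and3P[_ + _]; rewrite /= orbF negb_or => /andP[-> ->]; by [].
have eXlr : exists X' c, X = rcons X' c.
  case/lastP: X eX {X0 fX} => [[/xf]//|X' c _]; by exists X', c.
have [X' [c eXc]] := eXlr.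
have lX : last u' X = c by rewrite eXc last_rcons.
have adj : forall x y, linked (x' :: s) x y -> qadj x y by apply/sorted_linked.
have pc : parity c = parity e.
  have /adj/qadjP[k fk] : linked (x' :: s) c f.
    by left; exists X', [:: e]; rewrite eX eXc cat_rcons.
  by move: fk; rewrite fE => /(congr1 (@parity n)); rewrite !parity_flip => /negb_inj ->.
have rX x : x != e -> x != f -> linked X x (flip x i).
  move=> xne xnf; have := hrung x; rewrite eX => /linked_cat[//|/linked_mem/andP[+ _]|h].
    by rewrite !inE (negPf xne) (negPf xnf).
  case: h => p' [q' [a [b [_ [eb _] [] [ea ef]]]]].
    by move: xne; rewrite -[x](flipK i) ef -eb fE flipK eqxx.
  by move: xnf; rewrite ea -eb eqxx.
have aX x : (x \in X) = (x != u') && (x != v').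
  have -> : (x != u') && (x != v') = (x != e) && (x != f).
    by case: euv => -[-> ->] //; rewrite andbC.
  have : x \in x' :: s by []; rewrite eX mem_cat !inE.
  case: (eqVneq x e) => [->|_]; first by rewrite (negPf fX.2).
  by case: (eqVneq x f) => [->|_]; [rewrite (negPf fX.1)|rewrite /= !orbF => ->].
have rX' x : x != u' -> x != v' -> linked X x (flip x i).
  by move=> xu xv; apply: rX; case: euv => -[ee ef]; rewrite ?ee ?ef.
apply: (@twist X) => //.
- by move: us; rewrite eX cat_uniq => /and3P[].
- by apply/sorted_linked => x y h; apply: adj; rewrite eX; apply: linked_catl.
- rewrite w10; apply: rX'; rewrite /w0 ?flip_neq // vE.
  by apply: contra ij => /eqP /flip_injr ->.
- by move=> x; rewrite !inE !negb_or => /and4P[xu xv _ _]; apply: rX'.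
- by rewrite X0 lX pc.
- by rewrite X0 lX; apply: good_uncovered.
Qed.

(** All rungs but [u' v'] are taken, from [u'] to [v'], which are then uncovered. The inner part [X]
    of the path has its ends at distance three, so they are good for [m1]. *)
Let step_no_hlayer : (forall k t, ~~ hlayer m1 k t) -> ham3 m u v.
Proof.
move=> nh; pose P x := (x != u') && (x != v').
have fe x y : (flip x i == y) = (x == flip y i) by rewrite -(inj_eq (inv_inj (flipK i))) flipK.
have mmR : ismat (rungs i P).
  by apply: rungs_ismat => x; rewrite /P !fe vE flipK andbC.
have nu k : ~~ rungs i P u' k by rewrite /rungs /P eqxx andbF.
have gR : good (rungs i P) u' v' by apply: good_uncovered.
have [s [_ [_ [[[[ps us as_ ls] hs] _ _] _]]]] := IH mmR (rungs_dset i P) puv' gR.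
have hrung x : P x -> linked (u' :: s) x (flip x i) by move=> h; apply: hs; rewrite /rungs eqxx.
have uv : u' <> v' by move=> e; move: puv'; rewrite e eqxx.
have [X eX] : exists X, u' :: s = [:: u'] ++ X ++ [:: v'].
  by case/lastP: s ls {ps us as_ hs hrung} => [/uv//|X w]; rewrite last_rcons => ->; exists X; rewrite cats1.
have uvX : u' \notin X /\ v' \notin X.
  move: us; rewrite eX /= mem_cat negb_or cat_uniq => /andP[/andP[-> _] /and3P[_ + _]].
  by rewrite /= orbF.
have rX x : P x -> linked X x (flip x i).
  move=> Px; have Py : P (flip x i) by move: Px; rewrite /P !fe vE flipK andbC.
  have := hrung x Px; rewrite eX.
  move: Px Py => /andP[/eqP xu /eqP xv] /andP[/eqP yu /eqP yv].
  case/linked_cat => [/linked_mem/andP[]|/linked_cat[//|/linked_mem/andP[]|h]|h].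
  - by rewrite inE => /eqP.
  - by rewrite inE => /eqP.
  - by case: h => p' [q' [a [b [_ [<- _] [] [? ?]]]]].
  - by case: h => p' [q' [a [b [e1 _ h]]]]; case: (p') e1 => [|? []] // [e1]; case: h => -[? ?]; [case: xu|case: yu]; rewrite e1.
have adj : forall x y, linked (u' :: s) x y -> qadj x y by apply/sorted_linked.
have Pw0 : P w0.
  by rewrite /P /w0 flip_neq vE /=; apply: contra ij => /eqP /flip_injr ->.
have lw : linked X w0 w1 by rewrite w10; apply: rX.
have sX : size X = (2 ^ n).-2.
  have hsz : size (u' :: s) = 2 ^ n by apply: ham_size (conj (And4 ps us as_ ls) hs).
  by rewrite -hsz eX !size_cat /= addn1.
have n8 : 7 < 2 ^ n.
  by apply: (@leq_trans (2 ^ 3)) => //; rewrite leq_exp2l // (leq_trans _ n5).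
have [h [t [Y eXh]]] : exists h t Y, X = h :: rcons Y t.
  case: (X) lw sX => [/linked_mem//|h X']; case/lastP: X' => [|Y t]; last by exists h, t, Y.
  by move=> _ /=; move: n8; case: (2 ^ n) => [|[|[|[|?]]]].
have hX : head u' X = h by rewrite eXh.
have tX : last u' X = t by rewrite eXh /= last_rcons.
have /adj/qadjP[k hE] : linked (u' :: s) u' h.
  by left; exists [::], (rcons Y t ++ [:: v']); rewrite eX eXh.
have /adj/qadjP[l tE] : linked (u' :: s) v' t.
  by right; exists (u' :: h :: Y), [::]; rewrite eX eXh /= -cats1 -catA.
have hXin : h \in X by rewrite eXh inE eqxx.
have tXin : t \in X by rewrite eXh inE mem_rcons inE eqxx orbT.
have ik : i != k by apply/eqP => e; move: uvX.2; rewrite vE e -hE hXin.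
have il : i != l.
  apply/eqP => e; move: uvX.1; rewrite -{1}[u'](flipK i) -vE e -tE tXin //.
have uX : uniq X by move: us; rewrite eX /= => /andP[_]; rewrite cat_uniq => /and3P[].
(* Otherwise the first and the last vertex of [X] form a rung and would be consecutive on [X], which
   is too long for that. *)
have kl : k != l.
  apply/eqP => e.
  have th : flip h i = t by rewrite hE tE e vE flipC.
  have Ph : P h by apply/andP; split; apply/eqP => e'; [move: uvX.1|move: uvX.2]; rewrite -e' hXin.
  have := rX h Ph; rewrite th => /(linked_index uX).
  have ih : index h X = 0 by rewrite eXh /= eqxx.
  have it : index t X = (size X).-1.
    have : nth u' X (size X).-1 = t by rewrite nth_last.
    by move=> <-; rewrite index_uniq // eXh /= size_rcons.
  rewrite ih it => -[]; last by [].
  by rewrite sX; move: n8; case: (2 ^ n) => [|[|[|[|[|?]]]]].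
apply: (@twist X) => //.
- move=> x; rewrite -/(P x).
  have : x \in u' :: s by []; rewrite eX !mem_cat !inE /P.
  case: (eqVneq x u') => [->|_]; first by rewrite (negPf uvX.1).
  by case: (eqVneq x v') => [->|_]; [rewrite (negPf uvX.2)|rewrite /= orbF => ->].
- by apply/sorted_linked => x y xy; apply: adj; rewrite eX; apply: linked_catr; apply: linked_catl.
- by move=> x; rewrite !inE !negb_or => /and4P[xu xv _ _]; apply: rX; apply/andP.
- by rewrite hX tX hE tE !parity_flip; move: puv'; case: (parity u') (parity v') => [] [].
- rewrite hX tX; have -> : t = flip (flip (flip h k) i) l by rewrite hE tE vE flipK.
  by apply: good_far => //; rewrite eq_sym.
Qed.

Lemma step_almost : ham3 m u v.
Proof.
have [/existsP[k /existsP[t hk]]|nh] := boolP [exists k, exists t, hlayer m1 k t]; last first.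
  apply: step_no_hlayer => k t; apply: contra nh => h.
  by apply/existsP; exists k; apply/existsP; exists t.
have m1k x l : m1 x l -> l = k by apply: hlayer_single mm1 hk.
have [ki|ki] := eqVneq k i.
  have [x tx ux] : exists2 x, typ i x <> typ i u' & ~~ m1 x i.
    have [/existsP[x /andP[/eqP tx mx]]|/existsPn h] := boolP [exists x, (typ i x != typ i u') && ~~ m1 x i].
      by exists x.
    case/goodP: g => _ nc2 _; case: nc2; apply/c2P; exists (lift d i), (lift d j).
    have uE : ins d (u d) u' = u by rewrite projK.
    have vE' : ins d (u d) v' = v by rewrite -vd projK.
    split; first by rewrite (inj_eq (@lift_inj _ d)).
    - by rewrite -uE flip_ins_lift -vE vE'.
    - by rewrite -{1}uE.
    - by rewrite -{1}vE'.
    move=> z; have [b [y ->]] := ins_surj d z; rewrite -{1}uE !typ_lift.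
    have [->|bu] := eqVneq b (u d).
      by move=> /addbI ty yu yv; apply: hi => // e; [apply: yu|apply: yv]; rewrite e.
    have -> : b = ~~ u d by case: (b) (u d) bu => [] [].
    move=> ty _ _; move: (h y); rewrite negb_and !negbK => /orP[/eqP e|//].
    by move: ty; rewrite e; case: (u d) (typ i u') => [] [].
  apply: step_uncovered tx => l; apply/negP => ml.
  by move: ux; rewrite -ki -(m1k _ _ ml) ml.
exfalso.
have [e] := @ord_avoid n.+1 [:: d; lift d i; lift d j; lift d k] (leqW n5).
rewrite !inE !negb_or => /and4P[ed ei ej ek].
have ue x : ~~ m x e.
  apply/negP => mx; have [l le] := dset_lift mx.
  case/orP => [/m0ij[li|[lj _]]|/m1k lk].
  - by move: ei; rewrite le li eqxx.
  - by move: ej; rewrite le lj eqxx.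
  - by move: ek; rewrite le lk eqxx.
have [a] := @ord_avoid n.+1 [:: d; e; lift d i] (leq_trans (isT : 3 < 5) (leqW n5)).
rewrite !inE !negb_or => /and3P[ad ae ai].
have [i2 iE|i2] := unliftP e (lift d i); last by move: ei; rewrite -i2 eqxx.
have vu : v = flip u (lift d i).
  by rewrite -[u](projK d) flip_ins_lift -/u' -vE -vd projK.
have pvE : proj e v = flip (proj e u) i2 by rewrite vu iE proj_flip_lift.
(* This vertex lies with [u] in the half cut along [e] and has the type of [u] in direction [i].
   With respect to [d] it lies opposite to [u], where only [k] occurs. So it is not matched along
   [i] and destroys both C1 and C2. *)
pose z := flip (flip u d) a.
have zd : z d = ~~ u d by rewrite !flipE eqxx [d == a]eq_sym (negPf ad) addbF addbT.
have ze : z e = u e by rewrite !flipE [e == a]eq_sym (negPf ed) (negPf ae) !addbF.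
have tz : typ (lift d i) z = typ (lift d i) u.
  by rewrite !typ_flip [_ == a]eq_sym ai [_ == d]eq_sym (neq_lift d i) -addbA addbF.
have nz : m z (lift d i) -> False.
  move=> mz; have /m1k e' : m1 (proj d z) i by rewrite /m1 /side -zd projK.
  by move: ki; rewrite e' eqxx.
have ty : typ i2 (proj e z) = typ i2 (proj e u).
  move: tz; rewrite iE -{1}[z](projK e) -{1}[u](projK e) !typ_lift ze.
  exact: addbI.
have mzE : side e m (u e) (proj e z) i2 -> False.
  by move=> h; apply: nz; rewrite iE -[z](projK e) ze.
have zu : proj e z <> proj e u.
  move=> e'; have /ffunP/(_ d) : z = u by rewrite -[z](projK e) ze e' projK.
  by rewrite zd; case: (u d).
have zv : proj e z <> proj e v.
  move=> e'; have ve : v e = u e by rewrite vu flipE (negPf ei) addbF.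
  have /ffunP/(_ d) : z = v by rewrite -[z](projK e) ze e' -ve projK.
  by rewrite zd vd; case: (u d).
move: (noside ue); rewrite negbK => /or3P[/c1P[f tf h]|/c2P[f [l [_ fE _ _ h]]]|/c3P[f fE mf]].
- have fi : f = i2 by move: tf; rewrite pvE typ_flip; case: eqP => // _; case: (typ f _).
  by apply: mzE; rewrite fi in h; apply: h.
- have fi : f = i2 by move: fE; rewrite pvE => /flip_injr.
  by apply: mzE; rewrite fi in h; apply: h.
- case/goodP: g => _ _; apply; apply/c3P; exists (lift d i) => //.
  have fi : f = i2 by move: fE; rewrite pvE => /flip_injr.
  by move: mf; rewrite /side projK fi iE.
Qed.

End Almost.

Lemma step_bad : (forall e, (forall x, ~~ m x e) -> v e = u e) ->
  (forall e, (forall x, ~~ m x e) -> ~~ good (side e m (u e)) (proj e u) (proj e v)) -> ham3 m u v.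
Proof.
move=> nosep noside; move: (noside d du); rewrite negbK -/m0 -/u' -/v'.
case/or3P => [/c1P[i ti hi]|/c2P[i [j [ij vE mu mv hi]]]|/nc3//].
  exact: step_layer ti hi nosep.
exact: step_almost ij vE mu mv hi noside.
Qed.

End StepBad.

Theorem few_directions_step n : 4 < n -> few_directions_extend n -> few_directions_extend n.+1.
Proof.
move=> n5 IH m u v mm dm puv g.
have unused e : e \notin dset m -> forall x, ~~ m x e.
  by move=> h x; apply: contra h => mx; rewrite inE; apply/existsP; exists x.
have used e : (forall x, ~~ m x e) -> e \notin dset m.
  by move=> h; rewrite inE; apply/existsPn.
have [d dd] : exists d, d \notin dset m.
  apply/existsP; apply: contraT => /existsPn h.
  have : #|'I_n.+1| <= #|dset m|.
    by apply: subset_leq_card; apply/subsetP => e _; move: (h e); rewrite negbK.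
  by rewrite card_ord leqNgt (leq_trans (_ : _ < 6)) // ltnS (leq_trans dm).
have [/existsP[e /andP[ed /eqP ve]]|/existsPn nosep] :=
  boolP [exists e, (e \notin dset m) && (v e == ~~ u e)].
  exact: (stepS n5 IH mm dm puv g (unused _ ed) ve).
have sep e : (forall x, ~~ m x e) -> v e = u e.
  by move=> /used ed; move: (nosep e); rewrite ed /=; case: (v e) (u e) => [] [].
have [/existsP[e /andP[ed ge]]|/existsPn noside] :=
  boolP [exists e, (e \notin dset m) && good (side e m (u e)) (proj e u) (proj e v)].
  by apply: (stepN_good n5 IH mm dm puv (unused _ ed) (sep _ (unused _ ed)) ge).
apply: (step_bad n5 IH mm dm puv g (unused _ dd) (sep _ (unused _ dd)) sep) => e /used ed.
by move: (noside e); rewrite ed.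
Qed.

(** * Certificates for the five-dimensional cube *)

(* Subsets of a set of four elements, enumerated so that set operations are
   table lookups. *)
Inductive nib := N0 | N1 | N2 | N3 | N4 | N5 | N6 | N7 | N8 | N9 | Na | Nb | Nc | Nd | Ne | Nf.

Definition nsub (a b : nib) : bool := match a with
  | N0 => true
  | N1 => match b with N1 | N3 | N5 | N7 | N9 | Nb | Nd | Nf => true | _ => false end
  | N2 => match b with N2 | N3 | N6 | N7 | Na | Nb | Ne | Nf => true | _ => false end
  | N3 => match b with N3 | N7 | Nb | Nf => true | _ => false end
  | N4 => match b with N4 | N5 | N6 | N7 | Nc | Nd | Ne | Nf => true | _ => false end
  | N5 => match b with N5 | N7 | Nd | Nf => true | _ => false end
  | N6 => match b with N6 | N7 | Ne | Nf => true | _ => false end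
  | N7 => match b with N7 | Nf => true | _ => false end
  | N8 => match b with N8 | N9 | Na | Nb | Nc | Nd | Ne | Nf => true | _ => false end
  | N9 => match b with N9 | Nb | Nd | Nf => true | _ => false end
  | Na => match b with Na | Nb | Ne | Nf => true | _ => false end
  | Nb => match b with Nb | Nf => true | _ => false end
  | Nc => match b with Nc | Nd | Ne | Nf => true | _ => false end
  | Nd => match b with Nd | Nf => true | _ => false end
  | Ne => match b with Ne | Nf => true | _ => false end
  | Nf => match b with Nf => true | _ => false end
  end.

Definition nand (a b : nib) : nib := match a with
  | N0 => match b with N0 => N0 | N1 => N0 | N2 => N0 | N3 => N0 | N4 => N0 | N5 => N0 | N6 => N0 | N7 => N0 | N8 => N0 | N9 => N0 | Na => N0 | Nb => N0 | Nc => N0 | Nd => N0 | Ne => N0 | Nf => N0 end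
  | N1 => match b with N0 => N0 | N1 => N1 | N2 => N0 | N3 => N1 | N4 => N0 | N5 => N1 | N6 => N0 | N7 => N1 | N8 => N0 | N9 => N1 | Na => N0 | Nb => N1 | Nc => N0 | Nd => N1 | Ne => N0 | Nf => N1 end
  | N2 => match b with N0 => N0 | N1 => N0 | N2 => N2 | N3 => N2 | N4 => N0 | N5 => N0 | N6 => N2 | N7 => N2 | N8 => N0 | N9 => N0 | Na => N2 | Nb => N2 | Nc => N0 | Nd => N0 | Ne => N2 | Nf => N2 end
  | N3 => match b with N0 => N0 | N1 => N1 | N2 => N2 | N3 => N3 | N4 => N0 | N5 => N1 | N6 => N2 | N7 => N3 | N8 => N0 | N9 => N1 | Na => N2 | Nb => N3 | Nc => N0 | Nd => N1 | Ne => N2 | Nf => N3 end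
  | N4 => match b with N0 => N0 | N1 => N0 | N2 => N0 | N3 => N0 | N4 => N4 | N5 => N4 | N6 => N4 | N7 => N4 | N8 => N0 | N9 => N0 | Na => N0 | Nb => N0 | Nc => N4 | Nd => N4 | Ne => N4 | Nf => N4 end
  | N5 => match b with N0 => N0 | N1 => N1 | N2 => N0 | N3 => N1 | N4 => N4 | N5 => N5 | N6 => N4 | N7 => N5 | N8 => N0 | N9 => N1 | Na => N0 | Nb => N1 | Nc => N4 | Nd => N5 | Ne => N4 | Nf => N5 end
  | N6 => match b with N0 => N0 | N1 => N0 | N2 => N2 | N3 => N2 | N4 => N4 | N5 => N4 | N6 => N6 | N7 => N6 | N8 => N0 | N9 => N0 | Na => N2 | Nb => N2 | Nc => N4 | Nd => N4 | Ne => N6 | Nf => N6 end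
  | N7 => match b with N0 => N0 | N1 => N1 | N2 => N2 | N3 => N3 | N4 => N4 | N5 => N5 | N6 => N6 | N7 => N7 | N8 => N0 | N9 => N1 | Na => N2 | Nb => N3 | Nc => N4 | Nd => N5 | Ne => N6 | Nf => N7 end
  | N8 => match b with N0 => N0 | N1 => N0 | N2 => N0 | N3 => N0 | N4 => N0 | N5 => N0 | N6 => N0 | N7 => N0 | N8 => N8 | N9 => N8 | Na => N8 | Nb => N8 | Nc => N8 | Nd => N8 | Ne => N8 | Nf => N8 end
  | N9 => match b with N0 => N0 | N1 => N1 | N2 => N0 | N3 => N1 | N4 => N0 | N5 => N1 | N6 => N0 | N7 => N1 | N8 => N8 | N9 => N9 | Na => N8 | Nb => N9 | Nc => N8 | Nd => N9 | Ne => N8 | Nf => N9 end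
  | Na => match b with N0 => N0 | N1 => N0 | N2 => N2 | N3 => N2 | N4 => N0 | N5 => N0 | N6 => N2 | N7 => N2 | N8 => N8 | N9 => N8 | Na => Na | Nb => Na | Nc => N8 | Nd => N8 | Ne => Na | Nf => Na end
  | Nb => match b with N0 => N0 | N1 => N1 | N2 => N2 | N3 => N3 | N4 => N0 | N5 => N1 | N6 => N2 | N7 => N3 | N8 => N8 | N9 => N9 | Na => Na | Nb => Nb | Nc => N8 | Nd => N9 | Ne => Na | Nf => Nb end
  | Nc => match b with N0 => N0 | N1 => N0 | N2 => N0 | N3 => N0 | N4 => N4 | N5 => N4 | N6 => N4 | N7 => N4 | N8 => N8 | N9 => N8 | Na => N8 | Nb => N8 | Nc => Nc | Nd => Nc | Ne => Nc | Nf => Nc end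
  | Nd => match b with N0 => N0 | N1 => N1 | N2 => N0 | N3 => N1 | N4 => N4 | N5 => N5 | N6 => N4 | N7 => N5 | N8 => N8 | N9 => N9 | Na => N8 | Nb => N9 | Nc => Nc | Nd => Nd | Ne => Nc | Nf => Nd end
  | Ne => match b with N0 => N0 | N1 => N0 | N2 => N2 | N3 => N2 | N4 => N4 | N5 => N4 | N6 => N6 | N7 => N6 | N8 => N8 | N9 => N8 | Na => Na | Nb => Na | Nc => Nc | Nd => Nc | Ne => Ne | Nf => Ne end
  | Nf => match b with N0 => N0 | N1 => N1 | N2 => N2 | N3 => N3 | N4 => N4 | N5 => N5 | N6 => N6 | N7 => N7 | N8 => N8 | N9 => N9 | Na => Na | Nb => Nb | Nc => Nc | Nd => Nd | Ne => Ne | Nf => Nf end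
  end.

Definition ng0 (a : nib) : bool := match a with N1 | N3 | N5 | N7 | N9 | Nb | Nd | Nf => true | _ => false end.

Definition ng1 (a : nib) : bool := match a with N2 | N3 | N6 | N7 | Na | Nb | Ne | Nf => true | _ => false end.

Definition ng2 (a : nib) : bool := match a with N4 | N5 | N6 | N7 | Nc | Nd | Ne | Nf => true | _ => false end.

Definition ng3 (a : nib) : bool := match a with N8 | N9 | Na | Nb | Nc | Nd | Ne | Nf => true | _ => false end.

Definition ns0 (a : nib) : nib := match a with N0 => N1 | N1 => N1 | N2 => N3 | N3 => N3 | N4 => N5 | N5 => N5 | N6 => N7 | N7 => N7 | N8 => N9 | N9 => N9 | Na => Nb | Nb => Nb | Nc => Nd | Nd => Nd | Ne => Nf | Nf => Nf end.

Definition ns1 (a : nib) : nib := match a with N0 => N2 | N1 => N3 | N2 => N2 | N3 => N3 | N4 => N6 | N5 => N7 | N6 => N6 | N7 => N7 | N8 => Na | N9 => Nb | Na => Na | Nb => Nb | Nc => Ne | Nd => Nf | Ne => Ne | Nf => Nf end.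

Definition ns2 (a : nib) : nib := match a with N0 => N4 | N1 => N5 | N2 => N6 | N3 => N7 | N4 => N4 | N5 => N5 | N6 => N6 | N7 => N7 | N8 => Nc | N9 => Nd | Na => Ne | Nb => Nf | Nc => Nc | Nd => Nd | Ne => Ne | Nf => Nf end.

Definition ns3 (a : nib) : nib := match a with N0 => N8 | N1 => N9 | N2 => Na | N3 => Nb | N4 => Nc | N5 => Nd | N6 => Ne | N7 => Nf | N8 => N8 | N9 => N9 | Na => Na | Nb => Nb | Nc => Nc | Nd => Nd | Ne => Ne | Nf => Nf end.

Definition nget (a : nib) (c d : bool) : bool :=
  if d then (if c then ng3 a else ng2 a) else (if c then ng1 a else ng0 a).

Definition nset (a : nib) (c d : bool) : nib :=
  if d then (if c then ns3 a else ns2 a) else (if c then ns1 a else ns0 a).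

Inductive vtx := V (b0 b1 b2 b3 : bool).

Inductive dir := D0 | D1 | D2 | D3.

Definition nbr (i : dir) (x : vtx) : vtx := let: V a b c d := x in
  match i with D0 => V (~~ a) b c d | D1 => V a (~~ b) c d | D2 => V a b (~~ c) d | D3 => V a b c (~~ d) end.

Definition veq (x y : vtx) : bool := let: V a b c d := x in let: V a' b' c' d' := y in
  [&& eqb a a', eqb b b', eqb c c' & eqb d d'].

Definition vpar (x : vtx) : bool := let: V a b c d := x in a (+) b (+) c (+) d.

Definition vbit (i : dir) (x : vtx) : bool := let: V a b c d := x in
  match i with D0 => a | D1 => b | D2 => c | D3 => d end.

Definition deq (i j : dir) :=
  match i, j with D0, D0 | D1, D1 | D2, D2 | D3, D3 => true | _, _ => false end.

Lemma veqP : Equality.axiom veq.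
Proof. by move=> [[] [] [] []] [[] [] [] []]; constructor. Qed.
HB.instance Definition _ := hasDecEq.Build vtx veqP.

Lemma deqP : Equality.axiom deq.
Proof. by move=> [] []; constructor. Qed.
HB.instance Definition _ := hasDecEq.Build dir deqP.

(* A set of edges of Q4.  The edges of each direction fall into two groups of
   four, told apart by the parity of the three other coordinates. *)
Inductive eset := E (a a' b b' c c' d d' : nib).

Definition getE (e : eset) (i : dir) (x : vtx) : bool :=
  let: E a a' b b' c c' d d' := e in let: V p q r s := x in
  match i with
  | D0 => nget (if q (+) r (+) s then a' else a) q r
  | D1 => nget (if p (+) r (+) s then b' else b) p r
  | D2 => nget (if p (+) q (+) s then c' else c) p q
  | D3 => nget (if p (+) q (+) r then d' else d) p q
  end.

Definition setE (e : eset) (i : dir) (x : vtx) : eset :=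
  let: E a a' b b' c c' d d' := e in let: V p q r s := x in
  match i with
  | D0 => if q (+) r (+) s then E a (nset a' q r) b b' c c' d d' else E (nset a q r) a' b b' c c' d d'
  | D1 => if p (+) r (+) s then E a a' b (nset b' p r) c c' d d' else E a a' (nset b p r) b' c c' d d'
  | D2 => if p (+) q (+) s then E a a' b b' c (nset c' p q) d d' else E a a' b b' (nset c p q) c' d d'
  | D3 => if p (+) q (+) r then E a a' b b' c c' d (nset d' p q) else E a a' b b' c c' (nset d p q) d'
  end.

Definition andE (e f : eset) : eset :=
  let: E a a' b b' c c' d d' := e in let: E x x' y y' z z' t t' := f in
  E (nand a x) (nand a' x') (nand b y) (nand b' y') (nand c z) (nand c' z') (nand d t) (nand d' t').

(** Nested conditionals, here and in the search below, stop at the first failure; under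
    call-by-value evaluation a conjunction would compute both its arguments. *)
Definition subE (e f : eset) : bool :=
  let: E a a' b b' c c' d d' := e in let: E x x' y y' z z' t t' := f in
  if nsub a x then if nsub a' x' then if nsub b y then if nsub b' y' then
  if nsub c z then if nsub c' z' then if nsub d t then nsub d' t'
  else false else false else false else false else false else false else false.

(* Lists of edge sets, in a form that keeps the certificates small. *)
Inductive elist := enil | econs (a a' b b' c c' d d' : nib) (l : elist).

Fixpoint eseq (l : elist) : seq eset :=
  if l is econs a a' b b' c c' d d' l' then E a a' b b' c c' d d' :: eseq l' else [::].

Definition E0 := E N0 N0 N0 N0 N0 N0 N0 N0.

Definition star (x : vtx) (e : eset) : bool :=
  if getE e D0 x then true else if getE e D1 x then true else if getE e D2 x then true else getE e D3 x.

Definition bools := [:: false; true].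

Definition verts := flatten [seq flatten [seq flatten [seq [seq V a b c d | a <- bools] | b <- bools] | c <- bools] | d <- bools].

Definition dirs := [:: D0; D1; D2; D3].

Definition mkE (f : dir -> vtx -> bool) : eset :=
  foldr (fun x e => foldr (fun i e => if f i x then setE e i x else e) e dirs) E0 verts.

Definition vin (x : vtx) (s : seq vtx) := has (veq x) s.

(** The edges that stay possible once the edge of direction [i] at [x] is chosen: this edge and all
    edges disjoint from it. *)
Definition commask (x : vtx) (i : dir) : eset :=
  mkE (fun j y => [|| vin y [:: x; nbr i x] && (vin (nbr j y) [:: x; nbr i x]) |
       ~~ (vin y [:: x; nbr i x] || vin (nbr j y) [:: x; nbr i x])]).

Definition clrmask (x : vtx) : eset := mkE (fun j y => ~~ (veq y x || veq (nbr j y) x)).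

(** Every edge has exactly one even end, so it suffices to decide at the even vertices. *)
Definition masks := Eval vm_compute in
  [seq (x, (commask x D0, commask x D1), (commask x D2, commask x D3), clrmask x) | x <- verts & ~~ vpar x].

Inductive row := Row (x : vtx) (m0 m1 m2 m3 cl : eset) (nb : seq vtx).

(* What is known about the matchings of a class: [LD] lists the directions they
   may use, [LK e] says that they contain [e]. *)
Inductive label := LD (b0 b1 b2 b3 : bool) | LK (e : eset).

(** A test for non-maximality: a listed neighbour without any possible edge could still be matched
    with the vertex that was left uncovered. *)
Fixpoint hasfree (nb : seq vtx) (p : eset) : bool :=
  if nb is y :: nb' then (if star y p then hasfree nb' p else true) else false.

Definition ftab (i : dir) (x : vtx) (tabs : seq (seq eset)) := [seq [seq c <- t | getE c i x] | t <- tabs].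

(* Runs through the maximal matchings: [p] holds the edges that are still
   possible, [tabs] the covers that contain all the edges chosen so far, and at
   most [ub] vertices are left uncovered. *)
Section DFS.
Variable lf : seq (seq eset) -> eset -> bool.

Fixpoint dfs (rs : seq row) (ub : nat) (tabs : seq (seq eset)) (p : eset) {struct rs} : bool :=
  if rs is Row x m0 m1 m2 m3 cl nb :: rs' then
    if (if getE p D0 x then dfs rs' ub (ftab D0 x tabs) (andE p m0) else true) then
    if (if getE p D1 x then dfs rs' ub (ftab D1 x tabs) (andE p m1) else true) then
    if (if getE p D2 x then dfs rs' ub (ftab D2 x tabs) (andE p m2) else true) then
    if (if getE p D3 x then dfs rs' ub (ftab D3 x tabs) (andE p m3) else true) then
      if ub is ub'.+1 then
        let p' := andE p cl in if hasfree nb p' then true else dfs rs' ub' tabs p'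
      else true
    else false else false else false else false
  else lf tabs p.
End DFS.

(* Q5 is cut into two copies of Q4.  The path goes from [v0] in the first copy to
   [v] in the first copy, or in the second if [sep]; [K] are the matching edges
   between the copies.  A pattern is the sequence of the vertices at which the
   path changes copies. *)
Inductive config := Cfg (sep : bool) (v : vtx) (K : seq vtx) (pats : seq (seq vtx)).

Definition v0 := V false false false false.

Fixpoint pairs (on : bool) (u : vtx) (c : seq vtx) (v : vtx) : seq (vtx * vtx) :=
  if c is x :: c' then (if on then [:: (u, x)] else [::]) ++ pairs (~~ on) x c' v
  else if on then [:: (u, v)] else [::].

Section Side.

Variables (sd sep : bool) (v : vtx) (K : seq vtx).

Definition forb (i : dir) (x : vtx) : bool :=
  [&& ~~ sep, ~~ sd & (veq x v0 && veq (nbr i x) v) || (veq x v && veq (nbr i x) v0)].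

Definition allowed (i : dir) (x : vtx) : bool :=
  [&& ~~ vin x K, ~~ vin (nbr i x) K & ~~ forb i x].

Definition rowsof : seq row :=
  [seq let: (x, (m0, m1), (m2, m3), cl) := r in
       Row x m0 m1 m2 m3 cl [seq nbr i x | i <- dirs & allowed i x]
   | r <- masks & ~~ vin r.1.1.1 K].

Definition p0 := mkE allowed.

(** Three crossing edges are treated only for matchings with at most one uncovered vertex of each
    parity; 8 is the number of even vertices of Q4, hence no restriction. *)
Definition ub := if size K == 3 then 1 else 8.

Definition oddsK := [seq y <- verts | vpar y & ~~ vin y K].

Fixpoint few (n : nat) (s : seq vtx) (p : eset) : bool :=
  if s is y :: s' then if star y p then few n s' p else if n is n'.+1 then few n' s' p else false
  else true.

(** [dfs] tests maximality when a vertex is left uncovered; at a leaf fewer edges are possible, so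
    the test is repeated for all even vertices. *)
Fixpoint vac (rs : seq row) (p : eset) : bool :=
  if rs is Row x _ _ _ _ _ nb :: rs' then
    if star x p then vac rs' p else if hasfree nb p then true else vac rs' p
  else false.

Fixpoint trail (x : vtx) (ds : seq dir) : seq vtx :=
  x :: (if ds is i :: ds' then trail (nbr i x) ds' else [::]).

Fixpoint tedges (x : vtx) (ds : seq dir) (e : eset) : eset :=
  if ds is i :: ds' then tedges (nbr i x) ds' (setE e i x) else e.

(** A system of paths is stored as its edge set. Following edges and never using the last direction
    again recovers the path from its first vertex; 15 steps are enough in Q4. *)
Definition nextd (c : eset) (x : vtx) (i : option dir) : option dir :=
  let ok j := if (if i is Some k then deq k j else false) then false else getE c j x in
  if ok D0 then Some D0 else if ok D1 then Some D1 else if ok D2 then Some D2 else if ok D3 then Some D3 else None.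

Fixpoint walk (n : nat) (c : eset) (x : vtx) (i : option dir) : seq dir :=
  if n is n'.+1 then
    if nextd c x i is Some j then j :: walk n' c (nbr j x) (Some j) else [::]
  else [::].

Inductive vset := VS (a b c d : nib).

Definition vmark (s : vset) (x : vtx) : vset := let: VS a b c d := s in let: V p q r t := x in
  if r then if t then VS a b c (nset d p q) else VS a b (nset c p q) d
  else if t then VS a (nset b p q) c d else VS (nset a p q) b c d.

Definition vfull (s : vset) : bool := if s is VS Nf Nf Nf Nf then true else false.

Definition vmem (s : vset) (x : vtx) : bool := let: VS a b c d := s in let: V p q r t := x in
  if r then if t then nget d p q else nget c p q else if t then nget b p q else nget a p q.

Definition VS0 := VS N0 N0 N0 N0.

(** Nothing about a proposed cover is trusted. The walks must join the prescribed pairs, and sixteen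
    counted visits that mark all sixteen vertices leave no room for repetitions. The result consists
    of the edges actually walked. *)
Fixpoint covck (ps : seq (vtx * vtx)) (c : eset) (w : eset) (s : vset) (n : nat) : option eset :=
  if ps is (a, b) :: ps' then
    let ds := walk 15 c a None in let t := trail a ds in
    if veq (last a t) b then covck ps' c (tedges a ds w) (foldl vmark s t) (size t + n) else None
  else if (if n == 16 then vfull s else false) then Some w else None.

Definition table (pats : seq (seq vtx)) (on : bool) (cs : seq elist) : seq (seq eset) :=
  [seq pmap (fun c => covck (pairs on v0 z.1 v) c E0 VS0 0) (eseq z.2) | z <- zip pats cs].

Fixpoint msub (m f : seq bool) : bool :=
  match m, f with
  | a :: m', b :: f' => if a then (if b then msub m' f' else false) else msub m' f'
  | [::], _ => true
  | _, _ => false end.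

Definition nz (a : nib) := if a is N0 then false else true.

Definition ldok (b0 b1 b2 b3 : bool) (p : eset) : bool :=
  let: E a a' b b' c c' d d' := p in
  [&& b0 || ~~ (nz a || nz a'), b1 || ~~ (nz b || nz b'), b2 || ~~ (nz c || nz c') & b3 || ~~ (nz d || nz d')].

Variables (tabs : seq (seq eset)) (cls : seq (label * seq bool)).

Definition fmask (p : eset) : seq bool := map (has (subE p)) tabs.

Definition plain (f : seq bool) (p : eset) : bool :=
  has (fun z => let: (l, m) := z in if l is LD b0 b1 b2 b3 then (if ldok b0 b1 b2 b3 p then msub m f else false) else false) cls.

Definition unset (p : eset) (i : dir) (x : vtx) : eset :=
  andE p (mkE (fun j y => ~~ (deq i j && (veq x y || veq x (nbr i y))))).

(** A matching within [p] either contains all of [e], or it lies within [p] without some edge of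
    [e]; each of these smaller sets must fall under a class given by directions. *)
Definition known (f : seq bool) (p : eset) : bool :=
  has (fun z => let: (l, m) := z in
     if l is LK e then
       (if msub m f then all (fun x => all (fun i => if getE e i x then let q := unset p i x in plain (fmask q) q else true) dirs) [seq x <- verts | ~~ vpar x] else false)
     else false) cls.

Definition leaf (rs : seq row) (ft : seq (seq eset)) (p : eset) : bool :=
  if vac rs p then true else
  if (if size K == 3 then few 1 oddsK p else true) then
    let f := [seq ~~ nilp t | t <- ft] in
    if plain f p then true else known f p
  else true.

Definition sideck : bool := let rs := rowsof in dfs (leaf rs) rs ub tabs p0.
End Side.

Fixpoint common (n : nat) (m m' : seq bool) : bool :=
  if n is n'.+1 then
    match m, m' with
    | a :: m1, b :: m1' => if (if a then b else false) then common n' m1 m1' else common n m1 m1'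
    | _, _ => false end
  else true.

(** A half-layer of Q4: [vbit i y (+) vpar y] is [typ] in this model. *)
Definition blk (i : dir) (t : bool) : eset := mkE (fun j y => deq i j && (t == vbit i y (+) vpar y)).

(** The edges that C2 demands in the first copy. The direction [D0] is no loss, because adjacent
    ends in the same copy are normalised to [v0] and [nbr D0 v0]. *)
Definition c2set (j : dir) : eset :=
  let e := mkE (fun i y => [&& deq i D0, ~~ (vbit i y (+) vpar y) & ~~ (veq y v0 || veq (nbr i y) v0)]) in
  setE (setE e j v0) j (nbr D0 v0).

(** Given the parity of the ends, [vbit i v] says that they have equal types in direction [i]. A
    half-layer of Q5 meets the two copies in opposite types, whence [blk i false] and
    [blk i true]. *)
Definition cbad (sep : bool) (v : vtx) (e e' : eset) : bool :=
  has (fun i => [&& vbit i v, subE (blk i false) e & subE (blk i true) e']) dirs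
  || [&& ~~ sep, veq v (nbr D0 v0), subE (blk D0 true) e' & has (fun j => subE (c2set j) e) [:: D1; D2; D3]].

(** Two classes without three common patterns do no harm in two situations. If there are crossing
    edges and both classes omit the same direction, the cube can be cut along that direction
    instead, without crossing edges. If there are none, the two classes may force C1 or C2. *)
Definition exempt (sep : bool) (v : vtx) (k0 : bool) (l l' : label) : bool :=
  match l, l' with
  | LD a b c d, LD a' b' c' d' => if k0 then false else ~~ [&& a || a', b || b', c || c' & d || d']
  | LK e, LK e' => if k0 then cbad sep v e e' else false
  | _, _ => false end.

Record cert := Cert { cv0 : seq elist; cv1 : seq elist; cl0 : seq (label * seq bool); cl1 : seq (label * seq bool) }.

Definition check (g : config) (c : cert) : bool :=
  let: Cfg sep v K pats := g in
  if all (fun cs => if eqb (odd (size cs)) sep then all (fun x => vin x cs) K else false) pats then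
  if uniq pats then
  if sideck false sep v K (table v pats true (cv0 c)) (cl0 c) then
  if sideck true sep v K (table v pats false (cv1 c)) (cl1 c) then
    all (fun z => all (fun z' => if common 3 z.2 z'.2 then true else exempt sep v (nilp K) z.1 z'.1) (cl1 c)) (cl0 c)
  else false else false else false else false.

Arguments nget : simpl never.
Arguments nset : simpl never.

(** * Correctness of the edge set operations *)

Section EdgeSets.

Implicit Types (e f : eset) (i j : dir) (x y : vtx).

Lemma nget_nand a b c d : nget (nand a b) c d = nget a c d && nget b c d.
Proof. by case: a; case: b; case: c; case: d. Qed.

Lemma nget_nset a c d c' d' : nget (nset a c d) c' d' = nget a c' d' || ((c == c') && (d == d')).
Proof. by case: a; case: c; case: d; case: c'; case: d'. Qed.

Lemma nget_nsub a b c d : nsub a b -> nget a c d -> nget b c d.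
Proof. by case: a; case: b => //; case: c; case: d. Qed.

Lemma nget_nz a c d : nget a c d -> nz a.
Proof. by case: a => //; case: c; case: d. Qed.

Lemma nbrK i : involutive (nbr i).
Proof. by case: i => -[a b c d] /=; rewrite negbK. Qed.

Lemma vpar_nbr i x : vpar (nbr i x) = ~~ vpar x.
Proof. by case: i x => -[[] [] [] []]. Qed.

Lemma vbit_nbr i j x : vbit j (nbr i x) = vbit j x (+) (j == i).
Proof. by case: i; case: j; case: x => [[] [] [] []]. Qed.

Lemma mem_verts x : x \in verts.
Proof. by case: x => [[] [] [] []]. Qed.

Lemma mem_dirs i : i \in dirs.
Proof. by case: i. Qed.

Lemma vinE x (s : seq vtx) : vin x s = (x \in s).
Proof. by elim: s => //= y s ->. Qed.

Lemma getE_nbr e i x : getE e i (nbr i x) = getE e i x.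
Proof. by case: e => *; case: i; case: x => *. Qed.

Lemma getE_andE e f i x : getE (andE e f) i x = getE e i x && getE f i x.
Proof.
by case: e => *; case: f => *; case: i; case: x => * /=; case: ifP => _; rewrite nget_nand.
Qed.

Lemma getE_subE e f i x : subE e f -> getE e i x -> getE f i x.
Proof.
case: e => a a' b b' c c' d d'; case: f => z z' y y' w w' t t' /=.
case s1: (nsub a z) => //; case s2: (nsub a' z') => //; case s3: (nsub b y) => //.
case s4: (nsub b' y') => //; case s5: (nsub c w) => //; case s6: (nsub c' w') => //.
case s7: (nsub d t) => // s8.
by case: i; case: x => p q r s /=; case: ifP => _; apply: nget_nsub.
Qed.

Lemma mem_edge i x y :
  (y == x) || (y == nbr i x) = all (fun j => (j == i) || (vbit j x == vbit j y)) dirs.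
Proof. by case: i; case: x => [[] [] [] []]; case: y => [[] [] [] []]. Qed.

Lemma getE_setE e i x j y :
  getE (setE e i x) j y = getE e j y || [&& i == j & (y == x) || (y == nbr i x)].
Proof.
rewrite mem_edge; case: e => a a' b b' c c' d d'.
case: x => p q r s; case: y => p' q' r' s'.
case: i; case: j; rewrite /= ?orbF; try (by case: ifP).
- by case: q; case: r; case: s; case: q'; case: r'; case: s'; rewrite /= ?nget_nset /= ?orbF ?orbT.
- by case: p; case: r; case: s; case: p'; case: r'; case: s'; rewrite /= ?nget_nset /= ?orbF ?orbT.
- by case: p; case: q; case: s; case: p'; case: q'; case: s'; rewrite /= ?nget_nset /= ?orbF ?orbT.
- by case: p; case: q; case: r; case: p'; case: q'; case: r'; rewrite /= ?nget_nset /= ?orbF ?orbT.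
Qed.

(** Soundness rests on this inclusion: a mask that is too large leaves more edges possible and only
    makes the check harder to pass. *)
Lemma getE_mkE (f : dir -> vtx -> bool) i x : f i x -> getE (mkE f) i x.
Proof.
move=> fix_; rewrite /mkE.
have mono (ds : seq dir) y e : getE e i x -> getE (foldr (fun i e => if f i y then setE e i y else e) e ds) i x.
  by move=> h; elim: ds => //= j ds IH; case: ifP => // _; rewrite getE_setE IH.
have : x \in verts by apply: mem_verts.
have own e : getE (foldr (fun i e => if f i x then setE e i x else e) e dirs) i x.
  have : i \in dirs by apply: mem_dirs.
  elim: dirs => // j ds IHd; rewrite inE => /predU1P[<-|/IHd h] /=.
    by rewrite fix_ getE_setE !eqxx orbT.
  by case: ifP => // _; rewrite getE_setE h.
elim: verts => // y s IH; rewrite inE => /predU1P[<-|/IH h]; [exact: own|exact: mono].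
Qed.

End EdgeSets.

Definition submat (A : dir -> vtx -> bool) e := forall i x, A i x -> getE e i x.
Definition vmat (A : dir -> vtx -> bool) :=
  (forall i x, A i (nbr i x) = A i x) /\ (forall i j x, A i x -> A j x -> i = j).
Definition vcov (A : dir -> vtx -> bool) x := has (A^~ x) dirs.

Lemma vcovP (A : dir -> vtx -> bool) x : reflect (exists i, A i x) (vcov A x).
Proof.
by apply: (iffP hasP) => [[i _]|[i]] h; exists i => //; apply: mem_dirs.
Qed.

Lemma star_vcov A p x : submat A p -> vcov A x -> star x p.
Proof. by move=> h /vcovP[i /h]; rewrite /star; case: i => ->; do ?case: ifP. Qed.

(** * Soundness of the search through the matchings of one copy *)

Section SideSoundness.

Variables (sd sep : bool) (v : vtx) (K : seq vtx).
Let alw := allowed sd sep v K.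
Implicit Types (A : dir -> vtx -> bool) (p : eset).

Lemma allowed_nbr i x : alw i (nbr i x) = alw i x.
Proof.
rewrite /alw /allowed nbrK andbCA; do 2!congr (_ && _); rewrite /forb nbrK.
by congr (~~ _); do 2!congr (_ && _); rewrite orbC; congr (_ || _); rewrite andbC.
Qed.

Definition vmaximal A := forall i x, alw i x -> vcov A x || vcov A (nbr i x).

Lemma vmat_extend A : vmat A -> (forall i x, A i x -> alw i x) ->
  exists A', [/\ vmat A', forall i x, A i x -> A' i x, forall i x, A' i x -> alw i x & vmaximal A'].
Proof.
move=> mA aA.
suff H (s : seq (dir * vtx)) : exists A', [/\ vmat A', forall i x, A i x -> A' i x,
    forall i x, A' i x -> alw i x &
    forall i x, (i, x) \in s -> alw i x -> vcov A' x || vcov A' (nbr i x)].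
  have [A' [h1 h2 h3 h4]] := H [seq (i, x) | i <- dirs, x <- verts].
  exists A'; split=> // i x; apply: h4; apply: allpairs_f; [exact: mem_dirs|exact: mem_verts].
elim: s => [|[i x] s [A' [[sA uA] sub al mx]]]; first by exists A.
have [/andP[ax /norP[cx cy]]|h] := boolP (alw i x && ~~ (vcov A' x || vcov A' (nbr i x))); last first.
  exists A'; split=> // j y; rewrite inE => /predU1P[[-> ->] ax|]; last exact: mx.
  by move: h; rewrite ax /= negbK.
have ncov z j : z = x \/ z = nbr i x -> A' j z = false.
  by move=> hz; apply/negP => az; case: hz => zE; [case/negP: cx|case/negP: cy]; apply/vcovP; exists j; rewrite -zE.
pose A1 j y := A' j y || ((i == j) && ((y == x) || (y == nbr i x))).
have sub1 y : vcov A' y -> vcov A1 y by case/vcovP => k h; apply/vcovP; exists k; rewrite /A1 h.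
exists A1; split.
- split=> [j y|j k y].
    rewrite /A1 sA; congr (_ || _); case: eqP => //= ->.
    have fe z : (nbr j y == z) = (y == nbr j z) by rewrite -(inj_eq (inv_inj (nbrK j))) nbrK.
    by rewrite !fe nbrK orbC.
  rewrite /A1 => /orP[h|/andP[/eqP<- /orP hy]] /orP[h'|/andP[/eqP<- /orP hy']] //.
  + exact: uA h h'.
  + by rewrite ncov // in h; case: hy' => /eqP; [left|right].
  + by rewrite ncov // in h'; case: hy => /eqP; [left|right].
- by move=> j y /sub h; rewrite /A1 h.
- move=> j y; rewrite /A1 => /orP[/al//|/andP[/eqP<- /orP[/eqP->//|/eqP->]]].
  by rewrite allowed_nbr.
move=> j y; rewrite inE => /predU1P[[-> ->] _|/mx h ay]; last first.
  by apply/orP; case/orP: (h ay) => /sub1; [left|right]; auto.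
by apply/orP; left; apply/vcovP; exists i; rewrite /A1 !eqxx orbT.
Qed.

Definition mkrow x := Row x (commask x D0) (commask x D1) (commask x D2) (commask x D3) (clrmask x)
  [seq nbr i x | i <- dirs & alw i x].

Let evensK := [seq x <- verts | ~~ vpar x & ~~ vin x K].

Lemma rowsofE : rowsof sd sep v K = map mkrow evensK.
Proof.
rewrite /rowsof; have -> : masks =
  [seq (x, (commask x D0, commask x D1), (commask x D2, commask x D3), clrmask x) | x <- verts & ~~ vpar x].
  by vm_cast_no_check (erefl masks).
rewrite filter_map -map_comp -filter_predI; congr map.
by apply: eq_filter => x /=; rewrite andbC.
Qed.

Lemma hasfree_sound A p x : submat A p -> vmaximal A -> ~~ vcov A x ->
  hasfree [seq nbr i x | i <- dirs & alw i x] p = false.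
Proof.
move=> sA mA cx.
have : all (fun i => alw i x) [seq i <- dirs | alw i x] by apply: filter_all.
elim: [seq i <- dirs | alw i x] => //= i s IH /andP[ai /IH ->].
by have := mA _ _ ai; rewrite (negPf cx) /= => /(star_vcov sA) ->.
Qed.

Lemma submat_commask A p i x : vmat A -> submat A p -> A i x -> submat A (andE p (commask x i)).
Proof.
move=> [sA uA] sp ax j y ay; rewrite getE_andE sp //= getE_mkE // !vinE !inE.
have ax' : A i (nbr i x) by rewrite sA.
have [yx|yx] := eqVneq y x; first by rewrite yx in ay *; rewrite (uA _ _ _ ay ax) eqxx orbT.
have [yx'|yx'] := eqVneq y (nbr i x).
  by rewrite yx' in ay *; rewrite (uA _ _ _ ay ax') nbrK eqxx.
rewrite /=; apply/norP; split; apply/eqP => h.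
  have ah : A j x by rewrite -h sA.
  by case/eqP: yx'; rewrite -[y](nbrK j) h (uA _ _ _ ah ax).
have ah : A j (nbr i x) by rewrite -h sA.
by case/eqP: yx; rewrite -[y](nbrK j) h (uA _ _ _ ah ax') nbrK.
Qed.

Lemma submat_clrmask A p x : vmat A -> submat A p -> ~~ vcov A x -> submat A (andE p (clrmask x)).
Proof.
move=> [sA uA] sp cx j y ay; rewrite getE_andE sp //= getE_mkE //.
apply/norP; split; apply: contra cx => /veqP h; apply/vcovP; exists j.
  by rewrite -h.
by rewrite -h sA.
Qed.

Lemma In_filter (T : Type) (P : pred T) s c : List.In c (filter P s) -> List.In c s /\ P c.
Proof.
elim: s => //= z s IH; case: ifP => h /= hc.
  by case: hc => [<-|/IH[]]; split; auto.
by case: (IH hc); split; auto.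
Qed.

(** The covers that survive in the tables contain the edges of [A] at the vertices decided so far.
    Membership is [List.In], as [eset] carries no decidable equality. *)
Definition refines A (xs : seq vtx) (tabs' tabs : seq (seq eset)) :=
  forall t c, List.In c (nth [::] tabs' t) -> List.In c (nth [::] tabs t) /\
    forall i x, x \in xs -> A i x -> getE c i x.

Lemma refines_ftab A i x xs tabs' tabs : vmat A -> A i x ->
  refines A xs tabs' (ftab i x tabs) -> refines A (x :: xs) tabs' tabs.
Proof.
move=> [_ uA] ax h t c /h[]; rewrite /ftab.
have [ht|ht] := ltnP t (size tabs); last by rewrite nth_default // size_map.
rewrite (nth_map [::]) // => hin h3; have [h1 h2] := In_filter hin; split=> // j y.
rewrite inE => /predU1P[->|yx]; last exact: h3.
by move=> ay; rewrite (uA _ _ _ ay ax).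
Qed.

(** The search contains the branch that [A] itself dictates: its edge at each covered vertex, the
    clearing step at each uncovered one. The pruning cannot hit this branch because [A] is
    maximal. *)
Lemma dfs_sound (lf : seq (seq eset) -> eset -> bool) A (xs : seq vtx) n tabs p :
  vmat A -> vmaximal A -> submat A p -> count (fun x => ~~ vcov A x) xs <= n ->
  dfs lf (map mkrow xs) n tabs p ->
  exists tabs' p', [/\ lf tabs' p', submat A p' & refines A xs tabs' tabs].
Proof.
move=> mA mx; elim: xs n tabs p => [|x xs IH] n tabs p sA.
  by move=> _ h; exists tabs, p; split.
rewrite [dfs _ _ _ _ _]/= [count _ _]/= => cn.
case e0: (if getE p D0 x then _ else _) => //.
case e1: (if getE p D1 x then _ else _) => //.
case e2: (if getE p D2 x then _ else _) => //.
case e3: (if getE p D3 x then _ else _) => //.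
have [/vcovP[i ax]|cx] := boolP (vcov A x).
  have cx : vcov A x by apply/vcovP; exists i.
  rewrite cx add0n in cn => _.
  have step : dfs lf (map mkrow xs) n (ftab i x tabs) (andE p (commask x i)).
    by have := sA _ _ ax; case: (i) => g; rewrite g in e0 e1 e2 e3.
  have [tabs' [p' [h1 h2 h3]]] := IH _ _ _ (submat_commask mA sA ax) cn step.
  by exists tabs', p'; split=> //; apply: refines_ftab ax h3.
rewrite cx add1n in cn; case: n {e0 e1 e2 e3} cn => // n cn.
rewrite (hasfree_sound (submat_clrmask mA sA cx) mx cx) => step.
have [tabs' [p' [h1 h2 h3]]] := IH _ _ _ (submat_clrmask mA sA cx) cn step.
exists tabs', p'; split=> // t c /h3[h4 h5]; split=> // i y; rewrite inE => /predU1P[->|]; last exact: h5.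
by move=> ax; case/negP: cx; apply/vcovP; exists i.
Qed.

Variables (tabs : seq (seq eset)) (cls : seq (label * seq bool)).

Definition label_ok (l : label) A : Prop :=
  match l with
  | LD b0 b1 b2 b3 => forall i x, A i x -> match i with D0 => b0 | D1 => b1 | D2 => b2 | D3 => b3 end
  | LK e => forall i x, getE e i x -> A i x
  end.

Definition mask_ok (m : seq bool) A :=
  forall t, nth false m t -> exists2 c, List.In c (nth [::] tabs t) & submat A c.

Definition classified A := exists l m, [/\ List.In (l, m) cls, label_ok l A & mask_ok m A].

Lemma has_In (T : Type) (P : pred T) s : has P s -> exists2 z, List.In z s & P z.
Proof.
elim: s => //= z s IH /orP[h|/IH[y h1 h2]]; [exists z|exists y]; rewrite //; [by left|by right].
Qed.

Lemma msub_nth m f t : msub m f -> nth false m t -> nth false f t.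
Proof.
elim: m f t => [|a m IH] [|b f] [|t] //=; first by case: a; case: b.
by case: a => //; [case: b => //|]; apply: IH.
Qed.

Lemma plain_sound A f p : submat A p -> mask_ok f A -> plain cls f p -> classified A.
Proof.
move=> sA hf /has_In[[[b0 b1 b2 b3|//] m] hin].
case: ifP => // ld sub; exists (LD b0 b1 b2 b3), m; split=> //.
  move=> i x /sA; case: p ld {sA} => a a' b b' c c' d d' /and4P[l0 l1 l2 l3].
  case: i; case: x => x0 x1 x2 x3 /=; case: ifP => _ /nget_nz nza.
  - by move: l0; rewrite nza orbT orbF.
  - by move: l0; rewrite nza orbF.
  - by move: l1; rewrite nza orbT orbF.
  - by move: l1; rewrite nza orbF.
  - by move: l2; rewrite nza orbT orbF.
  - by move: l2; rewrite nza orbF.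
  - by move: l3; rewrite nza orbT orbF.
  - by move: l3; rewrite nza orbF.
by move=> t /(msub_nth sub); apply: hf.
Qed.

Lemma fmask_ok A p : submat A p -> mask_ok (fmask tabs p) A.
Proof.
move=> sA t; have [ht|ht] := ltnP t (size tabs); last by rewrite nth_default // size_map.
rewrite (nth_map [::]) // => /has_In[c h1 h2]; exists c => // i x /sA.
exact: getE_subE.
Qed.

Lemma known_sound A f p : vmat A -> submat A p -> mask_ok f A -> known tabs cls f p -> classified A.
Proof.
move=> [syA uA] sA hf /has_In[[[//|e] m] hin]; case: ifP => // sub /allP h.
have [/allP he|/allPn[[i x]]] := boolP (all (fun z => getE e z.1 z.2 ==> A z.1 z.2)
    [seq (i, x) | i <- dirs, x <- [seq x <- verts | ~~ vpar x]]).
  exists (LK e), m; split=> //; last by move=> t /(msub_nth sub); apply: hf.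
  have ev i x : ~~ vpar x -> getE e i x -> A i x.
    move=> px; apply/implyP; apply: (he (i, x)); apply: allpairs_f; first exact: mem_dirs.
    by rewrite mem_filter px mem_verts.
  move=> i x; have [px|px] := boolP (vpar x); last exact: ev.
  by rewrite -getE_nbr -syA; apply: ev; rewrite vpar_nbr px.
case/allpairsP => -[i' x'] [_ /= hx [-> ->]]; rewrite negb_imply => /andP[ge na].
have := allP (h _ hx) i' (mem_dirs i'); rewrite ge.
apply: plain_sound; last apply: fmask_ok; rewrite /unset => j y ay; rewrite getE_andE sA //= getE_mkE //;
  apply/negP => /andP[/deqP ij /orP[] /veqP xy]; case/negP: na.
- by rewrite ij xy.
- by rewrite xy syA ij.
- by rewrite ij xy.
- by rewrite xy syA ij.
Qed.

Lemma few_count n (s : seq vtx) p : count (fun y => ~~ star y p) s <= n -> few n s p.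
Proof. by elim: s n => //= y s IH n; case: (star y p) => /=; [apply: IH|case: n => // n; apply: IH]. Qed.

Lemma vac_sound A p xs : submat A p -> vmaximal A -> vac (map mkrow xs) p = false.
Proof.
move=> sA mA; elim: xs => //= x xs IH; case: ifP => // st.
have [cx|cx] := boolP (vcov A x); first by rewrite (star_vcov sA cx) in st.
by rewrite (hasfree_sound sA mA cx).
Qed.

(** The search follows a maximal extension of [A], yet [A] itself is classified: direction labels
    and covers pass to submatchings, and containment of a labelled edge set is tested on [A]
    directly. *)
Lemma sideck_sound A : vmat A -> (forall i x, A i x -> alw i x) ->
  (size K = 3 -> forall q, count (fun x => ~~ vcov A x) [seq x <- verts | (vpar x == q) && (x \notin K)] <= 1) ->
  sideck sd sep v K tabs cls -> classified A.
Proof.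
move=> mA aA few3 ck; have [A' [mA' sub aA' mx]] := vmat_extend mA aA.
have subc x : ~~ vcov A' x -> ~~ vcov A x.
  by apply: contra => /vcovP[i /sub h]; apply/vcovP; exists i.
have sp0 : submat A' (p0 sd sep v K) by move=> i x /aA' h; apply: getE_mkE.
have few3' : size K = 3 -> forall q, count (fun x => ~~ vcov A' x) [seq x <- verts | (vpar x == q) && (x \notin K)] <= 1.
  by move=> k3 q; apply: leq_trans (few3 k3 q); apply: sub_count.
have evE : evensK = [seq x <- verts | (vpar x == false) && (x \notin K)].
  by apply: eq_filter => x; rewrite vinE eqbF_neg.
have ubn : count (fun x => ~~ vcov A' x) evensK <= ub K.
  rewrite /ub; case: eqP => [/few3'/(_ false)|_]; first by rewrite evE.
  apply: leq_trans (count_size _ _) _; rewrite size_filter.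
  by apply: (@leq_trans (count (fun x => ~~ vpar x) verts)) => //; apply: sub_count => x /andP[].
move: ck; rewrite /sideck rowsofE => /(dfs_sound mA' mx sp0 ubn)[ft [p [+ sp ref]]].
rewrite /leaf (vac_sound _ sp mx).
have spA : submat A p by move=> i x /sub/sp.
case: ifP => [_|]; last first.
  case: eqP => // k3; have /few_count -> // : count (fun y => ~~ star y p) (oddsK K) <= 1.
  have -> : oddsK K = [seq x <- verts | (vpar x == true) && (x \notin K)].
    by apply: eq_filter => x; rewrite vinE eqb_id.
  apply: leq_trans (few3' k3 true); apply: sub_count => x; apply: contra.
  exact: star_vcov.
have fok : mask_ok [seq ~~ nilp t | t <- ft] A.
  move=> t; have [ht|ht] := ltnP t (size ft); last by rewrite nth_default // size_map.
  rewrite (nth_map [::]) //; case E: (nth [::] ft t) => [//|c s] _.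
  have [|h1 h2] := ref t c; first by rewrite E; left.
  exists c => // i x ax; have ax' := sub _ _ ax.
  have inK y j : A' j y -> y \notin K by move/aA'; rewrite /alw /allowed vinE => /and3P[].
  have [px|px] := boolP (vpar x).
    rewrite -getE_nbr; apply: h2; last by rewrite (mA'.1).
    by rewrite mem_filter vpar_nbr px mem_verts vinE (inK _ i) // (mA'.1).
  by apply: h2 => //; rewrite mem_filter px mem_verts vinE (inK _ i).
case: ifP => [pl _|_ kn]; first exact: plain_sound spA fok pl.
exact: known_sound mA spA fok kn.
Qed.

End SideSoundness.

Arguments walk : simpl never.

(** * From edge sets to systems of paths, and the meaning of a successful check *)

Section Covers.

Implicit Types (x y : vtx) (P : seq (seq vtx)).

Definition vadj x y := has (fun i => y == nbr i x) dirs.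

Fixpoint pieces (ps : seq (vtx * vtx)) P : Prop :=
  match ps, P with
  | (a, b) :: ps', p :: P' => (exists t, [/\ p = a :: t, path vadj a t & last a t = b]) /\ pieces ps' P'
  | [::], [::] => True
  | _, _ => False
  end.

Definition plinked P x y := exists2 p, p \in P & linked p x y.

Lemma trail_path a ds : exists t, trail a ds = a :: t /\ path vadj a t.
Proof.
elim: ds a => [|i ds IH] a /=; first by exists [::].
have [t [-> pt]] := IH (nbr i a); exists (nbr i a :: t); split=> //=.
by rewrite pt andbT; apply/hasP; exists i; rewrite ?mem_dirs.
Qed.

Lemma tedges_linked a ds e i x : getE (tedges a ds e) i x ->
  getE e i x \/ linked (trail a ds) x (nbr i x).
Proof.
elim: ds a e => [|j ds IH] a e /=; first by left.
case/IH; last by move=> h; right; apply: (@linked_catr _ [:: a]).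
rewrite getE_setE => /orP[|/andP[/eqP<- h]]; first by left.
right; have [t [-> _]] := trail_path (nbr j a) ds.
by case/orP: h => /eqP->; rewrite ?nbrK; [left|right]; exists [::], t.
Qed.

Lemma vmem_vmark s x y : vmem (vmark s x) y = vmem s y || (x == y).
Proof.
case: s => a b c d; case: x => x0 x1 x2 x3; case: y => y0 y1 y2 y3.
have -> : (V x0 x1 x2 x3 == V y0 y1 y2 y3) = [&& x0 == y0, x1 == y1, x2 == y2 & x3 == y3] by [].
by case: x2; case: x3; case: y2; case: y3; rewrite /= ?nget_nset ?andbT ?andbF ?orbF.
Qed.

Lemma vfull_vmem s y : vfull s -> vmem s y.
Proof. by case: s => [[]] // [] // [] // [] //= _; case: y => [[] [] [] []]. Qed.

Lemma foldl_vmark s (t : seq vtx) y : vmem (foldl vmark s t) y = vmem s y || (y \in t).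
Proof.
elim: t s => [|x t IH] s /=; first by rewrite orbF.
by rewrite IH vmem_vmark inE eq_sym orbA.
Qed.

Lemma covck_sound ps c w s n w' : covck ps c w s n = Some w' -> exists P,
  [/\ pieces ps P, forall y, vmem s y || (y \in flatten P), size (flatten P) + n = 16
    & forall i x, getE w' i x -> getE w i x \/ plinked P x (nbr i x)].
Proof.
elim: ps w s n => [|[a b] ps IH] w s n /=.
  case: eqP => // n16; case: ifP => // fs [<-]; exists [::]; split=> //.
    by move=> y; rewrite vfull_vmem.
  by move=> i x; left.
set ds := walk 15 c a None; have [t [tE pt]] := trail_path a ds; rewrite tE.
case: ifP => // /veqP lb /IH[P [h1 h2 h3 h4]]; exists ((a :: t) :: P); split=> //.
- by split=> //; exists t.
- by move=> y; have := h2 y; rewrite -[foldl _ _ _]/(foldl vmark s (a :: t)) foldl_vmark mem_cat orbA.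
- by rewrite -[flatten _]/((a :: t) ++ flatten P) size_cat [size (a :: t) + _]addnC -addnA.
move=> i x /h4[/tedges_linked[|h]|[p hp hl]]; first by left.
  by right; exists (a :: t); rewrite ?inE ?eqxx // -tE.
by right; exists p; rewrite // inE hp orbT.
Qed.

Definition feasible on v (A : dir -> vtx -> bool) (c : seq vtx) := exists P,
  [/\ pieces (pairs on v0 c v) P, uniq (flatten P), forall y, y \in flatten P
    & forall i x, A i x -> plinked P x (nbr i x)].

Lemma pmap_In (T U : Type) (g : T -> option U) s w : List.In w (pmap g s) -> exists c, g c = Some w.
Proof.
elim: s => //= c s IH; case E: (g c) => [w'|] /=; last exact: IH.
by case=> [<-|/IH//]; exists c.
Qed.

Lemma table_feasible v pats on cs t w A : List.In w (nth [::] (table v pats on cs) t) ->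
  submat A w -> t < size pats /\ feasible on v A (nth [::] pats t).
Proof.
move=> + sA; have [ht|ht] := ltnP t (size (zip pats cs)); last by rewrite nth_default // size_map.
have tp : t < size pats by move: ht; rewrite size_zip leq_min => /andP[].
rewrite (nth_map ([::], enil)) // nth_zip_cond ht /= => hin.
have [c hc] := pmap_In hin; have [P [h1 h2 h3 h4]] := covck_sound hc.
split=> //; exists P; split=> //.
(* A list of length sixteen that contains all sixteen vertices has no repetition. *)
- have := @leq_size_uniq _ verts (flatten P); apply=> //.
    by move=> y _; have := h2 y; case: y => [[] [] [] []].
  by rewrite addn0 in h3; rewrite h3.
- by move=> y; have := h2 y; case: y => [[] [] [] []].
move=> i x /sA /h4[|//]; by case: i; case: x => [[] [] [] []].
Qed.

Lemma pieces_chain (c : seq vtx) a v P0 P1 z :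
  pieces (pairs true a c v) P0 -> pieces (pairs false a c v) P1 -> exists ps,
  [/\ chain vadj a ps v, sidecat true ps = flatten P0 /\ sidecat false ps = flatten P1,
      crossing z ps = c /\ size ps = (size c).+1, all (fun p => p != [::]) ps
    & forall x y, (plinked P0 x y -> slinked true ps x y) /\ (plinked P1 x y -> slinked false ps x y)].
Proof.
elim: c a P0 P1 => [|x c IH] a P0 P1 /=.
  case: P0 => [//|p [|? ?]] [[t [-> pt lt]] //] _; case: P1 => // _.
  exists [:: a :: t]; split=> //=; first by exists t.
  move=> x y; split; last by case.
  by case=> p'; rewrite inE => /eqP-> h; left.
case: P0 => [//|p P0] [[t [-> pt lt]] h0] h1.
have [ps [ch [s0 s1] [cr sz] ne sl]] := IH x P1 P0 h1 h0.
case: ps ch s0 s1 cr sz ne sl => [//|q ps] ch s0 s1 cr sz ne sl.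
exists ((a :: t) :: q :: ps); split=> //=.
- by exists t; split=> //; rewrite lt.
- by rewrite -s1 -s0.
- by split; [rewrite lt -cr|case: sz => ->].
move=> y w; have [l0 l1] := sl y w; split.
  case=> p'; rewrite inE => /predU1P[->|hp] h; first by left.
  by right; apply: l1; exists p'.
by move=> h; right; apply: l0.
Qed.

Lemma common3 n (m m' : seq bool) : common n m m' -> exists2 ts,
  uniq ts & size ts = n /\ forall t, t \in ts -> nth false m t && nth false m' t.
Proof.
elim: m m' n => [|a m IH] [|b m'] [|n] //=; try by exists [::].
rewrite -[if a then b else false]/(a && b); case: ifP => hab.
  case/IH => ts ut [st ht]; exists (0 :: map S ts).
    by rewrite /= map_inj_uniq ?ut ?andbT; [apply/mapP => -[]|move=> ? ? []].
  split; first by rewrite /= size_map st.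
  by move=> t; rewrite inE => /predU1P[->|/mapP[t' /ht ht' ->]].
case/IH => ts ut [st ht]; exists (map S ts); first by rewrite map_inj_uniq // => ? ? [].
by split; [rewrite size_map|move=> t /mapP[t' /ht ht' ->]].
Qed.

Lemma all_In (T : Type) (P : pred T) s z : all P s -> List.In z s -> P z.
Proof. by elim: s => //= y s IH /andP[h /IH hs] [<-|/hs]. Qed.

Lemma check_sound sep v K pats ct A B :
  check (Cfg sep v K pats) ct -> vmat A -> vmat B ->
  (forall i x, A i x -> allowed false sep v K i x) -> (forall i x, B i x -> allowed true sep v K i x) ->
  (size K = 3 -> forall q, count (fun x => ~~ vcov A x) [seq x <- verts | (vpar x == q) && (x \notin K)] <= 1) ->
  (size K = 3 -> forall q, count (fun x => ~~ vcov B x) [seq x <- verts | (vpar x == q) && (x \notin K)] <= 1) ->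
  (exists2 cs, uniq cs & size cs = 3 /\ forall c, c \in cs ->
     [/\ feasible true v A c, feasible false v B c, odd (size c) = sep & {subset K <= c}]) \/
  exists l l', [/\ label_ok l A, label_ok l' B & exempt sep v (nilp K) l l'].
Proof.
rewrite /check; case: ifP => // /allP par; case: ifP => // up.
case: ifP => // /sideck_sound s0; case: ifP => // /sideck_sound s1 pr mA mB aA aB kA kB.
have [l [m [hin lA okA]]] := s0 _ mA aA kA.
have [l' [m' [hin' lB okB]]] := s1 _ mB aB kB.
have := all_In (all_In pr hin) hin'; case: ifP => [/common3[ts ut [st ht]] _|_ ex]; last first.
  by right; exists l, l'.
left.
have tP t : t \in ts -> [/\ t < size pats, feasible true v A (nth [::] pats t) & feasible false v B (nth [::] pats t)].
  case/ht/andP => /okA[w w1 w2] /okB[w' w1' w2'].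
  by have [? ?] := table_feasible w1 w2; have [? ?] := table_feasible w1' w2'.
exists (map (nth [::] pats) ts).
  rewrite map_inj_in_uniq // => t t' /tP[ht1 _ _] /tP[ht2 _ _] /eqP.
  by rewrite nth_uniq // => /eqP.
split; first by rewrite size_map.
move=> c /mapP[t /tP[h1 h2 h3] ->]; split=> //.
  by have := par _ (mem_nth [::] h1); case: ifP => // /eqbP ->.
have := par _ (mem_nth [::] h1); case: ifP => // _ /allP h x /h.
by rewrite vinE.
Qed.

End Covers.

(** * Transfer from the model to the five-dimensional cube *)

Section Frame.

Variables (u : cube 5) (d : 'I_5) (e : dir -> 'I_5).
Hypotheses (einj : injective e) (ed : forall i, e i != d)
  (esurj : forall k, k = d \/ exists i, k = e i).

(** Adding [u] coordinatewise moves [u] to the vertex [v0] of the first copy, so one end of the path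
    is always normalised. *)
Definition Phi (b : bool) (x : vtx) : cube 5 :=
  [ffun k => u k (+) (if k == d then b else if k == e D0 then vbit D0 x else
     if k == e D1 then vbit D1 x else if k == e D2 then vbit D2 x else vbit D3 x)].

Lemma Phi_d b x : Phi b x d = u d (+) b.
Proof. by rewrite ffunE eqxx. Qed.

Lemma Phi_e b x i : Phi b x (e i) = u (e i) (+) vbit i x.
Proof. by rewrite ffunE (negPf (ed i)) !(inj_eq einj); case: i. Qed.

Lemma frame_ext (z z' : cube 5) : z d = z' d -> (forall i, z (e i) = z' (e i)) -> z = z'.
Proof. by move=> hd he; apply/ffunP => k; case: (esurj k) => [->|[i ->]]. Qed.

Lemma Phi_cross b x : Phi (~~ b) x = flip (Phi b x) d.
Proof.
apply: frame_ext => [|i]; rewrite flipE ?eqxx ?Phi_d ?Phi_e ?(negPf (ed i)) ?addbF //.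
by rewrite addbT addbN.
Qed.

Lemma Phi_nbr b x i : Phi b (nbr i x) = flip (Phi b x) (e i).
Proof.
apply: frame_ext => [|j]; rewrite flipE ?Phi_d ?Phi_e.
  by rewrite [d == _]eq_sym (negPf (ed i)) addbF.
by rewrite vbit_nbr (inj_eq einj) addbA.
Qed.

Lemma Phi_inj b b' x x' : Phi b x = Phi b' x' -> b = b' /\ x = x'.
Proof.
move=> h; split; first by move/ffunP/(_ d): h; rewrite !Phi_d => /addbI.
have hb i : vbit i x = vbit i x' by move/ffunP/(_ (e i)): h; rewrite !Phi_e => /addbI.
by case: x x' hb {h} => ? ? ? ? [? ? ? ?] hb; congr V; [apply: (hb D0)|apply: (hb D1)|apply: (hb D2)|apply: (hb D3)].
Qed.

Lemma Phi_coord (z : cube 5) : z = Phi (u d (+) z d)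
  (V (u (e D0) (+) z (e D0)) (u (e D1) (+) z (e D1)) (u (e D2) (+) z (e D2)) (u (e D3) (+) z (e D3))).
Proof.
by apply: frame_ext => [|i]; rewrite ?Phi_d ?Phi_e; last case: i; rewrite /= addbA addbb.
Qed.

Lemma Phi_surj z : exists b x, z = Phi b x.
Proof. by eexists; eexists; apply: Phi_coord. Qed.

Lemma Phi0 : u = Phi false v0.
Proof. by apply: frame_ext => [|i]; rewrite ?Phi_d ?Phi_e; last case: i; rewrite /= addbF. Qed.

Lemma parity_Phi b x : parity (Phi b x) = parity u (+) b (+) vpar x.
Proof.
have P0 y : parity (Phi false y) = parity u (+) vpar y.
  have st i z : parity (Phi false z) = parity u (+) vpar z -> parity (Phi false (nbr i z)) = parity u (+) vpar (nbr i z).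
    by rewrite Phi_nbr parity_flip vpar_nbr => ->; rewrite addbN.
  have h0 : parity (Phi false v0) = parity u (+) vpar v0 by rewrite -Phi0 addbF.
  case: y => a0 a1 a2 a3.
  have h1 : parity (Phi false (V a0 false false false)) = parity u (+) vpar (V a0 false false false).
    by case: (a0) => //; apply: (st D0 v0).
  have h2 : parity (Phi false (V a0 a1 false false)) = parity u (+) vpar (V a0 a1 false false).
    by case: (a1) => //; apply: (st D1 (V a0 false false false)).
  have h3 : parity (Phi false (V a0 a1 a2 false)) = parity u (+) vpar (V a0 a1 a2 false).
    by case: (a2) => //; apply: (st D2 (V a0 a1 false false)).
  by case: (a3) => //; apply: (st D3 (V a0 a1 a2 false)).
case: b; last by rewrite P0 addbF.
by rewrite -[true]/(~~ false) Phi_cross parity_flip P0 addbT addNb.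
Qed.

Lemma typ_Phi b x i : typ (e i) (Phi b x) = typ (e i) u (+) (vbit i x (+) (b (+) vpar x)).
Proof.
rewrite /typ Phi_e parity_Phi.
by case: (u _) (vbit i x) (parity u) b (vpar x) => [] [] [] [] [].
Qed.

Lemma Phi_adj b x y : vadj x y -> qadj (Phi b x) (Phi b y).
Proof. by case/hasP => i _ /eqP->; rewrite Phi_nbr qadj_flip. Qed.

Lemma Phi_qcross b x : qadj (Phi b x) (Phi (~~ b) x).
Proof. by rewrite Phi_cross qadj_flip. Qed.

Section Config.

Variables (m : cube 5 -> 'I_5 -> bool) (v : cube 5) (sep : bool) (w : vtx) (K : seq vtx).
Hypotheses (mm : ismat m) (vE : v = Phi sep w) (pw : sep (+) vpar w)
  (mK : forall x, m (Phi false x) d = (x \in K)).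

Let A i x := m (Phi false x) (e i).
Let B i x := m (Phi true x) (e i).

Let mK' b x : m (Phi b x) d = (x \in K).
Proof. by case: b => //; rewrite -[true]/(~~ false) Phi_cross mm.1. Qed.

Lemma side_vmat b : vmat (fun i x => m (Phi b x) (e i)).
Proof.
by split=> [i x|i j x h h']; [rewrite Phi_nbr mm.1|apply: einj; apply: mm.2 h h'].
Qed.

Lemma pattern_ham c : feasible true w A c -> feasible false w B c -> odd (size c) = sep ->
  {subset K <= c} -> exists ps s, [/\ weave Phi false ps = u :: s, ham m u v s,
    crossing v0 ps = c & all (fun p => p != [::]) ps].
Proof.
move=> [P0 [h0 u0 a0 l0]] [P1 [h1 u1 a1 l1]] odc Kc.
have [ps [ch [s0 s1] [cr sz] ne sl]] := pieces_chain v0 h0 h1.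
have := weave_ham Phi_adj Phi_qcross Phi_inj Phi_surj (m := m) (b := false) ch.
rewrite s0 s1 sz /= negbK odc -vE -Phi0 => H.
have hm z k : m z k -> linked (weave Phi false ps) z (flip z k).
  move=> mz; have [b [x zE]] := Phi_surj z; rewrite zE in mz *.
  case: (esurj k) mz => [->|[i ->]] mz.
    rewrite -Phi_cross; apply: (weave_cross Phi_adj Phi_qcross false b (z0 := v0) ch).
    by rewrite cr; apply: Kc; rewrite -(mK' b).
  rewrite -Phi_nbr; apply: weave_linked; case: b mz {zE} => mz.
    exact: (sl _ _).2 (l1 _ _ mz).
  exact: (sl _ _).1 (l0 _ _ mz).
by have [s es hs] := H u0 u1 a0 a1 hm; exists ps, s.
Qed.

Lemma config_ham pats ct : good m u v -> check (Cfg sep w K pats) ct ->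
  (size K = 3 -> forall q, #|[set z | (parity z == q) && [forall k, ~~ m z k]]| <= 1) ->
  (K != [::] -> forall k, (forall z, ~~ m z k) -> ham3 m u v) -> ham3 m u v.
Proof.
move=> g ck few3 unused.
have al b i x : m (Phi b x) (e i) -> (x \notin K) && (nbr i x \notin K).
  move=> mx; have ned y : m (Phi b y) (e i) -> y \notin K.
    by move=> my; apply/negP; rewrite -(mK' b) => /(mm.2 _ _ _ my) h; move: (ed i); rewrite h eqxx.
  by rewrite !ned // Phi_nbr mm.1.
have aA i x : A i x -> allowed false sep w K i x.
  move=> mx; rewrite /allowed !vinE; have /andP[-> ->] := al _ _ _ mx.
  rewrite /= /forb; apply/negP => /and3P[ns _ /orP[/andP[/veqP xE /veqP yE]|/andP[/veqP xE /veqP yE]]].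
    case/goodP: g => _ _; apply; apply/c3P; exists (e i).
      by rewrite vE (negPf ns) -yE xE Phi_nbr -Phi0.
    by rewrite Phi0 -xE.
  case/goodP: g => _ _; apply; apply/c3P; exists (e i).
    by rewrite vE (negPf ns) -xE -[x](nbrK i) yE Phi_nbr -Phi0.
  by rewrite Phi0 -yE Phi_nbr mm.1.
have aB i x : B i x -> allowed true sep w K i x.
  move=> mx; rewrite /allowed !vinE; have /andP[-> ->] := al _ _ _ mx.
  by rewrite /forb /= andbF.
have kS b : size K = 3 -> forall q, count (fun x => ~~ vcov (fun i x => m (Phi b x) (e i)) x)
    [seq x <- verts | (vpar x == q) && (x \notin K)] <= 1.
  move=> k3 q; apply: leq_trans (few3 k3 (parity u (+) b (+) q)).
  rewrite -size_filter -(size_map (Phi b)).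
  set s := map _ _; have us : uniq s.
    by rewrite map_inj_uniq ?filter_uniq //; move=> x y /Phi_inj[].
  rewrite -(card_uniqP us); apply: subset_leq_card; apply/subsetP => z /mapP[x].
  rewrite !mem_filter => /and3P[cx /andP[/eqP px xK] _] ->; rewrite inE parity_Phi px eqxx /=.
  apply/forallP => k; case: (esurj k) => [->|[i ->]]; first by rewrite mK'.
  by apply: contra cx => h; apply/vcovP; exists i.
have [[cs ucs [scs hcs]]|[l [l' [lA lB ex]]]] :=
  check_sound ck (side_vmat false) (side_vmat true) aA aB (kS false) (kS true).
  case: cs ucs scs hcs => [|c1 [|c2 [|c3 [|? ?]]]] // + _ hcs.
  rewrite /= !inE !negb_or => /and3P[/andP[/eqP n12 /eqP n13] /eqP n23 _].
  have go c : c \in [:: c1; c2; c3] -> exists ps s, [/\ weave Phi false ps = u :: s, ham m u v s,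
      crossing v0 ps = c & all (fun p => p != [::]) ps].
    by case/hcs => fA fB odc Kc; apply: pattern_ham.
  have [|p1 [s1 [w1 h1 r1 e1]]] := go c1; first by rewrite !inE eqxx.
  have [|p2 [s2 [w2 h2 r2 e2]]] := go c2; first by rewrite !inE eqxx orbT.
  have [|p3 [s3 [w3 h3 r3 e3]]] := go c3; first by rewrite !inE eqxx !orbT.
  exists s1, s2, s3; split=> //; split=> ss.
  - by apply: n12; rewrite -r1 -r2 (weave_inj Phi_inj _ e1 e2 (b := false)) // w1 w2 ss.
  - by apply: n13; rewrite -r1 -r3 (weave_inj Phi_inj _ e1 e3 (b := false)) // w1 w3 ss.
  - by apply: n23; rewrite -r2 -r3 (weave_inj Phi_inj _ e2 e3 (b := false)) // w2 w3 ss.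
case: l lA ex => [b0 b1 b2 b3|E1] lA; case: l' lB => [b0' b1' b2' b3'|E2] lB //=.
  case: (boolP (nilp K)) => // Kn h.
  have Kn' : K != [::] by case: (K) Kn.
  suff [i hi hi'] : exists2 i, forall x, ~~ A i x & forall x, ~~ B i x.
    apply: (unused Kn' (e i)) => z; have [b [x ->]] := Phi_surj z.
    by case: b; [apply: hi'|apply: hi].
  move: h; rewrite !negb_and !negb_or => /or4P[] /andP[/negPf bf /negPf bf'];
    [exists D0|exists D1|exists D2|exists D3] => x; apply/negP => h;
    first [by move: (lA _ _ h); rewrite bf|by move: (lB _ _ h); rewrite bf'].
case: (nilp K) => // /orP[/hasP[i _ /and3P[vi sA sB]]|/and4P[ns /veqP wE sB /hasP[j j0 sA]]].
  case/goodP: g => nc1 _ _; case: nc1; apply/c1P; exists (e i).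
    by rewrite vE typ_Phi vi pw addbF.
  move=> z; have [b [x ->]] := Phi_surj z; rewrite typ_Phi => tx.
  have {}tx : vbit i x (+) vpar x = b.
    by move: tx; case: (typ _ u) (vbit i x) b (vpar x) => [] [] [] [].
  case: b tx => tx; [apply: lB; apply: getE_subE sB _|apply: lA; apply: getE_subE sA _];
    by apply: getE_mkE; rewrite tx; case: (i).
case/goodP: g => _ nc2 _; case: nc2; apply/c2P; exists (e D0), (e j).
have vu : v = flip u (e D0) by rewrite vE (negPf ns) wE Phi_nbr -Phi0.
have c2e i x : [&& deq i D0, ~~ (vbit i x (+) vpar x) & ~~ (veq x v0 || veq (nbr i x) v0)] -> getE (c2set j) i x.
  by move=> h; rewrite /c2set; lazy zeta; rewrite 2!getE_setE getE_mkE.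
split=> //.
- by rewrite (inj_eq einj); move: j0; rewrite !inE => /or3P[] /eqP->.
- by rewrite Phi0; apply: lA; apply: getE_subE sA _; rewrite !getE_setE !eqxx !orbT.
- rewrite vu Phi0 -Phi_nbr; apply: lA; apply: getE_subE sA _; rewrite !getE_setE !eqxx !orbT //.
move=> z; have [b [x ->]] := Phi_surj z; rewrite typ_Phi => tx nu nv.
have {}tx : vbit D0 x (+) vpar x = b.
  by move: tx; case: (typ _ u) (vbit D0 x) (b) (vpar x) => [] [] [] [].
case: b tx nu nv => tx nu nv.
  by apply: lB; apply: getE_subE sB _; apply: getE_mkE; rewrite tx.
apply: lA; apply: getE_subE sA _; apply: c2e; rewrite tx /=.
apply/norP; split; apply/negP => /veqP h.
  by apply: nu; rewrite h -Phi0.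
by apply: nv; rewrite vu -[x](nbrK D0) h Phi_nbr -Phi0.
Qed.

End Config.

End Frame.

(** * Symmetries of the configurations *)

Definition perm4 := (dir * dir * dir * dir)%type.
Definition perms : seq perm4 :=
  [seq z <- [seq (y.1, y.2.1, y.2.2.1, y.2.2.2) |
       y <- [seq (a, y) | a <- dirs, y <- [seq (b, y) | b <- dirs, y <- [seq (c, d) | c <- dirs, d <- dirs]]]]
   | [&& ~~ deq z.1.1.1 z.1.1.2, ~~ deq z.1.1.1 z.1.2, ~~ deq z.1.1.1 z.2,
         ~~ deq z.1.1.2 z.1.2, ~~ deq z.1.1.2 z.2 & ~~ deq z.1.2 z.2]].
Definition pdir (s : perm4) (i : dir) : dir := let: (a, b, c, d) := s in
  match i with D0 => a | D1 => b | D2 => c | D3 => d end.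
Definition vperm (s : perm4) (x : vtx) : vtx := let: (a, b, c, d) := s in
  V (vbit a x) (vbit b x) (vbit c x) (vbit d x).
Definition vadd (x y : vtx) : vtx := let: V a b c d := x in let: V a' b' c' d' := y in
  V (a (+) a') (b (+) b') (c (+) c') (d (+) d').
Fixpoint subseqs (k : nat) (s : seq vtx) : seq (seq vtx) :=
  if s is x :: s' then
    (if k is k'.+1 then map (cons x) (subseqs k' s') else [::]) ++ subseqs k s'
  else if k is 0 then [:: [::]] else [::].
Definition vsof (K : seq vtx) : vset := foldl vmark VS0 K.
Definition vseq (s s' : vset) : bool := let: VS a b c d := s in let: VS a' b' c' d' := s' in
  if nsub a a' then [&& nsub a' a, nsub b b', nsub b' b, nsub c c', nsub c' c, nsub d d' & nsub d' d] else false.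
Definition cfgK (sep : bool) (w : vtx) (k : nat) (g : config) : option (vset * seq vtx) :=
  let: Cfg sep' w' K _ := g in
  if [&& eqb sep sep', veq w w' & size K == k] then Some (vsof K, K) else None.

(* Every set of [k] crossing edges is, up to a permutation of the directions
   fixing [w] and to exchanging the two ends of the path, one of the listed ones,
   unless it contains the edge between the two ends. *)
Definition exhaustive (sep : bool) (k : nat) (gs : seq config) (ws : seq vtx) : bool :=
  all (fun w =>
    let st := [seq s <- perms | veq (vperm s w) w] in
    let Ks := pmap (cfgK sep w k) gs in
    all (fun K => [&& sep, veq w v0 & vin v0 K] || has (fun s =>
      (let S := vsof (map (vperm s) K) in has (fun z => vseq S z.1) Ks)
      || (let S := vsof (map (fun x => vperm s (vadd x w)) K) in has (fun z => vseq S z.1) Ks)) st) (subseqs k verts)) ws.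

(** After sorting the directions only the number of ones in [v] matters: it is even when the ends
    lie in different copies and odd otherwise. *)
Definition wS := [:: V false false false false; V true true false false; V true true true true].
Definition wN := [:: V true false false false; V true true true false].

Lemma perms_pdir s : s \in perms -> injective (pdir s).
Proof.
have : all (fun s => all (fun i => all (fun j => deq (pdir s i) (pdir s j) ==> deq i j) dirs) dirs) perms by [].
move/allP => h /h /allP hs i j /eqP ij.
have := allP (hs i (mem_dirs i)) j (mem_dirs j).
by have -> : deq (pdir s i) (pdir s j) by []; move/deqP.
Qed.

Lemma perms_surj s j : s \in perms -> exists i, j = pdir s i.
Proof.
have : all (fun s => all (fun j => has (fun i => deq j (pdir s i)) dirs) dirs) perms by [].
by move/allP => h /h /allP/(_ j (mem_dirs j))/hasP[i _ /deqP]; exists i.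
Qed.

Lemma vbit_vperm s i x : vbit i (vperm s x) = vbit (pdir s i) x.
Proof. by case: s => -[[a b] c] d; case: i. Qed.

Lemma vtx_ext x y : (forall i, vbit i x = vbit i y) -> x = y.
Proof.
case: x y => a b c d [a' b' c' d'] h; congr V.
- exact: (h D0).
- exact: (h D1).
- exact: (h D2).
- exact: (h D3).
Qed.

Lemma vperm_bij s : s \in perms -> bijective (vperm s).
Proof.
move=> sp; have inj : injective (vperm s).
  move=> x y e; apply: vtx_ext => j; have [i ->] := perms_surj j sp.
  by rewrite -!vbit_vperm e.
have surj y : y \in [seq vperm s x | x <- verts].
  have : size (undup [seq vperm s x | x <- verts]) = 16.
    by rewrite undup_id ?size_map // map_inj_uniq.
  have uu := undup_uniq [seq vperm s x | x <- verts].
  move=> sz; have sub : {subset undup [seq vperm s x | x <- verts] <= verts} by move=> x _; apply: mem_verts.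
  have le : size verts <= size (undup [seq vperm s x | x <- verts]) by rewrite sz.
  have [_ hy] := uniq_min_size uu sub le.
  by have := hy y; rewrite mem_undup mem_verts.
pose g y := nth v0 verts (index y [seq vperm s x | x <- verts]).
have gK : cancel g (vperm s).
  move=> y; rewrite /g -(nth_map v0 v0) ?nth_index //.
  by rewrite -(size_map (vperm s)) index_mem.
by exists g => // x; apply: inj; rewrite gK.
Qed.

Lemma vbit_vadd i x y : vbit i (vadd x y) = vbit i x (+) vbit i y.
Proof. by case: i; case: x; case: y. Qed.

Lemma vaddK w : involutive (vadd^~ w).
Proof. by move=> x; apply: vtx_ext => i; rewrite !vbit_vadd -addbA addbb addbF. Qed.

Lemma filter_subseqs (P : pred vtx) s : filter P s \in subseqs (count P s) s.
Proof.
elim: s => //= x s IH; case: (P x) => /=; rewrite mem_cat ?add0n ?IH ?orbT //.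
by rewrite add1n map_f.
Qed.

Lemma vseqP K K' : vseq (vsof K) (vsof K') -> K =i K'.
Proof.
move=> h x; have vmE L : (x \in L) = vmem (vsof L) x.
  by rewrite foldl_vmark; case: x {h} => [[] [] [] []].
rewrite !vmE; move: h; case: (vsof K) => a b c d; case: (vsof K') => a' b' c' d' /=.
case: ifP => // s1 /and5P[s2 s3 s4 s5 /and3P[s6 s7 s8]].
by case: x {vmE} => x0 x1 [] []; apply/idP/idP; apply: nget_nsub.
Qed.

Lemma sort_vtx w : exists2 s, s \in perms & vperm s w \in wS ++ wN.
Proof.
have : all (fun w => has (fun s => vin (vperm s w) (wS ++ wN)) perms) verts by vm_cast_no_check (erefl true).
move/allP/(_ w (mem_verts w))/hasP => [s sp h].
by exists s; rewrite // -vinE.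
Qed.

Definition is_frame d (e : dir -> 'I_5) :=
  [/\ injective e, forall i, e i != d & forall k, k = d \/ exists i, k = e i].

Lemma frame_exists d : exists e, is_frame d e.
Proof.
pose o i : 'I_4 := match i with D0 => inord 0 | D1 => inord 1 | D2 => inord 2 | D3 => inord 3 end.
have oE i : o i = match i with D0 => 0 | D1 => 1 | D2 => 2 | D3 => 3 end :> nat by case: i; rewrite inordK.
exists (fun i => lift d (o i)); split.
- by move=> i j /lift_inj /(congr1 val) /=; rewrite !oE; case: i; case: j.
- by move=> i; rewrite eq_sym neq_lift.
move=> k; case: (unliftP d k) => [j|] ->; last by left.
right; have [i ji] : exists i, j = o i :> nat.
  by case: j => -[|[|[|[|//]]]] hj; [exists D0|exists D1|exists D2|exists D3]; rewrite oE.
by exists i; congr lift; apply: val_inj.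
Qed.

Lemma frame_perm d e s : is_frame d e -> s \in perms -> is_frame d (e \o pdir s).
Proof.
move=> [ei ed es] sp; split=> [|i|k] /=.
- by move=> i j /ei /(perms_pdir sp).
- exact: ed.
case: (es k) => [|[j ->]]; first by left.
by right; have [i ->] := perms_surj j sp; exists i.
Qed.

Lemma Phi_perm u d e s b x : is_frame d e -> s \in perms ->
  Phi u d e b x = Phi u d (e \o pdir s) b (vperm s x).
Proof.
move=> fr sp; have fr' := frame_perm fr sp; have [ei ed es] := fr; have [ei' ed' es'] := fr'.
apply: (frame_ext es') => [|i]; first by rewrite !Phi_d.
by rewrite (Phi_e _ ei' ed') /= (Phi_e _ ei ed) vbit_vperm.
Qed.

(** Coordinates read from the other end differ by a translation by [w] and, if the ends lie in
    different copies, by exchanging the copies. This is the second symmetry used in [exhaustive]. *)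
Lemma Phi_swap u d e sep w b x : is_frame d e ->
  Phi (Phi u d e sep w) d e b x = Phi u d e (b (+) sep) (vadd x w).
Proof.
move=> [ei ed es]; apply: (frame_ext es) => [|i].
  by rewrite !Phi_d -addbA [sep (+) b]addbC.
by rewrite !(Phi_e _ ei ed) vbit_vadd -addbA [vbit i w (+) _]addbC.
Qed.

Lemma ham_rev n (m : cube n -> 'I_n -> bool) u v s : ham m v u s ->
  exists2 t, u :: t = rev (v :: s) & ham m u v t.
Proof.
move=> [[ps us as_ ls] hs].
have [t et] : exists t, u :: t = rev (v :: s).
  by exists (rev (belast v s)); rewrite [v :: s]lastI rev_rcons ls.
exists t => //; split; last by move=> x i /hs h; rewrite et; apply: linked_rev.
split.
- rewrite -[path _ _ _]/(sorted (@qadj n) (u :: t)) et; apply/sorted_linked => x y /linked_rev.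
  by rewrite revK; apply: (sorted_linked (v :: s)).2.
- by rewrite et rev_uniq.
- by move=> x; rewrite et mem_rev.
by rewrite -[last _ _]/(last u (u :: t)) et rev_cons last_rcons.
Qed.

Lemma ham3_sym n (m : cube n -> 'I_n -> bool) u v : ham3 m v u -> ham3 m u v.
Proof.
move=> [s1 [s2 [s3 [[h1 h2 h3] [n12 n13 n23]]]]].
have [t1 e1 H1] := ham_rev h1; have [t2 e2 H2] := ham_rev h2; have [t3 e3 H3] := ham_rev h3.
have inj s s' t t' : u :: t = rev (v :: s) -> u :: t' = rev (v :: s') -> t = t' -> s = s'.
  by move=> e e' tt; move: e; rewrite tt e' => /(can_inj (@revK _)) [].
exists t1, t2, t3; split=> //; split.
- by move/(inj _ _ _ _ e1 e2).
- by move/(inj _ _ _ _ e1 e3).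
- by move/(inj _ _ _ _ e2 e3).
Qed.

Definition verified gs := forall g, List.In g gs -> exists ct, check g ct.

Lemma all2_verified gs cs : all2 check gs cs -> verified gs.
Proof.
elim: gs cs => [|g gs IH] [|c cs] //= h g'; first by case.
by case/andP: h => h /IH hs [<-|/hs //]; exists c.
Qed.

Section Exhaustive.

Variables (m : cube 5 -> 'I_5 -> bool) (u v : cube 5).
Hypotheses (mm : ismat m) (g : good m u v).

Lemma exhaustive_ham sep k gs ws d e w : verified gs -> exhaustive sep k gs ws ->
  is_frame d e -> v = Phi u d e sep w -> sep (+) vpar w -> w \in ws ->
  count (fun x => m (Phi u d e false x) d) verts = k ->
  (k = 3 -> forall q, #|[set z | (parity z == q) && [forall k, ~~ m z k]]| <= 1) ->
  (k != 0 -> forall l, (forall z, ~~ m z l) -> ham3 m u v) -> ham3 m u v.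
Proof.
move=> vg ex fr vE pw ww kE few3 unused.
have := allP ex w ww; set K := [seq x <- verts | m (Phi u d e false x) d].
move/allP/(_ K); rewrite -kE filter_subseqs kE => /(_ isT).
have KP x : m (Phi u d e false x) d = (x \in K) by rewrite mem_filter mem_verts andbT.
have [ei ed es] := fr.
case/orP => [/and3P[sepT /veqP w0]|/hasP[s]].
  rewrite vinE -KP -(Phi0 _ ei ed es) => mu; case/goodP: g => _ _; case; apply/c3P; exists d => //.
  by rewrite vE w0 sepT -[true]/(~~ false) (Phi_cross _ ei ed es) -(Phi0 _ ei ed es).
rewrite mem_filter => /andP[/veqP sw sp]; have fr' := frame_perm fr sp.
have [ei' ed' es'] := fr'.
have cfgP z : List.In z (pmap (cfgK sep w k) gs) -> [/\ z.1 = vsof z.2, size z.2 = k & exists pats ct, check (Cfg sep w z.2 pats) ct].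
  have: verified gs by []. rewrite /verified.
  elim: (gs) => //= g0 gs0 IH vg0; case E: (cfgK sep w k g0) => [K''|] /=; last first.
    by apply: IH => g1 h; apply: vg0; right.
  case=> [eK|]; last by apply: IH => g1 h; apply: vg0; right.
  have [ct ck] := vg0 g0 (or_introl erefl); case: g0 E ck {vg0} => sep' w' K0 pats /=.
  case: ifP => // /and3P[/eqbP <- /veqP <- /eqP sK] [e0] ck.
  by rewrite -eK -e0; split=> //; exists pats, ct.
have unused' (K' : seq vtx) : size K' = k -> K' != [::] -> k != 0 by move=> <-; case: K'.
have [vp vpK vpK'] := vperm_bij sp.
case/orP => /has_In[[S K'] /cfgP[/= -> sK [pats [ct ck]]] /vseqP eK].
  apply: (config_ham ei' ed' es' mm (sep := sep) (w := w) (K := K') _ pw _ g ck).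
  - by rewrite vE (Phi_perm _ _ _ fr sp) sw.
  - move=> y; rewrite -[y]vpK' -(Phi_perm _ _ _ fr sp) KP -eK mem_map //.
    exact: can_inj vpK.
  - by rewrite sK.
  - by move/(unused' _ sK).
apply: ham3_sym.
have uE : u = Phi v d e sep w.
  rewrite vE (Phi_swap _ _ _ _ _ fr) addbb.
  have -> : vadd w w = v0 by apply: vtx_ext => i; rewrite vbit_vadd addbb; case: i.
  exact: (Phi0 _ ei ed es).
apply: (config_ham (u := v) ei' ed' es' mm (sep := sep) (w := w) (K := K') _ pw _ (good_sym mm g) ck).
- by rewrite {1}uE (Phi_perm _ _ _ fr sp) sw.
- move=> y; rewrite -[y]vpK' -(Phi_perm _ _ _ fr sp) -eK.
  have -> : [seq vperm s (vadd x w) | x <- K] = map (vperm s) (map (vadd^~ w) K) by rewrite -map_comp.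
  rewrite mem_map; last exact: can_inj vpK.
  rewrite -[in RHS](vaddK w (vp y)) (mem_map (inv_inj (vaddK w))) -KP vE (Phi_swap _ _ _ _ _ fr) /=; case: (sep) => //.
  by rewrite -[true]/(~~ false) (Phi_cross _ ei ed es) mm.1.
- by rewrite sK.
- by move=> /(unused' _ sK) k0 l hl; apply: ham3_sym; apply: (unused k0 l).
Qed.

Lemma sorted_frame d : parity u != parity v -> exists e w,
  [/\ is_frame d e, v = Phi u d e (u d (+) v d) w, (u d (+) v d) (+) vpar w
    & w \in if u d (+) v d then wS else wN].
Proof.
move=> puv; have [e0 fr0] := frame_exists d; have [ei ed es] := fr0.
have vE := Phi_coord u ei ed es v; set w0 := V _ _ _ _ in vE.
have [s sp sw] := sort_vtx w0.
have fr := frame_perm fr0 sp; exists (e0 \o pdir s), (vperm s w0).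
have vE' : v = Phi u d (e0 \o pdir s) (u d (+) v d) (vperm s w0) by rewrite -(Phi_perm _ _ _ fr0 sp).
have [ei' ed' es'] := fr.
have pw : (u d (+) v d) (+) vpar (vperm s w0).
  have pv : parity v = parity u (+) (u d (+) v d) (+) vpar (vperm s w0).
    by rewrite {1}vE' (parity_Phi _ ei' ed' es').
  move: puv; rewrite pv; by case: (parity u) (u d (+) v d) (vpar _) => [] [] [].
split=> //; move: sw pw; rewrite mem_cat.
by case: (u d (+) v d) => /orP[]; rewrite !inE => h; rewrite ?h //; move: h; do ?case/orP; move=> /eqP->.
Qed.

End Exhaustive.

(** * Edges per direction and uncovered vertices *)

Section Counting.

Variables (m : cube 5 -> 'I_5 -> bool) (mm : ismat m).

(** Every edge has one end of each parity, so for either [q] this counts the edges of direction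
    [d]. *)
Definition ndir q d := #|[set z | (parity z == q) && m z d]|.
Definition nfree q := #|[set z | (parity z == q) && [forall k, ~~ m z k]]|.

Lemma ndir_parity q d : ndir (~~ q) d = ndir q d.
Proof.
rewrite /ndir -[RHS](card_imset _ (inv_inj (flipK d))); apply: eq_card => z.
apply/idP/imsetP => [|[y + ->]]; rewrite !inE; last by rewrite parity_flip mm.1 => /andP[/eqP-> ->]; rewrite eqxx.
move=> /andP[/eqP pz mz]; exists (flip z d); last by rewrite flipK.
by rewrite inE parity_flip pz negbK eqxx mm.1.
Qed.

Lemma card_parity q : #|[set z : cube 5 | parity z == q]| = 16.
Proof.
pose P q := [set z : cube 5 | parity z == q].
have eqP p : #|P (~~ p)| = #|P p|.
  rewrite -[RHS](card_imset _ (inv_inj (@flipK 5 ord0))); apply: eq_card => z.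
  apply/idP/imsetP => [|[y + ->]]; rewrite !inE; last by rewrite parity_flip => /eqP->.
  by move=> /eqP pz; exists (flip z ord0); rewrite ?flipK // inE parity_flip pz negbK.
have PC : ~: P q = P (~~ q).
  by apply/setP => z; rewrite !inE; case: (parity z) (q) => [] [].
have := cardsC (P q); rewrite PC eqP card_ffun card_bool card_ord addnn.
by move=> h; apply: double_inj; rewrite h.
Qed.

Lemma ndir_sum q : \sum_d ndir q d + nfree q = 16.
Proof.
rewrite -(card_parity q) -sum1_card /nfree -sum1_card.
rewrite (eq_bigr (fun d => \sum_(z | parity z == q) m z d)); last first.
  move=> d _; rewrite /ndir -sum1_card big_mkcond [RHS]big_mkcond; apply: eq_bigr => z _.
  by rewrite inE; case: (parity z == q); case: (m z d).
rewrite exchange_big /= big_mkcond [X in _ + X]big_mkcond [RHS]big_mkcond -big_split /=.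
apply: eq_bigr => z _; rewrite !inE; case: eqP => //= _.
case: forallP => [h|/forallP].
  by rewrite big1 // => d _; rewrite (negPf (h d)).
rewrite negb_forall => /existsP[d]; rewrite negbK => mz; rewrite (bigD1 d) //= mz big1 // => d' dd.
by case E: (m z d') => //; move: dd; rewrite (mm.2 _ _ _ E mz) eqxx.
Qed.

End Counting.

(** * The choice of the cutting direction in dimension five *)

Section Base.

Variable gs : bool -> nat -> seq config.
Hypotheses (vgs : forall sep k, k <= 3 -> verified (gs sep k))
  (ex2 : forall sep k, k <= 2 -> exhaustive sep k (gs sep k) (if sep then wS else wN))
  (exN : exhaustive false 3 (gs false 3) wN)
  (exS : exhaustive true 3 (gs true 3) [:: V true true true true]).

Variables (m : cube 5 -> 'I_5 -> bool) (u v : cube 5).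
Hypotheses (mm : ismat m) (puv : parity u != parity v) (g : good m u v).

(** Without crossing edges no pair of classes is exempt for lack of a direction. So this case stands
    on its own and can serve as the way out in the cases with crossing edges. *)
Lemma unused_ham d : (forall z, ~~ m z d) -> ham3 m u v.
Proof.
move=> ud; have [e [w [fr vE pw ww]]] := sorted_frame d puv.
apply: (exhaustive_ham mm g (@vgs _ 0 isT) (@ex2 _ 0 isT) fr vE pw ww) => //.
by apply/eqP; rewrite -leqn0 leqNgt -has_count; apply/hasPn => x _; apply: ud.
Qed.

Lemma count_crossings d e : is_frame d e ->
  count (fun x => m (Phi u d e false x) d) verts <= ndir m false d.
Proof.
move=> [ei ed es]; rewrite -size_filter.
(* Each crossing edge is represented by its end of even parity. *)
rewrite -(size_map (fun x => Phi u d e (parity u (+) vpar x) x)).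
set s := map _ _; have us : uniq s.
  by rewrite map_inj_uniq ?filter_uniq //; move=> x y /(Phi_inj ei ed)[].
rewrite -(card_uniqP us); apply: subset_leq_card; apply/subsetP => z /mapP[x].
rewrite mem_filter => /andP[mx _] ->; rewrite inE (parity_Phi _ ei ed es); apply/andP; split.
  by case: (parity u) (vpar x) => [] [].
case: (parity u (+) vpar x) => //.
by rewrite -[true]/(~~ false) (Phi_cross _ ei ed es) mm.1.
Qed.

(** Three crossing edges along a separating direction are certified only for antipodal ends, hence
    the alternative in the second hypothesis. *)
Lemma direction_ham d : ndir m false d <= 3 ->
  (ndir m false d = 3 -> (forall q, nfree m q <= 1) /\ (v d = u d \/ forall i, v i <> u i)) ->
  ham3 m u v.
Proof.
move=> n3 h3; have [e [w [fr vE pw ww]]] := sorted_frame d puv; have [ei ed es] := fr.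
have kn := count_crossings fr; set k := count _ _ in kn.
have un : k != 0 -> forall l, (forall z, ~~ m z l) -> ham3 m u v by move=> _; apply: unused_ham.
have [k2|k3] := leqP k 2.
  apply: (exhaustive_ham mm g (@vgs _ k (leqW k2)) (@ex2 _ k k2) fr vE pw ww) => //.
  by move=> kE; rewrite kE in k2.
have kE : k = 3 by apply/eqP; rewrite eqn_leq k3 (leq_trans kn n3).
have [fr3 hd] : (forall q, nfree m q <= 1) /\ (v d = u d \/ forall i, v i <> u i).
  by apply: h3; apply/eqP; rewrite eqn_leq n3 -kE.
rewrite -/k kE in un.
case: hd => hd.
  move: vE pw ww; rewrite hd addbb => vE pw ww.
  exact: (exhaustive_ham mm g (@vgs _ 3 isT) exN fr vE pw ww kE (fun _ => fr3)).
have sepT : u d (+) v d = true by have := hd d; case: (v d) (u d) => [] [] // /(_ erefl).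
move: vE pw ww; rewrite sepT => vE pw ww.
have w15 : w \in [:: V true true true true].
  have wb i : vbit i w.
    have := hd (e i); rewrite vE (Phi_e _ ei ed); by case: (u (e i)) (vbit i w) => [] [] // /(_ erefl).
  by rewrite inE; apply/eqP; apply: vtx_ext => i; rewrite wb; case: i.
exact: (exhaustive_ham mm g (@vgs _ 3 isT) exS fr vE pw w15 kE (fun _ => fr3)).
Qed.

Lemma base_ham : ham3 m u v.
Proof.
pose nd := ndir m false.
have sum16 : \sum_d nd d <= 16 by rewrite -(ndir_sum mm false) leq_addr.
have [d min_d] : exists d, forall d', nd d <= nd d'.
  by exists [arg min_(d < ord0) nd d]; case: arg_minnP => // i _ h d'; apply: h.
have d3 : nd d <= 3.
  rewrite leqNgt; apply: contraL sum16 => d4; rewrite -ltnNge.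
  apply: (@leq_trans (\sum_(d' < 5) 4)); first by rewrite sum_nat_const card_ord.
  by apply: leq_sum => d' _; apply: leq_trans d4 (min_d d').
have [nd3|n3] := eqVneq (nd d) 3; last first.
  by apply: (direction_ham d3) => h; move: n3; rewrite /nd h eqxx.
(* Three edges in each of five directions account for at least 15 of the 16 vertices of one
   parity. *)
have free q : nfree m q <= 1.
  rewrite -(leq_add2l (\sum_d' ndir m q d')) ndir_sum // -[16]/(15 + 1) leq_add2r.
  apply: (@leq_trans (\sum_(d' < 5) 3)); first by rewrite sum_nat_const card_ord.
  apply: leq_sum => d' _; rewrite -nd3; apply: leq_trans (min_d d') _.
  by rewrite /nd; case: (q); rewrite // -[true]/(~~ false) ndir_parity.
have [vd|vd] := eqVneq (v d) (u d); first by apply: (direction_ham d3) => _; split=> //; left.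
have [e [w [fr vE pw ww]]] := sorted_frame d puv; have [ei ed es] := fr.
have sepT : u d (+) v d = true by case: (u d) (v d) vd => [] [].
rewrite sepT in vE pw ww.
have [w15|w15] := eqVneq w (V true true true true).
  apply: (direction_ham d3) => _; split=> //; right=> i.
  case: (es i) => [->|[j ->]]; first exact/eqP.
  by rewrite vE (Phi_e _ ei ed) w15; case: (u (e j)); case: (j).
(* If the ends are not antipodal, the sorted [w] has at most two ones, so [D2] and [D3] do not
   separate them. One of the two carries only three edges: otherwise there would be at least 3 * 5 +
   2 = 17 edges. *)
have [i1 [i2 [i12 v1 v2]]] : exists i1 i2, [/\ i1 != i2, v i1 = u i1 & v i2 = u i2].
  exists (e D2), (e D3); rewrite (inj_eq ei) vE !(Phi_e _ ei ed).
  move: ww; rewrite !inE (negPf w15) orbF => /orP[] /eqP->; by rewrite /= !addbF.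
have [n1|n1] := leqP (nd i1) 3.
  by apply: (direction_ham n1) => _; split=> //; left.
have [n2|n2] := leqP (nd i2) 3.
  by apply: (direction_ham n2) => _; split=> //; left.
exfalso; move: sum16; apply/negP; rewrite -ltnNge.
have one (i : 'I_5) : \sum_(d' < 5) (d' == i) = 1.
  by rewrite (bigD1 i) //= eqxx big1 // => d' /negPf->.
apply: (@leq_trans (\sum_(d' < 5) (3 + ((d' == i1) + (d' == i2))))).
  by rewrite !big_split /= !one sum_nat_const card_ord.
apply: leq_sum => d' _; have n0 : 3 <= nd d' by rewrite -nd3.
case: eqP => [->|_]; first by rewrite (negPf i12) addn0.
by case: eqP => [->|_]; rewrite ?addn0.
Qed.

End Base.

(* The certificates are found by the following functions, about which nothing
   has to be proved. *)
Fixpoint gc (n : nat) (cur : option (vtx * vtx)) (prs : seq (vtx * vtx)) (s : vset) (e : eset) (acc : seq eset) : seq eset :=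
  if n is n'.+1 then
    match cur with
    | None => match prs with
        | [::] => if vfull s then e :: acc else acc
        | (a, b) :: prs' => gc n' (if veq a b then None else Some (a, b)) prs' s e acc end
    | Some (x, b) =>
        foldl (fun acc i => let y := nbr i x in
          if veq y b then gc n' None prs s (setE e i x) acc
          else if vmem s y then acc else gc n' (Some (y, b)) prs (vmark s y) (setE e i x) acc) acc dirs
    end
  else acc.

Definition gcovers (prs : seq (vtx * vtx)) : seq eset :=
  gc 40 None prs (foldl (fun s z => vmark (vmark s z.1) z.2) VS0 prs) E0 [::].

Fixpoint tonm (m : seq bool) : seq nib :=
  let b (a : bool) c d (n : nib) := if a then nset n c d else n in
  match m with
  | [:: p, q, r, t & m'] => b p false false (b q true false (b r false true (b t true true N0))) :: tonm m'
  | [:: p; q; r] => [:: b p false false (b q true false (b r false true N0))]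
  | [:: p; q] => [:: b p false false (b q true false N0)]
  | [:: p] => [:: b p false false N0]
  | [::] => [::]
  end.
Definition fromnm (m : seq nib) : seq bool :=
  flatten [seq [:: nget a false false; nget a true false; nget a false true; nget a true true] | a <- m].
Definition npop (a : nib) : nat := nget a false false + nget a true false + nget a false true + nget a true true.
Fixpoint nmsub (m f : seq nib) : bool :=
  match m, f with a :: m', b :: f' => if nsub a b then nmsub m' f' else false | _, _ => true end.
Fixpoint ncommon (n : nat) (m m' : seq nib) : bool :=
  if n is 0 then true else
  match m, m' with a :: m1, b :: m1' => ncommon (n - npop (nand a b)) m1 m1' | _, _ => false end.
Fixpoint gleaves (rs : seq row) (ub : nat) (tabs : seq (seq eset)) (p : eset) (acc : seq (eset * seq nib)) {struct rs} : seq (eset * seq nib) :=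
  if rs is Row x m0 m1 m2 m3 cl nb :: rs' then
    let acc := if getE p D0 x then gleaves rs' ub (ftab D0 x tabs) (andE p m0) acc else acc in
    let acc := if getE p D1 x then gleaves rs' ub (ftab D1 x tabs) (andE p m1) acc else acc in
    let acc := if getE p D2 x then gleaves rs' ub (ftab D2 x tabs) (andE p m2) acc else acc in
    let acc := if getE p D3 x then gleaves rs' ub (ftab D3 x tabs) (andE p m3) acc else acc in
    if ub is ub'.+1 then
      let p' := andE p cl in if hasfree nb p' then acc else gleaves rs' ub' tabs p' acc
    else acc
  else (p, tonm [seq ~~ nilp t | t <- tabs]) :: acc.

Definition evs := [seq x <- verts | ~~ vpar x].

Definition gsets (sep sd : bool) (v : vtx) : seq eset :=
  [seq blk i sd | i <- dirs & vbit i v] ++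
  (if [&& ~~ sep, ~~ sd & veq v (nbr D0 v0)] then [seq c2set j | j <- [:: D1; D2; D3]] else [::]).

Fixpoint mand (m m' : seq nib) : seq nib :=
  match m, m' with a :: m1, b :: m1' => nand a b :: mand m1 m1' | _, _ => [::] end.

Definition elab (p : eset) : label :=
  let: E a a' b b' c c' d d' := p in LD (nz a || nz a') (nz b || nz b') (nz c || nz c') (nz d || nz d').

Definition gdrop (cov : seq (seq eset)) (p e : eset) : seq (eset * seq nib) :=
  flatten [seq pmap (fun i => if getE e i x then let q := unset p i x in Some (q, tonm (map (has (subE q)) cov)) else None) dirs | x <- evs].

Definition gflag (flags : seq eset) (z : eset * seq nib) : bool := has (fun e => subE e z.1) flags.

Definition glv (sd sep : bool) (v : vtx) (K : seq vtx) (cov : seq (seq eset)) : seq (eset * seq nib) :=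
  let rs := rowsof sd sep v K in
  filter (fun z : eset * seq nib => ~~ vac rs z.1 && (if size K == 3 then few 1 (oddsK K) z.1 else true))
    (gleaves rs (ub K) cov (p0 sd sep v K) [::]).

Record prep := Prep { pcov : seq (seq eset); ppl : seq (eset * seq nib); psp : seq (eset * seq nib); pz : seq (label * seq nib) }.

Definition gprep (sd sep : bool) (v : vtx) (K : seq vtx) (pats : seq (seq vtx)) : prep :=
  let cov := map (fun c => gcovers (pairs (~~ sd) v0 c v)) pats in
  let ls := glv sd sep v K cov in
  let flags := if nilp K then gsets sep sd v else [::] in
  let sp := filter (gflag flags) ls in
  let pl := filter (fun z => ~~ gflag flags z) ls ++
     flatten (map (fun z : eset * seq nib => flatten (map (gdrop cov z.1) (filter (fun e => subE e z.1) flags))) sp) in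
  let c1 := map (fun z : eset * seq nib => (if nilp K then LD true true true true else elab z.1, z.2)) pl in
  let c2 := flatten (map (fun z : eset * seq nib => map (fun e => (LK e, z.2)) (filter (fun e => subE e z.1) flags)) sp) in
  Prep cov pl sp (c1 ++ c2).

Definition pairok (thr : nat) (sep : bool) (v : vtx) (K : seq vtx) (z z' : label * seq nib) : bool :=
  if ncommon thr z.2 z'.2 then true else exempt sep v (nilp K) z.1 z'.1.

Definition leq (l l' : label) := match l, l' with
  | LD a b c d, LD a' b' c' d' => [&& eqb a a', eqb b b', eqb c c' & eqb d d']
  | LK e, LK e' => subE e e' && subE e' e | _, _ => false end.

Definition gabs (cs : seq (label * seq nib)) (z : label * seq nib) : bool :=
  has (fun c => (if c.1 is LD true true true true then (if z.1 is LD _ _ _ _ then true else false) else leq c.1 z.1) && nmsub c.2 z.2) cs.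

Definition gmins (zs : seq (label * seq nib)) : seq (label * seq nib) :=
  foldl (fun cs z => if gabs cs z then cs else z :: filter (fun c => ~~ gabs [:: z] c) cs) [::] zs.

Fixpoint gmerge1 (n : nat) (ok : label * seq nib -> bool) (z : label * seq nib) (cs : seq (label * seq nib)) : option (seq (label * seq nib)) :=
  if n is n'.+1 then
  if cs is c :: cs' then
    let m := (z.1, mand z.2 c.2) in
    if leq z.1 c.1 && ok m then Some (m :: cs') else omap (cons c) (gmerge1 n' ok z cs')
  else None else None.

Definition gmerge ok zs := foldl (fun cs z => if gabs cs z then cs else
  if gmerge1 3 ok z cs is Some cs' then cs' else z :: cs) [::] zs.

Fixpoint gcount (p : seq eset) (c : eset) (n : nat) : nat :=
  if p is q :: p' then gcount p' c (if subE q c then n.+1 else n) else n.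

Fixpoint gbest (S : seq eset) (cs : seq eset) (b : eset) (n : nat) : eset :=
  if cs is c :: cs' then let k := gcount S c 0 in if n < k then gbest S cs' c k else gbest S cs' b n else b.

Fixpoint ggreedy (fuel : nat) (As : seq eset) (cov : seq eset) (acc : seq eset) : seq eset :=
  if fuel is f.+1 then
    if As is p :: As' then
      match [seq c <- cov | subE p c] with
      | [::] => ggreedy f As' cov acc
      | c :: cs => let b := gbest (take 100 As) cs c 0 in
          ggreedy f [seq q <- As | ~~ subE q b] cov (b :: acc)
      end
    else acc
  else acc.

Fixpoint gfirst (cls : seq (label * seq nib)) (z : eset * seq nib) : eset * seq nib :=
  if cls is c :: cls' then
    if (if c.1 is LD b0 b1 b2 b3 then ldok b0 b1 b2 b3 z.1 else false) && nmsub c.2 z.2 then (z.1, c.2) else gfirst cls' z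
  else (z.1, [::]).

Definition gassign (cls : seq (label * seq nib)) (pl sp : seq (eset * seq nib)) : seq (eset * seq nib) :=
  map (gfirst cls) pl
  ++ flatten [seq [seq (z.1, c.2) | c <- cls & (if c.1 is LK e then subE e z.1 && nmsub c.2 z.2 else false)] | z <- sp].

Definition gtabs (cov : seq (seq eset)) (asg : seq (eset * seq nib)) : seq (seq eset) :=
  let asg' := [seq (z.1, fromnm z.2) | z <- asg] in
  [seq rev (ggreedy (size asg) [seq z.1 | z <- asg' & nth false z.2 t.1] t.2 [::]) | t <- zip (iota 0 (size cov)) cov].

Definition gsort (cls : seq (label * seq nib)) (pl : seq (eset * seq nib)) : seq (label * seq nib) :=
  let cnt c := count (fun z => nmsub c.2 z.2) (take 60 pl) in
  map fst (sort (fun a b => b.2 <= a.2) [seq (c, cnt c) | c <- cls]).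

Definition ecompact (s : seq eset) : elist :=
  foldr (fun e l => let: E a a' b b' c c' d d' := e in econs a a' b b' c c' d d' l) enil s.

(** Classes of the first copy are merged as long as [thr] patterns remain common with every class of
    the second. A value above the required three leaves slack for merging the classes of the second
    copy afterwards. *)
Definition gcert (thr : nat) (g : config) : cert :=
  let: Cfg sep v K pats := g in
  let q0 := gprep false sep v K pats in
  let q1 := gprep true sep v K pats in
  let bypop := sort (fun a b : label * seq nib => sumn (map npop a.2) <= sumn (map npop b.2)) in
  let z1 := bypop (gmins (pz q1)) in
  let c0 := gmerge (fun z => all (pairok thr sep v K z) z1) (bypop (pz q0)) in
  let c0 := bypop c0 in
  let c1 := gmerge (fun z => all (fun z' => pairok 3 sep v K z' z) c0) z1 in
  let back := map (fun c : label * seq nib => (c.1, take (size pats) (fromnm c.2))) in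
  let c0 := gsort c0 (ppl q0) in let c1 := gsort c1 (ppl q1) in
  Cert (map ecompact (gtabs (pcov q0) (gassign c0 (ppl q0) (psp q0)))) (map ecompact (gtabs (pcov q1) (gassign c1 (ppl q1) (psp q1)))) (back c0) (back c1).

(* [0x1abc] stands for the sequence of the vertices with the bits of [a, b, c];
   in a list of sequences each sequence is preceded by its length. *)
Fixpoint bits (p : positive) : seq bool :=
  match p with xH => [::] | xO q => false :: bits q | xI q => true :: bits q end.

Fixpoint digits (s : seq bool) (acc : seq vtx) : seq vtx :=
  if s is [:: a, b, c, d & s'] then digits s' (V a b c d :: acc) else acc.

Definition dec (n : N) : seq vtx := if n is Npos p then digits (bits p) [::] else [::].

Definition vnat (x : vtx) : nat := let: V a b c d := x in a + 2 * b + 4 * c + 8 * d.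

Fixpoint blocks (n : nat) (s : seq vtx) : seq (seq vtx) :=
  if n is n'.+1 then
    if s is x :: s' then take (vnat x) s' :: blocks n' (drop (vnat x) s') else [::]
  else [::].

Definition cfg (z : bool * N * N * N) : config :=
  let: (sep, v, K, pats) := z in
  let ds := dec pats in Cfg sep (head v0 (dec v)) (dec K) (blocks (size ds) ds).

(** * The configurations and their crossing patterns *)

Local Open Scope N_scope.

Definition configs_S0 := Eval vm_compute in map cfg [::
  (true, 0x10, 0x1, 0x11b1d1e171418121137c83da232f1313832f43d92389b31fd375831cd349d343d31c8);
  (true, 0x13, 0x1, 0x11d1e14181b12171138f731ae3dc234623157345b38a23df13b58386b3bf73d62326d3a84);
  (true, 0x1f, 0x1, 0x117181211141e1d1b3b34325d38a7316e32cd3738385432c73b313297326b31ab)].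

Definition configs_N0 := Eval vm_compute in map cfg [::
  (false, 0x11, 0x1,
    0x128f2832292e32ad2f829727927322323d26e2b32d92fd2892fb2752f722f2252fe2912d324f2862e92852ab2f22432d524926d449bf4bfe942ad32ae48f7c4ec4a4ef434d57948ae54e5df);
  (false, 0x17, 0x1,
    0x128f22f21f22524f2ad2f22c12d32e328a2892df24629222626e2232c82b321c2022572832862bf2d62432fe21623d28522944fb522c2e942ad624921a2ef24a4e34c4d62f4b32f4d34c4832c44fe642fd54198641f85)].

Definition configs_S1 := Eval vm_compute in map cfg [::
  (true, 0x10, 0x11, 0x11136b13a713e13371931df31e93f1831b53df1313e321f381631fb);
  (true, 0x10, 0x13,
    0x1323d37b33d7333be343b33ed38373eb33b3433783d32313e3b373e373e38373d387333bd33de);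
  (true, 0x10, 0x17, 0x11737e9367b3d7a39e735b73b7537a1367d3bf73a7432c7347f35783972);
  (true, 0x10, 0x1f,
    0x13e7f3feb3d7f3bdf3fbd38f73bf432f831fe34f231f23ef134f138fd31f43b2f3f483df23efb3bf7);
  (true, 0x13, 0x10, 0x1304b30d7308730de30783041308430e2302d30b230e130ed30db);
  (true, 0x13, 0x11, 0x1113c173a1731da341939e1386131e9351b34f131d535b131cb31f235d1341f);
  (true, 0x13, 0x14, 0x11434a7354b384f38463ad439e43c4734df34dc342934973fe4314a);
  (true, 0x13, 0x15, 0x138e5385734d5345b35d23d5e32e53b4535eb357838753185354b3e5838153e5d351b);
  (true, 0x13, 0x1c,
    0x13ceb38c738cb34ec3edc34dc3ce132cd3dc231ce3bc437c132cb31cb3cdb3dec37c23bc73cd7);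
  (true, 0x13, 0x1d, 0x11d38df3cd73d863cdb34da35ed34df3dc436ed3fdb3da13def32cd);
  (true, 0x1f, 0x10, 0x1301e302d3087304b308230813014304830bd30713012);
  (true, 0x1f, 0x11, 0x111351b3a1734193a41381631bc31d33219351e331d316b3971331e);
  (true, 0x1f, 0x13, 0x1323d343b3837313e33de384333ed348338733b3733843d23343d3e133d343e3d323b34b3)].

Definition configs_N1 := Eval vm_compute in map cfg [::
  (false, 0x11, 0x10, 0x120e20420220820b20720d);
  (false, 0x11, 0x12, 0x122322f22522922c2c2226);
  (false, 0x11, 0x16, 0x126e28626b2b62e624626d226);
  (false, 0x11, 0x1e, 0x12e52e32e92ef2fe);
  (false, 0x17, 0x10, 0x120d20820220b204201);
  (false, 0x17, 0x11, 0x129121f2a12c121c21921a2f1213216);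
  (false, 0x17, 0x18, 0x128f2832a82982c8285286);
  (false, 0x17, 0x19, 0x129d29b22929e2982492e9289)].

Definition configs_S2 := Eval vm_compute in map cfg [::
  (true, 0x10, 0x113, 0x13d13331d331e313e3e1333143317);
  (true, 0x10, 0x117, 0x13167376131a737a131c7);
  (true, 0x10, 0x11f, 0x13b1f3d1f3f1b321f341f381f3f183f12);
  (true, 0x10, 0x137, 0x13e733d73337d3b73337b337133723378);
  (true, 0x10, 0x13d, 0x133de3ed333db37d333d73b3d33d43d3b);
  (true, 0x10, 0x17b, 0x137cb3bc737fb);
  (true, 0x13, 0x101, 0x1301b3017301e301230183014);
  (true, 0x13, 0x104, 0x1304b304d304e304130423048);
  (true, 0x13, 0x107, 0x1307b307e307d307230873074);
  (true, 0x13, 0x10d, 0x130d230d430d730db30de);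
  (true, 0x13, 0x112, 0x132c131f231c232f13c12);
  (true, 0x13, 0x115, 0x1351b38153e15351e3e5132153415);
  (true, 0x13, 0x11c, 0x13c173c1b3c1e31c73ec13c1231ce3d1c);
  (true, 0x13, 0x11e, 0x131ce3ef13e51319e315e);
  (true, 0x13, 0x147, 0x1345734673497);
  (true, 0x13, 0x149, 0x1394b3947394e3849349d324937493e49);
  (true, 0x13, 0x14c, 0x13c473c4b384c3e4c374c324c314c);
  (true, 0x13, 0x14f, 0x13f4e384f3f4734fb3f4d38f43d4f);
  (true, 0x13, 0x159,
    0x154519b589157545eb9554eb9598e57589e51515d97545e9158951b598e75598d7552ed5951459b545197595de258759152d51952ed955158975915d2594eb5519d5b59875e55d9b259b74554be595154e955912e58751959e25157e89554598b529bd55519be51592e5e79255b92d55254985198e5558b7958915d575b9259e75155918e55e91b55d2985915e455198759e875559be459514b55e8925d9157554db957859151895751592b525db95e51985b4915559bd25e95715925de5bd91557e5195975825578915542795be4595519275db952598d57);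
  (true, 0x13, 0x15c,
    0x1545dcb52cd575c8157554cdb58c45b54cd5258ec5758c45754cd5158ce51575c8b54ce51515ec25b8c455c45d158c47554c517557c8b55dc4252bdc558ec7554c157552ced5cb15254cb255ec5d25bcd545c715e554cbd551bec5d54c25587ec5cd275554ceb557b8c582c575c75b855dc2b55b24c5bd5c452c5db515bc45857c4551bce5bec455cdb255e8c5152e54c5c2d5b5c2b5155d82c5e518c5ec1545ce15b515c875eb54c52cd7558c5725c82e55bc7545154ce5751c85c8b575815ec57ceb55c54e15d5bc45c8512552c7d5845ec558bec554cbe5ec7585bc475545cb251ce57);
  (true, 0x13, 0x15e, 0x138e535ed35e735eb385e32e53de53e57);
  (true, 0x13, 0x1cf,
    0x152cdfb58cdf754cfb158dcef528cf754cdfb54cdf258cef151cef751cefb5cdf725cdbf752cfd15dcef15ecdfb5dfec252dcef5cef7151fdce514ecf57fbc8584cf25fc8175f74cb54c21f54fb8c5bf7c45fb8c75cb74f581fec5cebf754dfcb547f8c57c84f58f4cb5bf4c757fcb85bf24c5c12f7582fdc5fb4c85f728c57f18c58c12f5bf84c58f74c54ecdf5fb14c5f78c45ecdf254c8ef5fc42b5fb78c5f7c8b5bfc4752cf7d5fb28c54cdbf5f71c85c1f275c4bf15bf7c851cdef5c7fb25cefd85847cf58cbf452f4cd548c2f584cfd);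
  (true, 0x1f, 0x101, 0x13017301d301e30123014);
  (true, 0x1f, 0x107, 0x13078307e307b307d);
  (true, 0x1f, 0x112, 0x132513291316231a2);
  (true, 0x1f, 0x116, 0x1361d361b361e381631673d163b16);
  (true, 0x1f, 0x11e, 0x1313e319e31ae315e316e);
  (true, 0x1f, 0x13c,
    0x158c73b523cd754c23d51c23e5837ce5234cd5ce31d543bcd532ecd52cd3b58c23d53b8c754c8b35c1d3e51ce3b52cb375823c7524c3d534cde51c73b543dce523d1c513bce5123c75237cb584ce35437cb54ec835c43b75c732d5c437b54c13e513bec53bc2757384c583d4c52cb315d132c534c8b548ce35b37c853b7c853bec4543b8c54cd32524cd358b34c5c13b75732cd5ced1358c7325dc82352137c5c43b257c438543ceb53edc15b8c43542cd35cd4235c23bd534ced537c8b57321c5ec837538bc45c2e3151c732);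
  (true, 0x10, 0x112, 0x13132323131f2);
  (true, 0x10, 0x116, 0x13d16361b361d3b16316e3e1636e1);
  (true, 0x10, 0x11e, 0x131fe3ef13e31313e315e);
  (true, 0x10, 0x135,
    0x151d53258e37558e57355d7b354eb3554d5b35235d1557318553be4537d5852b3d5585d7353b5d45375b155de23535de25e73b55537e852e3d55ed5135e751353be455d5e23532ed55315de55137e5357e85531d251b35e5873155e5731557e835de31553b4d5515d3e5387e554573152315755e231554e3b55378e5e73155b583d5154e35153b458e5315e853153e45153285d57315455132b538e4553157e54513753d5285eb315532e85554d3857e153583751515e3d51358e5e45135513de523e5455318e554d735875325d523153e54853db4553154b523e855324e55d153e5d32855238755135d2);
  (true, 0x10, 0x13c,
    0x153bec45237dc513bec54ecb3531dec54ceb358cd735ceb31523bdc53dec25cdb32537ec85ce731513b7c531bec5ced135cd73258ce735c7d23543ecb53b7c1537b8c532edc5c47b35edc1353e4c851c23e51c4735c132e5c23e157ec835374c85c7132523ec153c47b58c734538c7252c13d54c7385bdc435cd8235e231c574c8358327c534cdb53bdc45c137e5b374c538cd7532cde5c8b3754cb13532ced53dce252cb315834c7537d8c5347bc51e32c538b7c5c8de3587dc35d31c25c23bd53ed1c5c437b5ec723541cb35db3c45237c85423cd53cd7858c23d57dc835732cd53bd4c);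
  (true, 0x10, 0x13f,
    0x151fd3253bfe454efb354ef3153bf7d54bf7358ef73537fe8513fe8537fd854dfb358df32523fd4513fe458ef31531fd453bf785bf7345ef2315efd135231fd54f73b5df132587fb35132fe57efb35fd48353b4df5dfe235f2e3d5317f8537f8d5fe41357bf835e8f73573b4f5d231f5f4db3538ef75e2f13537f8e5bfe7352e3df5fd13e5e4f3b5d83fe5473f8532fbd5f48e35b7f4353bef75f1e235e4f315fb387538fed5f31d25b37f453e4fb5f132d51fe325dfb375bef43538e4f5b8f7352f13e58df735d8f735de32f51327f587ef352fd3158f3725437fb);
  (true, 0x10, 0x17f, 0x13e7f3b7f3d7f3f7e3f71327f3f7b3f7d);
  (true, 0x13, 0x103, 0x15042b3502d13508273501e23502e13508d7350b723508173508e73504e13504d23);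
  (true, 0x13, 0x105,
    0x150451b50815750e751501542502d51505eb15054eb508b455015e2504e51501b5450b245508e7550db5850e15750457b50158250b84550154e50285750582b50b754508e2550857e50e45b50d42550b574502e5b502451);
  (true, 0x13, 0x10c,
    0x1508c47504c8b508ce7508c42504c82502c81502ce150ce71501cd2502c41504ecb501c8e50ed1c50ceb15017c850e1dc50d2ec50cdb250ec21501c4b504cb850b8c450cd2b508c72508dc7504cbe508c41);
  (true, 0x13, 0x10f,
    0x1504ef1508df2508ef1504df2502ef15018ef501f825012ef5012fd5024f1507f82504f7b508fb750284f50bf7450df1250ef21501f2e5014fb50ebf1507ef850b84f50748f5048bf504feb);
  (true, 0x13, 0x114, 0x1345134f131643491);
  (true, 0x13, 0x116, 0x13816361b3d16361d361e3e1636d13416);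
  (true, 0x13, 0x11d, 0x13dc131fd3d61316d31ad);
  (true, 0x13, 0x145, 0x138453e45354b354e3d453547345737453854);
  (true, 0x13, 0x148, 0x134c838c434f8);
  (true, 0x13, 0x14b, 0x1349b346b345b34ab34cb);
  (true, 0x13, 0x14d, 0x134ad34cd3d94346d);
  (true, 0x13, 0x156,
    0x154675b58546751d5e658456b5685d752e6d55621575456eb557e6858e67554576254b26555d6e252645b5856b75186e55451e6567b5454865b5645715645db55d8265657e155467258b756557b86526457548b565b684551be565d6425562b5d576845564517556e785d675858d756551b6e56d57856285e55d62b5b5486567b85567154582e655e51865564bd55648b51e4565564b855e61b56d5b85467515645e15152465415b655642d5751e65246b55568b755b82655876e54e6755815e651465e5658b755682b556bd25b465d5b62455b645e556e1b5e56b156e51b);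
  (true, 0x13, 0x15a,
    0x15857ab515dea545dab52aed5545dba554eab58a45755748a54a75158a5d754ab5755dba252a8d5554dba5aed15548ab55a75e1545aeb58ae7555dea251a8575ae4515abd4552a85b554aeb5a15de5157ea55e81a557e8a55b2a458ea155a85d75ae75154a15b5b5d4a5aeb54585ba2542ba55a154e5572a855d8a25dba25585a2b5b518a54157a5a85db528ab55abe45515e2a5a8e755ae45b5abd54582ab5545ba1554ab85158a75451ab575d8a5bae855a457b5d8a255851a75eb54a5abe855a157e5da7545aed58547a8558a2d55ad7585a2e45585dea5154ea);
  (true, 0x13, 0x15d, 0x13ed535d735db34d532d5315d35d435d2);
  (true, 0x13, 0x1cd, 0x13cdb3cd73cde34dc3edc38dc37dc3dc7);
  (true, 0x13, 0x1de, 0x13e5d3d5e3d6e3e6d3d9e);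
  (true, 0x1f, 0x103,
    0x150132d50231d50413e50823d5018235028135048b350231e5024d350e2d350d13250e2315083b450173b50437850e41350173e50437b5083b750b3785043b750237b50431e5073e8508e435013b450328d5032ed503de450423b);
  (true, 0x1f, 0x10f, 0x150de2f5082df50b14f50817f50218f50728f50bedf50d82f50d42f5041bf5082bf50b74f);
  (true, 0x1f, 0x113, 0x132133413331d3813331b331e37133b133431);
  (true, 0x1f, 0x117, 0x13137315731a7);
  (true, 0x1f, 0x135,
    0x151573b5451375235d754731551375d54b31551e23555e43b58153e53854751853e52751351523752351b55e83758235d58d52352135d54513e5238d55123e558e7355548b354153b5328d558573258532752375d557d835758135458b355873b51354e55e4b352e75358354753518e557e8355732d53154e5351e85e831555d3e253875d54de5358e5135735e15315e455d32e5d857355723d513e54534db55513be58453b553b4d5d853758137553e4d551d53e53754b57513d5845d3552e315e5137515e8353758e55782353b458532ed5583157)].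

Definition configs_N2 := Eval vm_compute in map cfg [::
  (false, 0x11, 0x102, 0x1202402e3402e940285402d3402f84024940f8240243);
  (false, 0x11, 0x106, 0x14046b4026440268404624086e406d840468);
  (false, 0x11, 0x10e, 0x120e40e2f40e8540e4f40e7540e2340e4540e8340e73);
  (false, 0x11, 0x123, 0x12232324e2394632d482364c32b432b54723949e23423fb4423a428a3442394a324);
  (false, 0x11, 0x125, 0x122525242e5344f52452e94235d4c52148f52425c7442594825f42ef54e2594d56246b25);
  (false, 0x11, 0x127,
    0x14cf724c7f242f7342375427354c237427f942c7949723462794f26742c574a23745729429f7);
  (false, 0x11, 0x12d,
    0x142fd942fd542cd34f2ad429d5425d94d2af423d94dfc2492df42ad5452ad4df25425d34d326);
  (false, 0x11, 0x12f, 0x12f222f42fe9442f3482f542f3142fa748cf24f2e54c2bf4f27942f58449f2482f3);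
  (false, 0x11, 0x16a,
    0x14ade6426da426ad4ae6246ab848a62462ae44a26468ba426a84a26d4da764a46d446ad446ab4aed646dea);
  (false, 0x11, 0x16e, 0x126e2e642e6544e69436ed48e6f456e246ed344e63436e4426ef4c6eb42e6946e79);
  (false, 0x11, 0x1ef, 0x12ef2fe44ef342ef542ef94afe749fe748ef34cfe248ef64bef546fe848ef547ef342efa);
  (false, 0x17, 0x103, 0x1408e34082340483404b340813408d34043b);
  (false, 0x17, 0x108, 0x12084084f4082f4081f408f1408ef408e9408df4081a);
  (false, 0x17, 0x10b, 0x120b40b8540b8f40b2340f8b40b2640bdf40bef40feb402bf);
  (false, 0x17, 0x112,
    0x141c2342913413264c12f423154a2f1413254c1f24f12c412af41f2a462f14913246231415624215f491f242c13);
  (false, 0x17, 0x116,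
    0x12612164816f429614612542f614618f418c641df648361416c242c6144a614a416485614618541ef6461ef46f8148f61);
  (false, 0x17, 0x119,
    0x1291481932194819642195418f9459124e19f441934419f419c24e1954f1944219649ab14391e);
  (false, 0x17, 0x11b,
    0x1419b641cb341abf41ab54ba914916b41fb3413bf41fb54169b4b3154bfc141bf6461bf4f1cb4bc5141fb645ab1416b54b31f41baf);
  (false, 0x17, 0x11f,
    0x12f121f48cf1481f5418cf42cf1421fc441fa418af4cf12481f34e1f54189f4e1f348af1486f141fc8481f6);
  (false, 0x17, 0x18b,
    0x148fb3489b648bf348ab5483bf48b3f4856b48fb5486b943bc848fb64c8fb468bf4bfc8458b648ba5);
  (false, 0x17, 0x19a,
    0x14a9d24ad92449ab49ea1429da4198a42a894a89d49ea449d2a4d9a2492a44a49b4b91a49ad1419ba4ae1944ea949ae1);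
  (false, 0x17, 0x19e,
    0x129e2e941f9e48e9f49e834259e44f9e4e9a141e9f469eb4893e4a9ed4159e49ebf48c9e46e9d42f9e48e95489ef);
  (false, 0x11, 0x101,
    0x14097140f41409e140681403414058140c2140a2140ae140f7140a81403b14032140f2140fb1409b1403e1405e140921);
  (false, 0x11, 0x103, 0x1408e3404234023440e23408234048340e3d);
  (false, 0x11, 0x107, 0x1207407e9408f7407e540927403e7407e340c2740749);
  (false, 0x11, 0x10f, 0x1408f44028f402fd408f24048f40df2407f8);
  (false, 0x11, 0x124, 0x144a254462542c43442a542643445f2446294245c42649449254432f44cf242f4a4924f);
  (false, 0x11, 0x126, 0x126244263226482654562b4426f426f44826f442694f624462b348263462e548269);
  (false, 0x11, 0x12c, 0x12c222c4c2b34c2bf482cf42c5b42c97442cf4c2734c729432ec4c27542c9e44fc242cf4);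
  (false, 0x11, 0x12e, 0x142ce342fe342fe94e32542ef94c2fe42fe54f23e425e34ce2f4f32e429fe425fe426e9);
  (false, 0x11, 0x167,
    0x12672764276948765478f648763469874367d467b54496745b7642673467d3467e54a67444769476f84c672469b742567);
  (false, 0x11, 0x16b,
    0x126b2b646be944c6b42c6b42b654b7a64b6a448f6b46b83436b84d36b4b7564649b4b6344863b4bea6);
  (false, 0x11, 0x16f, 0x1426fd446ef46ef846efb486f74ef764867f4fe86426ef462fb48f67468f746efd);
  (false, 0x17, 0x101, 0x12014018f40186401834012f40145401bf401e3401d5409e1);
  (false, 0x17, 0x107, 0x140f474058740f17403e740c27406b740a1740a8740fd740ae74098740fe7409b7);
  (false, 0x17, 0x109, 0x140e89408914019840982402944089d40429409b4);
  (false, 0x17, 0x10f, 0x14018f4028f408f1408f4408f24048f40f81);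
  (false, 0x17, 0x113,
    0x12312134831f4e1354213f4f3124813545e134213c4531e4b13544f314e13f431b6441354813f);
  (false, 0x17, 0x118,
    0x141c8f4198f41a8f4891548cf14891648fc148af1485134198648fa14f138486f14851a4891f468f14519848196);
  (false, 0x17, 0x11a,
    0x12a121a4a14f449a148fa14a186489a14581a49a144a1df41a384fa814a81541d9a4a9b141ace418a6481a945ab1);
  (false, 0x17, 0x11e,
    0x141aef41ce341cef41ae541fe649fe14e5134ef1546e914513e413ec415ea4a31e4e315419fe461e941fea4c16e4ef13);
  (false, 0x17, 0x189,
    0x12982894489f4189f4289f4a98d4689b4189c4698d42895448964a9844289649826482694298f4289c4189541893);
  (false, 0x17, 0x18f,
    0x128f2f8428f5418fa48fad448f34a18f418f64d8f5429f8448f948f9e4f8b6418f548fc14ef834f8e342cf8448f54ad8f);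
  (false, 0x17, 0x19b,
    0x129b2b948b9644b9f41b9f469b844b934f9b448b9542f9b438b94869b4169b459b844c9b4f9b249b4f49bd3)].

(** An empty list of patterns, here and in the next definition, belongs to three crossing edges at
    vertices of equal parity: five vertices of that parity face eight of the other, so at least
    three stay uncovered in each copy, where only one is allowed. *)
Definition configs_S3 := Eval vm_compute in map cfg [::
  (true, 0x1f, 0x1013, 0x150182350132d5013275013d250132b50138e501342501e2350713e50138250413b);
  (true, 0x1f, 0x1017, 0x13017307150a14750157b50197e50127c50c712507314509721);
  (true, 0x1f, 0x101f, 0x150128f50178f50142f50182f501bef50e71f50eb1f50124f);
  (true, 0x1f, 0x1037,
    0x150734b50273d50837d50137b50b47350738e50732850137e50d73b50237d50b73d50437b50738d);
  (true, 0x1f, 0x103d,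
    0x150d31e5028d350d23e503d845024d350e1d350d843504de350de23503d125034d850d73250de13);
  (true, 0x1f, 0x107b, 0x1307b30b750a7bd5072bc50b27c5073bd50b37850b7ce);
  (true, 0x1f, 0x1124, 0x1);
  (true, 0x1f, 0x1127, 0x1);
  (true, 0x1f, 0x112d, 0x1);
  (true, 0x1f, 0x1136,
    0x154831652136d5318e6531d6e56134d58b13656e31d58136b56231e5231465613d45671385d312652631b5e23165813d656318754e61356713e56318b56413752316853172656831758361b56731d58136756431b);
  (true, 0x1f, 0x113c,
    0x152c13d5231c752c31b5c13ed54831c5c13be5813ce58431c5c713b54c13b5213dc527c135c231b5cb2135cb81353c21d531dce5d231c5213c75314cb5e231c541c3e52ec135c137e);
  (true, 0x1f, 0x113e, 0x1313e3e3131e352139e55318e52e53133e15e813654e91352ec13);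
  (true, 0x1f, 0x116b, 0x13b61316b36b131b655216b);
  (true, 0x1f, 0x135a, 0x1);
  (true, 0x1f, 0x1012, 0x13012302150215e50281650c12b5018255024135014235012c450132d);
  (true, 0x1f, 0x1016, 0x150182650164b501246501b4650162d501d26501462501d62501b6450681b50184650126d);
  (true, 0x1f, 0x101e, 0x1301e30e15018e65012e95014e3501ce750a1ed5012e5);
  (true, 0x1f, 0x1035, 0x1);
  (true, 0x1f, 0x103c, 0x1);
  (true, 0x1f, 0x103f, 0x1);
  (true, 0x1f, 0x1123, 0x132313132312351327f33215ab13259b2315a7132);
  (true, 0x1f, 0x1125, 0x1325131523125352152e95155129d54291556b25152159b);
  (true, 0x1f, 0x112c, 0x131c232c1312c3c2152e1c95c219e52e15c51d2ca515c2e);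
  (true, 0x1f, 0x1135,
    0x158513755138758135e52315754513d53157b5275135831575e381554513b5415e355318e52514358135d5e851358e31557513455137e53158e5731e553e215521583543157);
  (true, 0x1f, 0x1137, 0x13137373133713173512c375137e555137e585731);
  (true, 0x1f, 0x113d, 0x13d31313d31d333d15db1365de91352d91355318d);
  (true, 0x1f, 0x116a,
    0x15a461d5461ba56a21d5a167e561ade521d6a56ea1d5a614e5a618b5a261b5216ad541a265a1647562a1e5a1d645a861758a126561a8e5a61de5ad1265a761d561da85816da58ad165a816b58621a5a618e56b14a58261a54a186541ab656a21758164a);
  (true, 0x1f, 0x1356, 0x1)].

Definition configs_N3 := Eval vm_compute in map cfg [::
  (false, 0x11, 0x1016, 0x1408614026140e6140d61406814076140b61);
  (false, 0x11, 0x1023, 0x14023e402374023b40e234023d40234);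
  (false, 0x11, 0x1025, 0x1402e540e25402854085240e524025b);
  (false, 0x11, 0x1027, 0x1407f2407a2402c740279407c24027f402a7402f7);
  (false, 0x11, 0x102d, 0x1402fd40df2402d3402d9402d5);
  (false, 0x11, 0x102f, 0x1402f4402f8402fd404f24024f4028f);
  (false, 0x11, 0x1036, 0x1);
  (false, 0x11, 0x103c, 0x1);
  (false, 0x11, 0x103e, 0x140e3840e3240e344083e40e8340e43);
  (false, 0x11, 0x1067, 0x14076840678407644076b4087640e764067e);
  (false, 0x11, 0x106b, 0x140b6840b6740b6440b8640b76);
  (false, 0x11, 0x106f, 0x1);
  (false, 0x11, 0x107e, 0x1407e3407fe40ea7407e9407e5);
  (false, 0x11, 0x10ef, 0x140efb40ef840ef740efd40ef2);
  (false, 0x11, 0x1236, 0x14623e4623d4832646237486234326e4623b48263);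
  (false, 0x11, 0x123e, 0x14e3254e329423ef4f23e423fe);
  (false, 0x11, 0x1247, 0x1);
  (false, 0x11, 0x1249, 0x142945429c442c94449f2494a244923449a2);
  (false, 0x11, 0x124b, 0x1);
  (false, 0x11, 0x124f, 0x144f2342f4544f294f24942fc44f24642f4a4f426);
  (false, 0x11, 0x125a, 0x148a2544a25452a7452ae485a24ad524452a442a5482a5);
  (false, 0x11, 0x125e, 0x1425e34e523425e9425ea452e9452ce4e562);
  (false, 0x11, 0x126a, 0x14462a4a26e462ae4862a4ad62462ad4d6a244a26);
  (false, 0x11, 0x126c, 0x14462c4c26b4c2674b62c46dc24ce26486c2462ec4627c4426c4c2b6);
  (false, 0x11, 0x126e, 0x1426e5426e34ae624e629462e9426ef4a26e46e9242e65);
  (false, 0x11, 0x127b, 0x1);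
  (false, 0x11, 0x127d, 0x1);
  (false, 0x11, 0x127f, 0x142f794c7f242f734f79242f754f3274f7254f7a247f294a7f2);
  (false, 0x11, 0x12ce, 0x142ce542ce942ce34c2fe42cef4cef24cf2e4ca2e4ec23);
  (false, 0x11, 0x12de, 0x1);
  (false, 0x11, 0x12ef, 0x142fe942fe542fe342fe642fea4fe2c4ef2342efc4ef62);
  (false, 0x11, 0x167e, 0x14fe67476ef4e679467e949e6746e7946ef74f76e);
  (false, 0x11, 0x16ad, 0x142ad64aed64ade646bad46ead44ad64ad464ea6d464ad4b6ad446da4a46d);
  (false, 0x11, 0x16af, 0x1);
  (false, 0x11, 0x16ef, 0x146efd426ef46ef7486ef46ef8446fe446ef);
  (false, 0x17, 0x1013, 0x140132401384013e401344083140813401e34013b);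
  (false, 0x17, 0x1017, 0x1401974013740157401f7);
  (false, 0x17, 0x1019, 0x1401984019e40e91402194089140291);
  (false, 0x17, 0x101b, 0x140bc14019b401b5401cb401b940b31401b6);
  (false, 0x17, 0x101f, 0x1401fe401f8408f14018f4012f4014f40ef1);
  (false, 0x17, 0x1038, 0x14083b408d340d8340b384083d408e3);
  (false, 0x17, 0x103b, 0x140b3e40b3840b324013b40bd34023b);
  (false, 0x17, 0x103d, 0x140d3e40b3d40d3440d8340db3);
  (false, 0x17, 0x1078, 0x14089740857408f74086740837408a7);
  (false, 0x17, 0x1089, 0x1408914089240894408e9404894028940e894089b);
  (false, 0x17, 0x108f, 0x1408f2408f4408f14081f408fe);
  (false, 0x17, 0x109b, 0x140b9440b9840b9e40b9140b92409b8409b4);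
  (false, 0x17, 0x109f, 0x1);
  (false, 0x17, 0x10bf, 0x140bfe40bfd40bf440dfb401bf40bf8);
  (false, 0x17, 0x1124, 0x1);
  (false, 0x17, 0x1128, 0x1);
  (false, 0x17, 0x112b, 0x1);
  (false, 0x17, 0x112d, 0x1);
  (false, 0x17, 0x1138, 0x1483154831f4813f451384318643816483614813543c8145318);
  (false, 0x17, 0x113a, 0x14231a4431a4a13843ea148a134a1d34a13b4a132483a1443a14a1344213a);
  (false, 0x17, 0x1168, 0x1498614618f416c848619468f146189468914861546183);
  (false, 0x17, 0x116a, 0x1461ae4a1e64ae614b61a462a146ea14614a4ea16468a14a146486a14a16d);
  (false, 0x17, 0x118a, 0x141a8f498a14f8a141a864a891438a148a6141a834a18349a81);
  (false, 0x17, 0x118e, 0x1);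
  (false, 0x17, 0x119a, 0x14891a49ea14491a4e91a4291a4a8914ae194a1924ae914819a);
  (false, 0x17, 0x119e, 0x14519e4e9134e9154a19e4f19e4913e46e91419ce4ce91491fe4c19e);
  (false, 0x17, 0x11ab, 0x149ba14ba9141abf41ab54ab1345ba14ab194ab514ba1c41ab64ab1549ab14a91b);
  (false, 0x17, 0x11ad, 0x141ad341da341afd4a19d4a13d4da164da314adc1431ad4a1df4adf1);
  (false, 0x17, 0x11af, 0x148af144af14aef14f1da4a1f84ea1f42f1a4a1f44daf14a14f);
  (false, 0x17, 0x11be, 0x1);
  (false, 0x17, 0x11ef, 0x14aef14cef149ef146ef1491fe419fe41fea41fe541fe341efc4afe1);
  (false, 0x17, 0x189b, 0x14a89b4b986489bf4689b498b6498fb4b98a489b6489b5);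
  (false, 0x17, 0x189f, 0x14498f4298f4198f4f89e4e98f498f141f894189f);
  (false, 0x17, 0x19ab, 0x144ab948ab9449ab49ba44ab984a49b419ab419ba494ab);
  (false, 0x17, 0x19ad, 0x14ad9b489da429da4e9da449da4a89d41a9d49da148d9a41d9a42d9a);
  (false, 0x11, 0x1012, 0x14029140251402f1402c14023140261);
  (false, 0x11, 0x101e, 0x140e9140e5140e3140ef1);
  (false, 0x11, 0x1024, 0x140249402f4402a44024f40423404624042f40429);
  (false, 0x11, 0x1026, 0x140264402684026b404624026e4026d);
  (false, 0x11, 0x102c, 0x1402ce407c240bc24027c4072c);
  (false, 0x11, 0x102e, 0x140ef2402ce402e9402e5402ef);
  (false, 0x11, 0x1035, 0x1);
  (false, 0x11, 0x1037, 0x14073e4073440738407d3407e34073b4073d);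
  (false, 0x11, 0x103d, 0x140de340d3240ed340e3d4043d4083d);
  (false, 0x11, 0x103f, 0x1);
  (false, 0x11, 0x106a, 0x1);
  (false, 0x11, 0x106e, 0x140e6b40e6d40e6840e644086e40e62);
  (false, 0x11, 0x107b, 0x1407cb407b540bc7407b9407bc);
  (false, 0x11, 0x107f, 0x1407f8407fe407f24047f408f7407fb);
  (false, 0x11, 0x1234, 0x14432f4423f4f2344432a443264423a44325);
  (false, 0x11, 0x123c, 0x14c2374c23b4c23d4c23e4b32c4ce324432c432ce);
  (false, 0x11, 0x1246, 0x14462342643426494264f446294f2644264a4f6244246a);
  (false, 0x11, 0x1248, 0x1);
  (false, 0x11, 0x124a, 0x144a2944a2344a25462a44a24f44a2f4a4f24f2a4442a5);
  (false, 0x11, 0x124e, 0x1);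
  (false, 0x11, 0x1256, 0x14526b4526e486254856245268486524562b);
  (false, 0x11, 0x125b, 0x14fb524a25b4b5c2452cb425fb425b945b62452fb);
  (false, 0x11, 0x1267, 0x1476234f7624c762462754627946725497624a2674267942675);
  (false, 0x11, 0x126b, 0x1462fb4f26b4a26b4b623462bc462b54c26b4b62f4b62c4526b);
  (false, 0x11, 0x126d, 0x14f26d4a26d4d6234d6294d6254623d462ad4d62a4926d4f62d);
  (false, 0x11, 0x126f, 0x14862f4462f4426f46df24f26b48f264f26e4f62e44f26);
  (false, 0x11, 0x127c, 0x14c2a74c2f74c7f242ca74f7c242cf74c2734c27f4c279);
  (false, 0x11, 0x127e, 0x1);
  (false, 0x11, 0x12cd, 0x142cd34fdc242cd54c2fd4cd324c25d4dc234c23d429cd4cd2f4fcd2);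
  (false, 0x11, 0x12cf, 0x14c2fb4c2fd4c7f24c2f748cf24c2fe4cbf244cf2);
  (false, 0x11, 0x12df, 0x142fd54cdf242fd94df254df29432fd4df234fd3243f2d42fd3);
  (false, 0x11, 0x167a, 0x14a76e48a764a76d4467a4ae764a867468a74ae6748a674a8764d67a46a874a67e);
  (false, 0x11, 0x16ac, 0x1);
  (false, 0x11, 0x16ae, 0x14ae674ae6d46ead46ea24ae6248a6e46ea446eda46eab46eba446ea46dea4ae76);
  (false, 0x11, 0x16be, 0x14b6e54fe6b45e6b46efb4b6ef4f6eb4e6bf4e6cb4be65);
  (false, 0x17, 0x1012, 0x14012f402a1401c240291401f24012640219401a2);
  (false, 0x17, 0x1016, 0x1401684016e4016d401e64026140162401644016b);
  (false, 0x17, 0x1018, 0x1408914019840813401a8408614018f408154081f);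
  (false, 0x17, 0x101a, 0x1401ab401ae408a1401a8404a140a81401a2);
  (false, 0x17, 0x101e, 0x140ea140e91401e34019e401e940ef1401e5);
  (false, 0x17, 0x1035, 0x1);
  (false, 0x17, 0x1039, 0x1);
  (false, 0x17, 0x103c, 0x1);
  (false, 0x17, 0x103f, 0x1);
  (false, 0x17, 0x1079, 0x14089740e974029740497);
  (false, 0x17, 0x108b, 0x1408cb4089b40c8b40ba8408b54085b408b6);
  (false, 0x17, 0x109a, 0x1);
  (false, 0x17, 0x109e, 0x140e9240e9440e9d4089e40e984019e);
  (false, 0x17, 0x10bd, 0x140bcd40dab40d9b40bd540bd340b6d);
  (false, 0x17, 0x1123, 0x14231f423154132f413264f1324f2314132c4231c4c1324a231);
  (false, 0x17, 0x1125, 0x14251f4251346152451f245132425164512a4251a41562435124f152);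
  (false, 0x17, 0x1129, 0x14291f42915429164912a4291a451924f1924912f4f912426914a1924c192);
  (false, 0x17, 0x112c, 0x141c9242c914a1c24c1a24c12f4c21f4c2f1492c141c294c291);
  (false, 0x17, 0x112f, 0x141f924c1f24a2f14f12c4c2f14f2a14f1324f23141fc2461f24f32141fa2);
  (false, 0x17, 0x1139, 0x14913b48913423194913242391431984491344391429134b9134319b);
  (false, 0x17, 0x113c, 0x14c13e4c31e4231c4c13242c314c1384c13b4b31c4cb314c3184314c4213c);
  (false, 0x17, 0x1169, 0x14619e48916429164689144916469814e9164e6914469142691);
  (false, 0x17, 0x1189, 0x14a8914c8914198f4f891489164198c4198a498f14891348915);
  (false, 0x17, 0x118b, 0x1);
  (false, 0x17, 0x118f, 0x148fc141f8541f86498f14f8c148fa141f83468f14f1584f13848cf1);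
  (false, 0x17, 0x119b, 0x14b913419bf4b91f49ba14fb914916b4ba91491b649b164319b419b6419b3);
  (false, 0x17, 0x119f, 0x14491f4891f4291f49ef14f1924f194498f14fe914e19f48f19);
  (false, 0x17, 0x11ac, 0x14a1ce48ac14aec144c1a4a8c14c8a14c1ae4a2c142a1c44ac14cea148ca1);
  (false, 0x17, 0x11ae, 0x149ea141aef41eaf4fea14a1e545ea14ea154ae194a15e4a1fe4fae1);
  (false, 0x17, 0x11bd, 0x1);
  (false, 0x17, 0x11bf, 0x14bfc141fb341fcb41fb64bfa14fb914fb314bf6141fbc45bf1);
  (false, 0x17, 0x189a, 0x144a8942a894198a4498a498a4498ab4a89b4a89e4b9a84189a);
  (false, 0x17, 0x189e, 0x14a89e498e549e854c89e4589e4e9f84e98a498e64e98f4389e498e3);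
  (false, 0x17, 0x18bd, 0x1);
  (false, 0x17, 0x19ac, 0x1)].

Local Close Scope N_scope.

Definition certs_S0 := Eval vm_compute in map (gcert 4) configs_S0.

Lemma verified_S0 : verified configs_S0.
Proof. by apply: (@all2_verified _ certs_S0); vm_cast_no_check (erefl true). Qed.

Lemma exhaustive_S0 : exhaustive true 0 configs_S0 wS.
Proof. by vm_cast_no_check (erefl true). Qed.

Definition certs_N0 := Eval vm_compute in map (gcert 4) configs_N0.

Lemma verified_N0 : verified configs_N0.
Proof. by apply: (@all2_verified _ certs_N0); vm_cast_no_check (erefl true). Qed.

Lemma exhaustive_N0 : exhaustive false 0 configs_N0 wN.
Proof. by vm_cast_no_check (erefl true). Qed.

Definition certs_S1 := Eval vm_compute in map (gcert 4) configs_S1.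

Lemma verified_S1 : verified configs_S1.
Proof. by apply: (@all2_verified _ certs_S1); vm_cast_no_check (erefl true). Qed.

Lemma exhaustive_S1 : exhaustive true 1 configs_S1 wS.
Proof. by vm_cast_no_check (erefl true). Qed.

Definition certs_N1 := Eval vm_compute in map (gcert 4) configs_N1.

Lemma verified_N1 : verified configs_N1.
Proof. by apply: (@all2_verified _ certs_N1); vm_cast_no_check (erefl true). Qed.

Lemma exhaustive_N1 : exhaustive false 1 configs_N1 wN.
Proof. by vm_cast_no_check (erefl true). Qed.

Definition certs_S2 := Eval vm_compute in map (gcert 4) configs_S2.

Lemma verified_S2 : verified configs_S2.
Proof. by apply: (@all2_verified _ certs_S2); vm_cast_no_check (erefl true). Qed.

Lemma exhaustive_S2 : exhaustive true 2 configs_S2 wS.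
Proof. by vm_cast_no_check (erefl true). Qed.

Definition certs_N2 := Eval vm_compute in map (gcert 4) configs_N2.

Lemma verified_N2 : verified configs_N2.
Proof. by apply: (@all2_verified _ certs_N2); vm_cast_no_check (erefl true). Qed.

Lemma exhaustive_N2 : exhaustive false 2 configs_N2 wN.
Proof. by vm_cast_no_check (erefl true). Qed.

Definition certs_S3 := Eval vm_compute in map (gcert 4) configs_S3.

Lemma verified_S3 : verified configs_S3.
Proof. by apply: (@all2_verified _ certs_S3); vm_cast_no_check (erefl true). Qed.

Lemma exhaustive_S3 : exhaustive true 3 configs_S3 [:: V true true true true].
Proof. by vm_cast_no_check (erefl true). Qed.

Definition certs_N3 := Eval vm_compute in map (gcert 4) configs_N3.

Lemma verified_N3 : verified configs_N3.
Proof. by apply: (@all2_verified _ certs_N3); vm_cast_no_check (erefl true). Qed.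

Lemma exhaustive_N3 : exhaustive false 3 configs_N3 wN.
Proof. by vm_cast_no_check (erefl true). Qed.

Definition configs (sep : bool) (k : nat) : seq config :=
  match sep, k with
  | true, 0 => configs_S0 | true, 1 => configs_S1 | true, 2 => configs_S2 | true, _ => configs_S3
  | false, 0 => configs_N0 | false, 1 => configs_N1 | false, 2 => configs_N2 | false, _ => configs_N3
  end.

Lemma few_directions_base : few_directions_extend 5.
Proof.
move=> m u v mm _ puv g.
apply: (@base_ham configs _ _ exhaustive_N3 exhaustive_S3 m u v mm puv g).
- case=> -[|[|[|[|//]]]] _.
  + exact: verified_S0.
  + exact: verified_S1.
  + exact: verified_S2.
  + exact: verified_S3.
  + exact: verified_N0.
  + exact: verified_N1.
  + exact: verified_N2.
  + exact: verified_N3.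
- case=> -[|[|[|//]]] _.
  + exact: exhaustive_S0.
  + exact: exhaustive_S1.
  + exact: exhaustive_S2.
  + exact: exhaustive_N0.
  + exact: exhaustive_N1.
  + exact: exhaustive_N2.
Qed.

Theorem few_directions n : 5 <= n -> few_directions_extend n.
Proof.
elim: n => // n IH; rewrite leq_eqVlt => /predU1P[[<-]|n5]; first exact: few_directions_base.
by apply: few_directions_step => //; apply: IH.
Qed.

(** * Back to sets of edges *)

Section Translation.

Variables (n : nat) (M : {set {set cube n}}).
Hypothesis mM : matching M.
Implicit Types (x y u v : cube n) (i j : 'I_n).

Definition edge_pred (x : cube n) (i : 'I_n) := [set x; flip x i] \in M.

Let m := edge_pred.

Lemma set2_flip (x y : cube n) i : (y \in [set x; flip x i]) -> [set y; flip y i] = [set x; flip x i].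
Proof. by rewrite !inE => /orP[] /eqP-> //; rewrite flipK setUC. Qed.

Lemma edge_pred_ismat : ismat m.
Proof.
split=> [x i|x i j]; rewrite /m /edge_pred; first by rewrite flipK setUC.
move=> mi mj; have [_ /trivIsetP tr] := mM.
have [e|/(tr _ _ mi mj)/disjointFr/(_ (set21 _ _))] := eqVneq [set x; flip x i] [set x; flip x j].
  have : flip x i \in [set x; flip x j] by rewrite -e set22.
  by rewrite !inE (negPf (flip_neq x i)) => /eqP/flip_injr.
by rewrite set21.
Qed.

Lemma edge_pred_dset : #|dset m| <= #|directions M|.
Proof.
apply: subset_leq_card; apply/subsetP => i; rewrite !inE => /existsP[x mx].
apply/existsP; exists x; apply/existsP; exists (flip x i).
rewrite -[_ \in M]/(m x i) mx flipE eqxx; by case: (x i).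
Qed.

Lemma edge_flip e : e \in M -> exists x i, e = [set x; flip x i].
Proof.
have [/subsetP sub _] := mM; move/sub; rewrite inE => /existsP[x /existsP[y /andP[/qadjP[i ->] /eqP->]]].
by exists x, i.
Qed.

Lemma edge_pred_ends u v : [set u; v] \in M -> exists2 i, v = flip u i & m u i.
Proof.
move=> uv; have [x [i e]] := edge_flip uv; have ue : u \in [set x; flip x i] by rewrite -e set21.
have e' := set2_flip ue; have vu : v \in [set u; flip u i] by rewrite e' -e set22.
have fu : flip u i \in [set u; v] by rewrite e -e' set22.
have vE : v = flip u i by move: fu; rewrite !inE (negPf (flip_neq u i)) => /eqP.
by exists i => //; rewrite /m /edge_pred -vE.
Qed.

(** The definition of a half-layer uses the end whose coordinate [i] is 0. There [typ i] is the
    parity, and along the edge [typ i] is constant, so either end may be used. *)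
Lemma mem_half_layer x i p : ([set x; flip x i] \in half_layer i p) = (typ i x == p).
Proof.
have ty y : ~~ y i -> typ i y = parity y by rewrite /typ => /negPf->.
apply/imsetP/eqP => [[y]|tx].
  rewrite !inE => /andP[yi /eqP <-] e; rewrite -(ty _ yi).
  have : x \in [set y; flip y i] by rewrite -e set21.
  by rewrite !inE => /orP[] /eqP-> //; rewrite typ_flip eqxx addbF.
have [xi|xi] := boolP (x i).
  exists (flip x i); last by rewrite flipK setUC.
  have fi : ~~ flip x i i by rewrite flipE eqxx xi.
  by rewrite !inE fi -(ty _ fi) typ_flip eqxx addbF tx eqxx.
by exists x => //; rewrite !inE xi -(ty _ xi) tx eqxx.
Qed.

Lemma half_layer_edge e i p : e \in half_layer i p -> exists x, e = [set x; flip x i].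
Proof. by case/imsetP => x _ ->; exists x. Qed.

Lemma half_layer_sub i p : half_layer i p \subset M <-> forall x, typ i x = p -> m x i.
Proof.
split=> [/subsetP h x /eqP tx|h]; first by apply: h; rewrite mem_half_layer.
apply/subsetP => e he; have [x ex] := half_layer_edge he; rewrite ex; apply: h.
by apply/eqP; rewrite -mem_half_layer -ex.
Qed.

Lemma covered_half_layer u i p : covered u (half_layer i p) <-> typ i u = p.
Proof.
split=> [[e he ue]|tu].
  have [x ex] := half_layer_edge he; rewrite ex in he ue.
  by apply/eqP; rewrite -mem_half_layer (set2_flip ue).
by exists [set u; flip u i]; rewrite ?set21 // mem_half_layer tu.
Qed.

Lemma C1E u v : C1 u v M <-> c1 m u v.
Proof.
split=> [[i [p [/half_layer_sub h /covered_half_layer tu /covered_half_layer tv]]]|/c1P[i tv h]].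
  by apply/c1P; exists i => [|x tx]; [rewrite tu tv|apply: h; rewrite tx].
exists i, (typ i u); split; first exact/half_layer_sub.
  exact/covered_half_layer.
exact/covered_half_layer.
Qed.

Lemma C2E u v : C2 u v M <-> c2 m u v.
Proof.
split=> [[i [j [ij vE [A [p hp ->] /subsetP sub] mu mv]]]|/c2P[i [j [ij vE mu mv h]]]].
  apply/c2P; exists i, j; split=> // x tx xu xv; apply: sub.
  rewrite mem_half_layer in hp; rewrite !inE mem_half_layer tx hp andbT.
  apply/eqP => e; have : x \in [set u; flip u i] by rewrite -e set21.
  by rewrite !inE -vE => /orP[] /eqP.
exists i, j; split=> //.
exists (half_layer i (typ i u) :\ [set u; flip u i]).
  by exists (typ i u); rewrite ?mem_half_layer.
apply/subsetP => e; rewrite !inE => /andP[ne he]; have [x ex] := half_layer_edge he.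
rewrite {}ex mem_half_layer in ne he *; apply: h; first exact/eqP.
  by move=> xu; rewrite xu eqxx in ne.
by move=> xv; move: ne; rewrite xv vE flipK setUC eqxx.
Qed.

Lemma C3E u v : C3 u v M <-> c3 m u v.
Proof.
split=> [/edge_pred_ends h|/c3P[i ->]]; first exact/c3P.
exact.
Qed.

Lemma path_edgesP (u : cube n) s e : (e \in path_edges u s) <->
  exists x y, cons2 (u :: s) x y /\ e = [set x; y].
Proof.
elim: s u => [|y s IH] u.
  by split=> // -[x [y [[[|? [|? ?]] [? []]]]]].
rewrite -[path_edges u (y :: s)]/([set u; y] :: path_edges y s) inE; split.
  case/orP => [/eqP->|/IH[a [b [[p [q E]] ->]]]]; first by exists u, y; split=> //; exists [::], s.
  by exists a, b; split=> //; exists (u :: p), q; rewrite E.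
case=> a [b [[[|w p] [q E]] ab]]; first by case: E => -> -> _; rewrite ab eqxx.
case: E => _ E; apply/orP; right; apply: (IH y).2; exists a, b; split=> //; by exists p, q.
Qed.

Lemma extends_ham u v : extends_to_hamilton_path u v M <-> exists s, ham m u v s.
Proof.
split=> [[s hs sub]|[s [hs hm]]]; exists s => //.
  split=> // x i /sub/path_edgesP[a [b [ab e]]].
  have xab : x \in [set a; b] by rewrite -e set21.
  have fab : flip x i \in [set a; b] by rewrite -e set22.
  move: xab fab; rewrite !inE => /orP[] /eqP xE /orP[] /eqP fE.
  - by move: (flip_neq x i); rewrite fE xE eqxx.
  - by left; rewrite fE xE.
  - by right; rewrite fE xE.
  - by move: (flip_neq x i); rewrite fE xE eqxx.
move=> e eM; have [x [i ex]] := edge_flip eM; rewrite ex in eM *.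
apply/path_edgesP; case: (hm x i eM) => c; first by exists x, (flip x i).
by exists (flip x i), x; rewrite setUC.
Qed.

End Translation.

Theorem theorem8 (n : nat) (u v : cube n) (M : {set {set cube n}}) :
  5 <= n ->
  parity u != parity v ->
  matching M ->
  #|directions M| <= 5 ->
  extends_to_hamilton_path u v M <-> ~ C1 u v M /\ ~ C2 u v M /\ ~ C3 u v M.
Proof.
move=> n5 puv mM dM; have mm := edge_pred_ismat mM.
have goodE : good (edge_pred M) u v <-> ~ C1 u v M /\ ~ C2 u v M /\ ~ C3 u v M.
  have [g1 g2] := goodP (edge_pred M) u v.
  have [h1 h1'] := C1E M u v; have [h2 h2'] := C2E M u v; have [h3 h3'] := C3E mM u v.
  by split=> [/g1[a b c]|[a [b c]]]; [|apply: g2]; split; auto.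
have [gd1 gd2] := goodE; split=> [/(extends_ham mM)[s hs]|/gd2 gd].
  apply: gd1; exact: (ham_good (leq_trans (isT : 2 < 5) n5) hs).
apply/(extends_ham mM).
have [s [_ [_ [[hs _ _] _]]]] := few_directions n5 mm (leq_trans (edge_pred_dset M) dM) puv gd.
by exists s.
Qed.
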